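(* Let $H$ be an operator on a complex Banach space $\mathcal{B}$ satisfying the standing hypothesis stated in the context, and let $f\in\mathcal{A}$. Then $$\overline{f(\sigma(H))}\subseteq\sigma(f(H)).$$
   Context: Write $\langle z\rangle:=(1+|z|^2)^{1/2}$ for $z\in\mathbf{C}$. Standing hypothesis on $H$: $H$ is a closed densely defined operator on a complex Banach space $\mathcal{B}$ with spectrum $\sigma(H)\subseteq\mathbf{R}$, and there are constants $c>0$, $\alpha\ge 0$ such that $\|(z-H)^{-1}\|\le c\,|\mathrm{Im}\,z|^{-1}\left(\frac{\langle z\rangle}{|\mathrm{Im}\,z|}\right)^{\alpha}$ for all $z\notin\mathbf{R}$. Algebra $\mathcal{A}$: for $\beta\in\mathbf{R}$, $S^\beta$ is the set of smooth $f:\mathbf{R}\to\mathbf{C}$ such that for every $n\ge 0$ there is $c_n>0$ with $|f^{(n)}(x)|\le c_n\langle x\rangle^{\beta-n}$ for all $x$; $\mathcal{A}:=\bigcup_{\beta<0}S^\beta$, an algebra under pointwise multiplication. Functional calculus: let $\tau(x,y)=\tau_0(y/\langle x\rangle)$ with $\tau_0\in C^\infty(\mathbf{R})$, $\tau_0(t)=1$ for $|t|\le1$, $\tau_0(t)=0$ for $|t|\ge2$. For $f\in\mathcal{A}$ and an integer $n>\alpha$ put $\tilde f(x,y):=\left(\sum_{r=0}^n f^{(r)}(x)\frac{(iy)^r}{r!}\right)\tau(x,y)$, $\frac{\partial\tilde f}{\partial\bar z}:=\frac12\left(\frac{\partial\tilde f}{\partial x}+i\frac{\partial\tilde f}{\partial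 y}\right)$, and $$f(H):=-\frac1\pi\iint_{\mathbf{C}}\frac{\partial\tilde f}{\partial\bar z}(z-H)^{-1}\,dx\,dy,\qquad z=x+iy.$$ The integral is norm convergent and independent of the choice of $n>\alpha$ and of $\tau$. Also $f(\sigma(H)):=\{f(x):x\in\sigma(H)\}$. *)

(* Defs.v *)
From HB Require Import structures.
From mathcomp Require Import all_boot all_order all_algebra.
From mathcomp Require Import complex.
From mathcomp Require Import all_classical all_reals all_analysis.

Set Implicit Arguments.
Unset Strict Implicit.
Unset Printing Implicit Defensive.

Import Order.TTheory GRing.Theory Num.Theory.
Import numFieldNormedType.Exports.

Local Open Scope classical_set_scope.
Local Open Scope ring_scope.
Local Open Scope complex_scope.

(* A complex Banach space is a [completeNormedModType R[i]] with [R : realType].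
   Its norm takes values in [R[i]] (nonnegative real elements); [rnorm] is the
   same norm with values in [R]. *)
Definition rnorm (R : realType) (V : normedModType R[i]) (x : V) : R :=
  complex.Re `|x|.

Lemma rnormE (R : realType) (V : normedModType R[i]) (x : V) :
  (rnorm x)%:C = `|x|.
Proof. by apply: RRe_real; exact: normr_real. Qed.

Section bounded_operators.
Context {R : realType} {B : normedModType R[i]}.

Definition bounded_op_pred : {pred B -> B} :=
  fun T => `[< linear T /\ exists M : R, forall x, rnorm (T x) <= M * rnorm x >].

Record bounded_op := BoundedOp {
  bop_fun :> B -> B ;
  _ : bop_fun \in bounded_op_pred }.

HB.instance Definition _ := [isSub for bop_fun].
HB.instance Definition _ := [Choice of bounded_op by <:].

Lemma rnormD (x y : B) : rnorm (x + y) <= rnorm x + rnorm y.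
Proof. by rewrite -lecR rmorphD/= !rnormE ler_normD. Qed.

Lemma rnormZ (a : R[i]) (x : B) : rnorm (a *: x) = complex.Re `|a| * rnorm x.
Proof.
by apply: (@complexI R); rewrite rmorphM/= !rnormE normrZ (RRe_real (normr_real a)).
Qed.

Lemma rnorm_ge0 (x : B) : 0 <= rnorm x.
Proof. by rewrite -ler0c rnormE. Qed.

Lemma rnorm0 : rnorm (0 : B) = 0.
Proof. by rewrite /rnorm normr0. Qed.

Lemma rnorm_eq0 (x : B) : rnorm x = 0 -> x = 0.
Proof. by move=> x0; apply/normr0_eq0; rewrite -rnormE x0. Qed.

Lemma bounded_op_submod_closed : submod_closed bounded_op_pred.
Proof.
split=> [|a S T].
  apply/asboolP; split; first by move=> b x y; rewrite scaler0 addr0.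
  by exists 0 => x; rewrite mul0r rnorm0.
move=> /asboolP[linS [M SM]] /asboolP[linT [N TN]]; apply/asboolP; split.
  move=> b x y; rewrite !fctE/= linS linT !scalerDr !scalerA (mulrC a b) addrACA.
  by [].
exists (complex.Re `|a| * M + N) => x; rewrite !fctE/= mulrDl.
apply: (le_trans (rnormD _ _)); rewrite lerD// rnormZ -mulrA ler_wpM2l//.
by rewrite -ler0c RRe_real// normr_real.
Qed.

HB.instance Definition _ :=
  GRing.isSubmodClosed.Build R[i] (B -> B) bounded_op_pred bounded_op_submod_closed.
HB.instance Definition _ := [SubChoice_isSubLmodule of bounded_op by <:].

Definition opnorm (T : bounded_op) : R :=
  sup [set rnorm (T x) | x in [set x : B | rnorm x <= 1]].

Lemma bounded_op_linear (T : bounded_op) : linear T.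
Proof. by case: T => T /= /asboolP[]. Qed.

Lemma bounded_opP (T : bounded_op) :
  exists M : R, forall x, rnorm (T x) <= M * rnorm x.
Proof. by case: T => T /= /asboolP[]. Qed.

Lemma bounded_op0 (T : bounded_op) : T 0 = 0.
Proof.
have := bounded_op_linear T (-1) 0 0.
by rewrite scaler0 addr0 scaleN1r addNr.
Qed.

Lemma bounded_opZ (T : bounded_op) a x : T (a *: x) = a *: T x.
Proof.
by have := bounded_op_linear T a x 0; rewrite !addr0 bounded_op0 addr0.
Qed.

Lemma bounded_opDE (S T : bounded_op) x : (S + T) x = S x + T x.
Proof. by []. Qed.

Lemma bounded_opZE a (T : bounded_op) x : (a *: T) x = a *: T x.
Proof. by []. Qed.

Lemma opnorm_has_sup (T : bounded_op) :
  has_sup [set rnorm (T x) | x in [set x : B | rnorm x <= 1]].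
Proof.
split; first by exists (rnorm (T 0)), 0 => //=; rewrite rnorm0.
have [M TM] := bounded_opP T; exists `|M| => _ [x /= x1 <-].
apply: (le_trans (TM x)); apply: (@le_trans _ _ (`|M| * rnorm x)).
  by rewrite ler_wpM2r ?rnorm_ge0// ler_norm.
by rewrite -[leRHS]mulr1 ler_wpM2l.
Qed.

Lemma opnorm_ub (T : bounded_op) x : rnorm x <= 1 -> rnorm (T x) <= opnorm T.
Proof.
by move=> x1; apply: ub_le_sup; [exact: (opnorm_has_sup T).2|exists x].
Qed.

Lemma opnorm_ge0 (T : bounded_op) : 0 <= opnorm T.
Proof.
by apply: (le_trans (rnorm_ge0 (T 0))); apply: opnorm_ub; rewrite rnorm0.
Qed.

Lemma opnorm_le (T : bounded_op) M :
  (forall x, rnorm x <= 1 -> rnorm (T x) <= M) -> opnorm T <= M.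
Proof.
move=> TM; apply: ge_sup; first exact: (opnorm_has_sup T).1.
by move=> _ [x /= x1 <-]; exact: TM.
Qed.

Lemma opnormP (T : bounded_op) x : rnorm (T x) <= opnorm T * rnorm x.
Proof.
have [->|x0] := eqVneq x 0; first by rewrite bounded_op0 rnorm0 mulr0.
have nx0 : 0 < rnorm x.
  by rewrite lt_def rnorm_ge0 andbT; apply: contra_neq x0; exact: rnorm_eq0.
have nV : complex.Re `|((rnorm x)^-1)%:C| = (rnorm x)^-1.
  by rewrite normc_def/= expr0n/= addr0 sqrtr_sqr ger0_norm// invr_ge0 ltW.
rewrite -ler_pdivrMr// mulrC.
rewrite -[in leLHS]nV -rnormZ -bounded_opZ; apply: opnorm_ub.
by rewrite rnormZ nV mulVf// gt_eqF.
Qed.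

Lemma opnormD (S T : bounded_op) : (opnorm (S + T))%:C <= (opnorm S)%:C + (opnorm T)%:C.
Proof.
rewrite -rmorphD lecR; apply: opnorm_le => x x1; rewrite bounded_opDE.
by apply: (le_trans (rnormD _ _)); rewrite lerD// opnorm_ub.
Qed.

Lemma opnormZ_le a (T : bounded_op) : opnorm (a *: T) <= complex.Re `|a| * opnorm T.
Proof.
apply: opnorm_le => x x1; rewrite bounded_opZE rnormZ ler_wpM2l ?opnorm_ub//.
by rewrite -ler0c RRe_real// normr_real.
Qed.

Lemma opnorm_eq0 (T : bounded_op) : (opnorm T)%:C = 0 -> T = 0.
Proof.
move=> /(@complexI R) T0; apply/val_inj/funext => x; apply: rnorm_eq0; apply/le_anti.
by rewrite rnorm_ge0 andbT; have := opnormP T x; rewrite T0 mul0r.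
Qed.

Lemma opnormZ a (T : bounded_op) : (opnorm (a *: T))%:C = `|a| * (opnorm T)%:C.
Proof.
rewrite -(RRe_real (normr_real a)) -rmorphM; congr (_%:C).
apply/le_anti; rewrite opnormZ_le andTb.
have [->|a0] := eqVneq a 0; first by rewrite normr0 mul0r opnorm_ge0.
have na0 : 0 < complex.Re `|a|.
  by rewrite -ltcR RRe_real ?normr_real// normr_gt0.
have nV : complex.Re `|a^-1| = (complex.Re `|a|)^-1.
  apply: (@complexI R).
  by rewrite fmorphV !RRe_real ?normr_real// normfV.
rewrite -ler_pdivlMl// -nV -[in leLHS](scale1r T) -(mulVf a0) -scalerA.
exact: opnormZ_le.
Qed.

HB.instance Definition _ := @Lmodule_isNormed.Build R[i] bounded_op
  (fun T => (opnorm T)%:C) opnormD opnormZ opnorm_eq0.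

Lemma normr_opE (T : bounded_op) : `|T| = (opnorm T)%:C.
Proof. by []. Qed.

End bounded_operators.
Arguments bounded_op {R} B.

(* The values of [op_fun] outside [op_dom] are irrelevant. *)
Record unbounded_op (R : realType) (B : normedModType R[i]) := UnboundedOp {
  op_dom : set B ;
  op_fun :> B -> B ;
  op_dom0 : op_dom 0 ;
  op_domP : forall (a : R[i]) x y, op_dom x -> op_dom y -> op_dom (a *: x + y) ;
  op_linear : forall (a : R[i]) x y, op_dom x -> op_dom y ->
    op_fun (a *: x + y) = a *: op_fun x + op_fun y }.

Definition op_of_bounded (R : realType) (B : normedModType R[i])
    (T : bounded_op B) : unbounded_op B :=
  @UnboundedOp R B setT T I (fun _ _ _ _ _ => I)
    (fun a x y _ _ => bounded_op_linear T a x y).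

Section spectral_theory.
Context {R : realType} {B : normedModType R[i]}.
Implicit Type H : unbounded_op B.

Definition closed_op H :=
  closed [set p : B * B | op_dom H p.1 /\ p.2 = H p.1].

Definition densely_defined H := dense (op_dom H).

Definition is_resolvent H (z : R[i]) (T : bounded_op B) :=
  (forall y, op_dom H (T y) /\ z *: T y - H (T y) = y) /\
  (forall x, op_dom H x -> T (z *: x - H x) = x).

Definition spectrum H : set R[i] := [set z | ~ exists T, is_resolvent H z T].

(* (z - H)^-1, with the junk value 0 when z is in the spectrum. *)
Definition resolvent H (z : R[i]) : bounded_op B := xget 0 (is_resolvent H z).

End spectral_theory.

Section complex_calculus.
Context {R : realType}.

Definition bracket (z : R[i]) : R := Num.sqrt (1 + (complex.Re `|z|) ^+ 2).

(* Derivatives and smoothness of a complex-valued function of a real variable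
   are taken componentwise. *)
Definition cderive1n (n : nat) (f : R -> R[i]) (x : R) : R[i] :=
  derive1n n (fun t => complex.Re (f t)) x +i*
  derive1n n (fun t => complex.Im (f t)) x.

Definition smooth (f : R -> R[i]) := forall (n : nat) (x : R),
  derivable (derive1n n (fun t => complex.Re (f t))) x 1 /\
  derivable (derive1n n (fun t => complex.Im (f t))) x 1.

Definition symbol_class (beta : R) : set (R -> R[i]) :=
  [set f | smooth f /\ forall n : nat, exists2 c : R, 0 < c &
    forall x : R,
      `|cderive1n n f x| <= (c * bracket x%:C `^ (beta - n%:R))%:C].

Definition algebraA : set (R -> R[i]) :=
  \bigcup_(beta in [set beta : R | beta < 0]) symbol_class beta.

Definition cutoff (tau0 : R -> R[i]) :=
  [/\ smooth tau0,
      forall t : R, `|t| <= 1 -> tau0 t = 1 &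
      forall t : R, 2 <= `|t| -> tau0 t = 0].

Definition almost_analytic_ext (n : nat) (tau0 f : R -> R[i]) (x y : R) : R[i] :=
  (\sum_(r < n.+1) cderive1n r f x * ('i%C * y%:C) ^+ r / (r`!)%:R)
  * tau0 (y / bracket x%:C).

Definition dbar (F : R -> R -> R[i]) (x y : R) : R[i] :=
  2^-1 * (cderive1n 1 (fun s => F s y) x + 'i%C * cderive1n 1 (F x) y).

End complex_calculus.

Section bochner_integral.
Local Open Scope ereal_scope.
Context {R : realType} {d : measure_display} {T : measurableType d}.
Context (mu : {measure set T -> \bar R}) {E : normedModType R[i]}.

Record simple_fun := SimpleFun {
  sf_size : nat ;
  sf_set : 'I_sf_size -> set T ;
  sf_val : 'I_sf_size -> E ;
  sf_measurable : forall i, measurable (sf_set i) ;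
  sf_finite : forall i, mu (sf_set i) < +oo }.

Definition sf_eval (s : simple_fun) (x : T) : E :=
  (\sum_(i < sf_size s) (\1_(sf_set i) x)%:C *: sf_val i)%R.

Definition sf_integral (s : simple_fun) : E :=
  (\sum_(i < sf_size s) (fine (mu (sf_set i)))%:C *: sf_val i)%R.

(* F is Bochner integrable with integral v: F is the almost everywhere limit of
   simple functions (hence strongly measurable) which also converge to F in
   L^1-norm and whose integrals converge to v. *)
Definition is_bochner_integral (F : T -> E) (v : E) :=
  exists s : nat -> simple_fun,
    [/\ {ae mu, forall x, sf_eval (s n) x @[n --> \oo] --> F x},
        (\int[mu]_x (rnorm (F x - sf_eval (s n) x)%R)%:E) @[n --> \oo]
          --> (0 : \bar R) &
        sf_integral (s n) @[n --> \oo] --> v].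

Definition bochner_integral (F : T -> E) : E := xget 0%R (is_bochner_integral F).

End bochner_integral.

Definition lebesgue2 (R : realType) :
    {measure set (measurableTypeR R * measurableTypeR R) -> \bar R} :=
  (@lebesgue_measure R \x @lebesgue_measure R)%E.

(* The integrand is the junk value 0 only on the spectrum of H, which for the
   operators under consideration lies in the Lebesgue-null set of real z. *)
Definition functional_calculus (R : realType) (B : normedModType R[i])
    (n : nat) (tau0 : R -> R[i]) (H : unbounded_op B) (f : R -> R[i])
    : bounded_op B :=
  - (pi^-1)%:C *: bochner_integral (lebesgue2 R)
     (fun p => dbar (almost_analytic_ext n tau0 f) p.1 p.2 *:
               resolvent H (p.1 +i* p.2)).

Definition standing_hypothesis (R : realType) (B : normedModType R[i])
    (H : unbounded_op B) (c alpha : R) :=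
  [/\ closed_op H, densely_defined H,
      spectrum H `<=` [set z | complex.Im z = 0],
      0 < c /\ 0 <= alpha &
      forall z : R[i], complex.Im z <> 0 ->
        `|resolvent H z| <=
          (c * `|complex.Im z|^-1 *
            (bracket z / `|complex.Im z|) `^ alpha)%:C].

(* Main.v *)
Require Import Defs.
From HB Require Import structures.
From mathcomp Require Import all_boot all_order all_algebra.
From mathcomp Require Import complex.
From mathcomp Require Import all_classical all_reals all_analysis.
From mathcomp Require Import measurable_realfun.
From mathcomp Require Import ring lra.

Set Implicit Arguments.
Unset Strict Implicit.
Unset Printing Implicit Defensive.

Import Order.TTheory GRing.Theory Num.Theory.
Import numFieldNormedType.Exports.

Local Open Scope classical_set_scope.
Local Open Scope ring_scope.
Local Open Scope complex_scope.

(** A spectral value l of H has approximate eigenvectors, and the functional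
    calculus turns them into approximate eigenvectors of f(H) at f(l); hence
    f(l) - f(H) has no bounded inverse.

    In detail, the resolvent set is open with a quantitative radius: a resolvent
    T at z yields one at every w with |w - z| |T| < 1 ([is_resolvent_near]).
    Applied to f(H) this makes its spectrum closed, so only values f(l) with l
    in the spectrum matter, and l is real.  Applied to H it shows that the norm
    of R(z) = (z - H)^-1 is at least 1 / |z - l|; since H has no spectrum off
    the real axis, z can be taken as close to l as desired, and nearly
    norming vectors of R(z) give unit vectors x_k with H x_k - l x_k -> 0
    ([approximate_eigenvector]).

    Let F be the almost analytic extension of f.  The identity
      R(z) x - x / (z - l) = R(z) (H x - l x) / (z - l)
    shows that the integrands of
      W = int (dbar F)(z) R(z)   and   w = int (dbar F)(z) / (z - l)
    become close when applied to x_k, at every z off the real axis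
    ([resolvent_eigen_approx]).  Both are dominated by one integrable function,
    because dbar F vanishes to order n > alpha on the real axis while the
    resolvent grows locally at most like |Im z|^(- alpha - 1), and 1 / |z - l| is at
    most 1 / |Im z| ([dbar_ext_dominated], [integrable_strip_weight]).
    Dominated convergence gives W x_k - w x_k -> 0
    ([functional_calculus_eigen_cvg]).  Finally w = - pi f(l) by the
    Cauchy-Pompeiu formula ([cauchy_pompeiu_ext]), and f(H) = - W / pi.

    The Cauchy-Pompeiu formula is obtained from the fundamental theorem of
    calculus on two rectangles lying above and below the real axis.  Their long
    edges, which approach the axis, contribute a Poisson integral of F that
    tends to its value at l, and the other edges contribute nothing in the limit
    ([cauchy_pompeiu_re]).  Bochner integrals exist by approximation with
    simple functions taking values in a dense sequence ([bochner_exists]). *)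

(** * The real-valued norm *)

Section norm.
Context {R : realType} {V : normedModType R[i]}.
Implicit Types (x y : V).

Lemma rnormN x : rnorm (- x) = rnorm x.
Proof. by rewrite /rnorm normrN. Qed.

Lemma rnorm_distrC x y : rnorm (x - y) = rnorm (y - x).
Proof. by rewrite /rnorm distrC. Qed.

Lemma rnormB x y : rnorm (x - y) <= rnorm x + rnorm y.
Proof. by rewrite (le_trans (rnormD _ _))// rnormN. Qed.

Lemma ler_rnorm_dist x y : `|rnorm x - rnorm y| <= rnorm (x - y).
Proof.
rewrite ler_norml; apply/andP; split.
  rewrite lerNl opprB lerBlDl -{1}(subrK x y) addrC (le_trans (rnormD _ _))//.
  by rewrite [in leRHS]rnorm_distrC.
by rewrite lerBlDl -{1}(subrK y x) addrC (le_trans (rnormD _ _)).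
Qed.

Lemma gtc0_re (e : R[i]) : 0 < e -> 0 < complex.Re e /\ e = (complex.Re e)%:C.
Proof. by case: e => a b; rewrite ltcE /= => /andP[/eqP -> a0]. Qed.

Lemma cvg_rnormP {T : Type} {F : set_system T} {FF : Filter F} (f : T -> V) l :
  f @ F --> l <-> (rnorm (f t - l) @[t --> F] --> (0 : R)).
Proof.
split=> [/cvgrPdist_lt fl|fl].
  apply/cvgrPdist_lt => e e0; have := fl e%:C.
  rewrite ltcR e0 => /(_ isT); apply: filterS => t.
  by rewrite -rnormE ltcR sub0r normrN rnorm_distrC ger0_norm// rnorm_ge0.
apply/cvgrPdist_lt => e /gtc0_re[e0 ->].
move/cvgrPdist_lt : fl => /(_ _ e0); apply: filterS => t.
by rewrite -rnormE ltcR sub0r normrN rnorm_distrC ger0_norm// rnorm_ge0.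
Qed.

Lemma cvg_rnorm {T : Type} {F : set_system T} {FF : Filter F} (f : T -> V) l :
  f @ F --> l -> rnorm (f t) @[t --> F] --> rnorm l.
Proof.
move=> /cvg_rnormP fl; apply/cvgrPdist_le => e e0.
move/cvgrPdist_le : fl => /(_ _ e0); apply: filterS => t.
rewrite sub0r normrN ger0_norm ?rnorm_ge0//; apply: le_trans.
by rewrite distrC ler_rnorm_dist.
Qed.

End norm.

Lemma rcauchy_cvg (R : realType) (V : completeNormedModType R[i]) (u : nat -> V) :
  (forall e : R, 0 < e -> exists N, forall m n, (N <= m)%N -> (N <= n)%N ->
     rnorm (u m - u n) <= e) -> exists l : V, u @ \oo --> l.
Proof.
move=> uc; suff /cvg_ex : cvg (u @ \oo) by [].
apply/cauchy_cvgP; apply/cauchy_exP => eps /gtc0_re[].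
set e := complex.Re eps => e0 ->.
have e20 : 0 < e / 2 by rewrite divr_gt0.
have [N uN] := uc _ e20; exists (u N); exists N => // m /= Nm.
rewrite -ball_normE /= -rnormE ltcR (le_lt_trans (uN _ _ _ _))//.
by rewrite ltr_pdivrMr// ltr_pMr// ltr1n.
Qed.

(** * Resolvents and approximate eigenvectors *)

Section bounded_op_facts.
Context {R : realType} {B : normedModType R[i]}.
Implicit Types (T : bounded_op B) (x y : B).

Lemma bounded_opD T x y : T (x + y) = T x + T y.
Proof. by rewrite -[x]scale1r (bounded_op_linear T) !scale1r. Qed.

Lemma bounded_opN T x : T (- x) = - T x.
Proof. by rewrite -scaleN1r bounded_opZ scaleN1r. Qed.

Lemma bounded_opB T x y : T (x - y) = T x - T y.
Proof. by rewrite bounded_opD bounded_opN. Qed.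

Lemma mk_bounded_op (f : B -> B) : linear f ->
  (exists M : R, forall x, rnorm (f x) <= M * rnorm x) ->
  {T : bounded_op B | forall x, T x = f x}.
Proof.
move=> lf bf; have fP : f \in bounded_op_pred by apply/asboolP.
by exists (BoundedOp fP).
Qed.

Lemma rnorm_op T : rnorm T = opnorm T.
Proof. by []. Qed.

End bounded_op_facts.

Lemma rnormc (R : realType) (z : R[i]) : rnorm (z : R[i]^o) = complex.Re `|z|.
Proof. by []. Qed.

Section neumann.
Context {R : realType} {B : completeNormedModType R[i]}.
Implicit Types (T : bounded_op B) (x y : B).

(** Banach's fixed point theorem for the metric given by the norm. *)
Lemma ex_fixed_point (f : B -> B) (q : R) : 0 <= q < 1 ->
  (forall x y, rnorm (f x - f y) <= q * rnorm (x - y)) -> exists x, f x = x.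
Proof.
move=> /andP[q0 q1] fq; pose u n := iter n f 0; pose C := rnorm (f 0 - 0).
have C0 : 0 <= C by exact: rnorm_ge0.
have uS n : rnorm (u n.+1 - u n) <= C * q ^+ n.
  elim: n => [|n ih]; first by rewrite expr0 mulr1.
  by rewrite (le_trans (fq _ _))// exprS mulrCA ler_wpM2l.
have q10 : 0 < 1 - q by rewrite subr_gt0.
have uD n k : rnorm (u (n + k)%N - u n) <= C * q ^+ n * (1 - q ^+ k) / (1 - q).
  elim: k => [|k ih]; first by rewrite addn0 subrr rnorm0 expr0 subrr mulr0 mul0r.
  rewrite addnS -(subrK (u (n + k)%N) (u _.+1)) -addrA (le_trans (rnormD _ _))//.
  rewrite (le_trans (lerD (uS _) ih))// exprD ler_pdivlMr// mulrDl divfK ?gt_eqF//.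
  by rewrite exprS le_eqVlt; apply/orP; left; apply/eqP; ring.
have uD' n k : rnorm (u (n + k)%N - u n) <= C / (1 - q) * q ^+ n.
  rewrite (le_trans (uD _ _))// [leRHS]mulrAC ler_wpM2r ?invr_ge0 ?(ltW q10)//.
  by rewrite ler_piMr ?mulr_ge0 ?exprn_ge0// gerBl exprn_ge0.
have [e e0|l ul] := @rcauchy_cvg _ _ u.
  have : C / (1 - q) * q ^+ n @[n --> \oo] --> (0 : R).
    rewrite -[X in _ --> X](mulr0 (C / (1 - q))); apply: cvgMl_tmp.
    by apply: cvg_expr; rewrite ger0_norm.
  move=> /cvgrPdist_le /(_ (e / 2)); rewrite divr_gt0// => /(_ isT)[N _ /(_ N (leqnn _))] /= HN.
  have HN' k : rnorm (u (N + k)%N - u N) <= e / 2.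
    by rewrite (le_trans (uD' _ _))// (le_trans _ HN)// sub0r normrN ler_norm.
  exists N => m n /subnKC <- /subnKC <-.
  rewrite -(subrK (u N) (u (N + (m - N))%N)) -addrA (le_trans (rnormD _ _))//.
  by rewrite [e]splitr lerD// rnorm_distrC.
exists l; apply/eqP; rewrite -subr_eq0; apply/eqP; apply: rnorm_eq0.
apply/eqP; rewrite eq_le rnorm_ge0 andbT; apply/ler_addgt0Pr => e e0; rewrite add0r.
move/cvg_rnormP : ul => /cvgrPdist_le /(_ (e / 2)); rewrite divr_gt0// => /(_ isT)[N _ HN].
have {}HN n : (N <= n)%N -> rnorm (u n - l) <= e / 2.
  by move=> /HN /=; rewrite sub0r normrN ger0_norm// rnorm_ge0.
rewrite -(subrK (u N.+1) (f l)) -addrA (le_trans (rnormD _ _))// [e]splitr lerD//.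
  rewrite (le_trans (fq _ _))// rnorm_distrC (le_trans _ (HN N (leqnn _)))//.
  by rewrite ler_piMl ?rnorm_ge0// ltW.
exact: HN.
Qed.

(** Since w - H = (1 + (w - z) T) (z - H), the resolvent at w is T N, where
    N is the inverse of 1 + (w - z) T; the vector N y is the fixed point of the
    contraction x |-> y - (w - z) T x. *)
Lemma is_resolvent_near (H : unbounded_op B) z w T : is_resolvent H z T ->
  rnorm (w - z : R[i]^o) * opnorm T < 1 -> exists S, is_resolvent H w S.
Proof.
move=> [TH1 TH2]; set q := _ * _ => q1.
have q0 : 0 <= q by rewrite mulr_ge0 ?opnorm_ge0 ?rnorm_ge0.
have qT x : rnorm ((w - z) *: T x) <= q * rnorm x.
  by rewrite rnormZ -mulrA ler_wpM2l ?(rnorm_ge0 (w - z : R[i]^o))// opnormP.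
have /choice[N NE] y : exists x, y - (w - z) *: T x = x.
  apply: (@ex_fixed_point (fun x => y - (w - z) *: T x) q); first by rewrite q0.
  move=> x x'; rewrite opprB addrC addrA subrK -scalerBr -bounded_opB.
  by rewrite (le_trans (qT _))// rnorm_distrC.
(* Injectivity of 1 + (w - z) T gives the linearity of N and, at the end, that
   T N is a left inverse too. *)
have Nuniq x : x = - ((w - z) *: T x) -> x = 0.
  move=> xE; apply: rnorm_eq0; apply/eqP; rewrite eq_le rnorm_ge0 andbT.
  have : rnorm x <= q * rnorm x by rewrite {1}xE rnormN.
  by rewrite -subr_le0 -{1}[rnorm x]mul1r -mulrBl pmulr_rle0 ?subr_gt0.
have Nlin : linear N.
  move=> a x y; apply/eqP; rewrite -subr_eq0; apply/eqP/Nuniq.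
  have KN v : (w - z) *: T (N v) = v - N v by rewrite -{2}(NE v) opprB [RHS]addrC subrK.
  rewrite bounded_opB bounded_op_linear scalerBr scalerDr scalerA mulrC -scalerA.
  rewrite !KN scalerBr (addrACA (a *: x)) -opprD [RHS]opprB opprB.
  by rewrite [RHS]addrC addrA subrK.
have Nbd y' : rnorm (N y') <= (1 - q)^-1 * rnorm y'.
  rewrite mulrC ler_pdivlMr ?subr_gt0// mulrBr mulr1 lerBlDr.
  by rewrite -{1}(NE y') (le_trans (rnormB _ _))// lerD2l mulrC.
have TNlin : linear (T \o N) by move=> a u v /=; rewrite Nlin bounded_op_linear.
have TNbd : exists M : R, forall x, rnorm ((T \o N) x) <= M * rnorm x.
  exists (opnorm T * (1 - q)^-1) => x; rewrite (le_trans (opnormP _ _))//= -mulrA.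
  by rewrite ler_wpM2l ?opnorm_ge0.
have [S SE] := @mk_bounded_op R B (T \o N) TNlin TNbd.
have S1 y : op_dom H (S y) /\ w *: S y - H (S y) = y.
  rewrite SE /=; have [dT TE] := TH1 (N y); split => //.
  rewrite -{1}(subrK z w) scalerDl -addrA TE -{2}(NE y) addrC subrK//.
exists S; split => // x dx.
have [dS SwE] := S1 (w *: x - H x).
apply/eqP; rewrite -subr_eq0; apply/eqP; set s := S _ in dS SwE *.
have dsx : op_dom H (s - x) by rewrite addrC -scaleN1r; exact: op_domP.
have HsxE : H (s - x) = w *: (s - x).
  rewrite addrC -scaleN1r op_linear// scaleN1r scalerDr scalerN.
  have -> : H s = w *: s - (w *: x - H x) by rewrite -SwE opprB [RHS]addrC subrK.
  by rewrite opprB scaleN1r addrCA addKr addrC.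
apply: Nuniq; rewrite -bounded_opZ -bounded_opN -[LHS](TH2 _ dsx) HsxE -scalerBl.
by rewrite -scaleNr opprB.
Qed.

Lemma notin_spectrum_near (H : unbounded_op B) z w T : is_resolvent H z T ->
  rnorm (w - z : R[i]^o) * opnorm T < 1 -> ~ spectrum H w.
Proof. by move=> HT wz /(_ (is_resolvent_near HT wz)). Qed.

Lemma resolventP (H : unbounded_op B) z : ~ spectrum H z ->
  is_resolvent H z (resolvent H z).
Proof. by move=> /contrapT[T HT]; rewrite /resolvent; exact: xgetI HT. Qed.

Lemma resolvent_identity (H : unbounded_op B) z w y :
  ~ spectrum H z -> ~ spectrum H w ->
  resolvent H w y - resolvent H z y =
    (z - w) *: resolvent H w (resolvent H z y).
Proof.
move=> /resolventP[z1 z2] /resolventP[w1 w2].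
have [dz zE] := z1 y; set Rz := resolvent H z y in dz zE *.
have := w2 _ dz.
have -> : w *: Rz - H Rz = y + (w - z) *: Rz.
  by rewrite -[in RHS]zE scalerBl [RHS]addrC addrA subrK.
rewrite bounded_opD bounded_opZ => RzE.
by rewrite -{1}RzE opprD addrA subrr add0r -scaleNr opprB.
Qed.

(** By the resolvent identity the difference is (z - w) R(w) R(z); bounding the
    norm of R(w) by that of R(z) plus the difference itself, half of the
    difference is absorbed in the left-hand side. *)
Lemma opnorm_resolventB (H : unbounded_op B) z w :
  ~ spectrum H z -> ~ spectrum H w ->
  rnorm (w - z : R[i]^o) * opnorm (resolvent H z) <= 2^-1 ->
  opnorm (resolvent H w - resolvent H z) <=
    2 * rnorm (w - z : R[i]^o) * opnorm (resolvent H z) ^+ 2.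
Proof.
move=> nz nw; set t := rnorm _; set N := opnorm _ => tN.
set D := opnorm _.
have t0 : 0 <= t by exact: rnorm_ge0.
have N0 : 0 <= N by exact: opnorm_ge0.
have D0 : 0 <= D by exact: opnorm_ge0.
have RwN : opnorm (resolvent H w) <= D + N.
  rewrite -rnorm_op -(subrK (resolvent H z) (resolvent H w)).
  by rewrite (le_trans (rnormD _ _)).
have : D <= t * N * (D + N).
  apply: opnorm_le => y y1.
  have -> : (resolvent H w - resolvent H z) y = (z - w) *: resolvent H w (resolvent H z y).
    by rewrite -resolvent_identity.
  rewrite rnormZ -(rnormc (z - w)) rnorm_distrC -/t -mulrA ler_wpM2l//.
  rewrite (le_trans (opnormP _ _))// mulrC ler_pM ?rnorm_ge0 ?opnorm_ge0//.
  by rewrite (le_trans (opnormP _ _))// ler_piMr.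
by nra.
Qed.

Lemma resolvent_continuous (H : unbounded_op B) z :
  (\forall w \near (z : R[i]^o), ~ spectrum H w) ->
  resolvent H w @[w --> (z : R[i]^o)] --> resolvent H z.
Proof.
move=> nz; apply/(cvg_rnormP (FF := nbhs_filter (z : R[i]^o))).
apply/cvgrPdist_le => e e0.
set N := opnorm (resolvent H z).
have N0 : 0 <= N by exact: opnorm_ge0.
have : rnorm (w - z : R[i]^o) @[w --> (z : R[i]^o)] --> (0 : R).
  by apply/(cvg_rnormP (FF := nbhs_filter (z : R[i]^o))); exact: cvg_id.
pose d := Num.min (2 * (N + 1))^-1 (e / (2 * (N + 1) ^+ 2)).
have N10 : 0 < N + 1 by rewrite ltr_wpDl.
have d0 : 0 < d by rewrite lt_min invr_gt0 mulr_gt0//= divr_gt0// mulr_gt0// exprn_gt0.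
move=> /cvgrPdist_le /(_ _ d0); apply: filterS2 (nz) => w nw.
rewrite sub0r normrN ger0_norm ?rnorm_ge0// le_min => /andP[t1 t2].
rewrite sub0r normrN ger0_norm ?rnorm_ge0// (le_trans (@opnorm_resolventB _ _ _ _ _ _))//.
- exact: (nbhs_singleton nz).
- rewrite -/N (@le_trans _ _ ((2 * (N + 1))^-1 * (N + 1)))//.
    by rewrite ler_pM ?rnorm_ge0// lerDl.
  by rewrite invfM divfK// gt_eqF.
- rewrite -/N (@le_trans _ _ (2 * (e / (2 * (N + 1) ^+ 2)) * (N + 1) ^+ 2))//.
    rewrite ler_pM ?mulr_ge0 ?rnorm_ge0 ?exprn_ge0// ?ler_wpM2l//.
    by rewrite lerXn2r ?nnegrE ?(ltW N10)// lerDl.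
  have M0 : (N + 1) ^+ 2 != 0 by rewrite expf_neq0// gt_eqF.
  by rewrite le_eqVlt; apply/orP; left; apply/eqP; field; rewrite gt_eqF.
Qed.

(** Both sides come from the identity
    R(z) x - x / (z - l) = R(z) (H x - l x) / (z - l): on an approximate
    eigenvector the resolvent almost acts as a scalar. *)
Lemma resolvent_eigen_approx (H : unbounded_op B) (z l : R[i]) x :
  ~ spectrum H z -> z != l -> op_dom H x ->
  rnorm (resolvent H z x - (z - l)^-1 *: x) <=
    opnorm (resolvent H z) * rnorm ((z - l)^-1 : R[i]^o) * rnorm (H x - l *: x).
Proof.
move=> /resolventP[z1 z2] zl dx; rewrite -mulrA mulrCA.
have -> : resolvent H z x - (z - l)^-1 *: x =
   (z - l)^-1 *: resolvent H z (H x - l *: x).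
  apply: (scalerI (_ : z - l != 0)); first by rewrite subr_eq0.
  rewrite scalerBr !scalerA mulfV ?subr_eq0// !scale1r.
  rewrite -[X in _ - X](z2 _ dx) -bounded_opZ -bounded_opB scalerBl opprB; congr (resolvent H z _).
  by rewrite addrC addrA subrK.
by rewrite rnormZ ler_wpM2l ?(rnorm_ge0 ((z - l)^-1 : R[i]^o))// opnormP.
Qed.

(** If z is close to l and off the spectrum, the resolvent T at z has norm at
    least 1 / |z - l|, since otherwise l would be off the spectrum too.
    Normalizing T y for a nearly norming y then works, because
    H (T y) - l T y = (z - l) T y - y. *)
Lemma approximate_eigenvector (H : unbounded_op B) (l : R[i]) (e : R) :
  spectrum H l ->
  (forall d : R, 0 < d -> exists z, rnorm (z - l : R[i]^o) <= d /\ ~ spectrum H z) ->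
  0 < e -> exists x, [/\ op_dom H x, rnorm x = 1 & rnorm (H x - l *: x) <= e].
Proof.
move=> Hl nl e0.
have d0 : 0 < e / 3 by rewrite divr_gt0.
have [z [zl nz]] := nl _ d0; set d := e / 3 in d0 zl.
set T := resolvent H z; have HT : is_resolvent H z T by exact: resolventP.
(* The constant 3 is chosen so that d = e / 3 accounts for (z - l) T y and 2 d
   for the vector y, after normalization. *)
have N1 : 1 <= d * opnorm T.
  rewrite leNgt; apply/negP => dT; apply: (notin_spectrum_near HT _ Hl).
  by rewrite (le_lt_trans _ dT)// ler_wpM2r ?opnorm_ge0// rnorm_distrC.
have N0 : 0 < opnorm T.
  by rewrite -(pmulr_rgt0 _ d0) (lt_le_trans ltr01).
have [y [y1 yT]] : exists y, rnorm y <= 1 /\ opnorm T / 2 < rnorm (T y).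
  apply: contrapT => /forallNP h.
  have : opnorm T <= opnorm T / 2.
    apply: opnorm_le => y y1; rewrite leNgt; apply/negP => yT.
    by apply: (h y).
  by rewrite ler_pdivlMr// ger_pMr// leNgt ltr1n.
set a := rnorm (T y) in yT.
have a0 : 0 < a by rewrite (lt_trans _ yT)// divr_gt0.
have aE : complex.Re `|(a^-1)%:C| = a^-1.
  by rewrite normc_def/= expr0n/= addr0 sqrtr_sqr ger0_norm// invr_ge0 ltW.
have [dy yE] := HT.1 y.
exists ((a^-1)%:C *: T y); split.
- by have := op_domP (a^-1)%:C dy (op_dom0 H); rewrite addr0.
- by rewrite rnormZ aE mulVf// gt_eqF.
have -> : H ((a^-1)%:C *: T y) = (a^-1)%:C *: H (T y).
  have := op_linear (a^-1)%:C dy (op_dom0 H); rewrite addr0 => ->.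
  suff -> : H 0 = 0 by rewrite addr0.
  have := op_linear 1 (op_dom0 H) (op_dom0 H); rewrite !scale1r addr0.
  by move/eqP; rewrite -subr_eq0 opprD addrA subrr sub0r oppr_eq0 => /eqP.
rewrite scalerA mulrC -scalerA -scalerBr.
have -> : H (T y) - l *: T y = (z - l) *: T y - y.
  by move: yE => /eqP; rewrite subr_eq addrC -subr_eq scalerBl addrAC => /eqP ->.
rewrite scalerBr (le_trans (rnormB _ _))// !rnormZ aE -/a -(rnormc (z - l)).
rewrite mulrCA mulVf ?gt_eqF// mulr1.
have -> : e = d + 2 * d by rewrite /d; field.
rewrite lerD// mulrC ler_pdivrMr// (le_trans y1)//.
have : opnorm T < 2 * a by rewrite mulrC -ltr_pdivrMr.
by rewrite -(ltr_pM2l d0) => /ltW aT; rewrite (le_trans N1)// (le_trans aT)//; lra.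
Qed.
End neumann.

(** * Integrals of simple functions *)

Section weighted_sets.
Context {R : realType} {d : measure_display} {T : measurableType d}.
Context (mu : {measure set T -> \bar R}) {E : normedModType R[i]}.
Implicit Types (l : seq (set T * E)) (D A : set T) (F : T -> E).

(** Measurability of a vector-valued function, tested on its distances to
    points.  For functions whose values are approximated by a fixed sequence
    this yields the simple functions required by the Bochner integral. *)
Definition norm_measurable F :=
  forall e : E, measurable_fun setT (fun p => rnorm (F p - e)).

(** A simple function presented as a list of weighted sets, a form that allows
    concatenation and induction on one set at a time. *)
Fixpoint wsets_ok l : Prop :=
  if l is a :: l' then
    [/\ measurable a.1, (mu a.1 < +oo)%E & wsets_ok l'] else True.

Fixpoint wsets_eval l x : E :=
  if l is a :: l' then (\1_(a.1) x)%:C *: a.2 + wsets_eval l' x else 0.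

Fixpoint wsets_integral D l : E :=
  if l is a :: l' then
    (fine (mu (D `&` a.1)))%:C *: a.2 + wsets_integral D l' else 0.

Lemma wsets_ok_cat l l' : wsets_ok (l ++ l') <-> wsets_ok l /\ wsets_ok l'.
Proof.
elim: l => [|a l ih] /=; first by split=> [|[]].
split=> [[? ? /ih[]]//|[[? ? ?] ?]].
by split => //; apply/ih.
Qed.

Lemma wsets_eval_cat l l' x :
  wsets_eval (l ++ l') x = wsets_eval l x + wsets_eval l' x.
Proof. by elim: l => [|a l /= ->]; rewrite ?add0r ?addrA. Qed.

Lemma wsets_integral_cat D l l' :
  wsets_integral D (l ++ l') = wsets_integral D l + wsets_integral D l'.
Proof. by elim: l => [|a l /= ->]; rewrite ?add0r ?addrA. Qed.

Lemma norm_measurable_subI F A (v : E) : measurable A -> norm_measurable F ->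
  norm_measurable (fun p => F p - (\1_A p)%:C *: v).
Proof.
move=> mA mF e.
rewrite (_ : (fun p => _) =
  (fun p => \1_A p * rnorm (F p - (v + e)) + \1_(~` A) p * rnorm (F p - e))).
  apply: measurable_funD; apply: measurable_funM => //;
    apply: measurable_indic => //; exact: measurableC.
apply/funext => p; rewrite !indicE.
have [pA|pA] := pselect (A p).
  rewrite (mem_set pA) memNset/=; last by apply.
  by rewrite scale1r mul1r mul0r addr0 opprD addrA.
by rewrite (memNset pA) mem_set//= scale0r subr0 mul0r mul1r add0r.
Qed.

Lemma norm_measurable_wsets F l : wsets_ok l -> norm_measurable F ->
  norm_measurable (fun p => F p - wsets_eval l p).
Proof.
elim: l F => [|a l ih] F /=.
  by move=> _ mF; under eq_fun do rewrite subr0.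
move=> [ma _ /ih{}ih] /(norm_measurable_subI a.2 ma)/ih.
by under eq_fun do rewrite -addrA -opprD.
Qed.

Lemma norm_measurable0 : norm_measurable (fun=> 0).
Proof. by move=> e; exact: measurable_cst. Qed.

Lemma measurable_rnorm_wsets l w : wsets_ok l ->
  measurable_fun setT (fun p => rnorm (w + wsets_eval l p)).
Proof.
move=> /norm_measurable_wsets /(_ norm_measurable0) /(_ w).
by under eq_fun do rewrite sub0r -opprD rnormN addrC.
Qed.

Lemma wsets_integralID D A l : measurable D -> measurable A ->
  wsets_ok l ->
  wsets_integral D l = wsets_integral (D `&` A) l + wsets_integral (D `\` A) l.
Proof.
move=> mD mA; elim: l => [|a l ih] /=; first by rewrite addr0.
move=> [ma aoo /ih ->]; rewrite addrACA; congr (_ + _).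
rewrite -scalerDl -rmorphD /= -fineD; last 2 first.
- rewrite ge0_fin_numE// (le_lt_trans _ aoo)// le_measure ?inE//.
  by apply: measurableI => //; exact: measurableI.
- rewrite ge0_fin_numE// (le_lt_trans _ aoo)// le_measure ?inE//.
  by apply: measurableI => //; exact: measurableD.
congr (_%:C *: _); congr fine.
rewrite (setIAC D A) setDE (setIAC D (~` A)) -setDE addeC.
by apply: measureDI => //; exact: measurableI.
Qed.

(** Induction on the list, for all sets D and constants w simultaneously: the
    first set cuts D in a part where w is increased by the first value and a
    part where w is kept. *)
Lemma rnorm_wsets_integral_le D l w : measurable D -> (mu D < +oo)%E ->
  wsets_ok l ->
  ((rnorm ((fine (mu D))%:C *: w + wsets_integral D l))%:E <=
    \int[mu]_(x in D) (rnorm (w + wsets_eval l x))%:E)%E.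
Proof.
elim: l D w => [|a l ih] D w mD Doo /=.
  move=> _; rewrite addr0.
  under eq_integral do rewrite addr0.
  rewrite integral_cst//= rnormZ normc_def/= expr0n/= addr0 sqrtr_sqr.
  rewrite ger0_norm ?fine_ge0// mulrC EFinM fineK// ge0_fin_numE//.
move=> [ma aoo lok].
have mDa : measurable (D `&` a.1) by exact: measurableI.
have mDa' : measurable (D `\` a.1) by exact: measurableD.
have Daoo : (mu (D `&` a.1) < +oo)%E by rewrite (le_lt_trans _ Doo)// le_measure ?inE.
have Da'oo : (mu (D `\` a.1) < +oo)%E by rewrite (le_lt_trans _ Doo)// le_measure ?inE.
have {1}-> : fine (mu D) = fine (mu (D `&` a.1)) + fine (mu (D `\` a.1)).
  rewrite -fineD ?ge0_fin_numE// addeC; congr fine; exact: measureDI.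
rewrite (wsets_integralID mD ma lok) rmorphD/= scalerDl.
set i1 := fine (mu (D `&` _)); set i2 := fine _.
have -> : i1%:C *: w + i2%:C *: w + (i1%:C *: a.2 +
    (wsets_integral (D `&` a.1) l + wsets_integral (D `\` a.1) l)) =
  (i1%:C *: (w + a.2) + wsets_integral (D `&` a.1) l) +
  (i2%:C *: w + wsets_integral (D `\` a.1) l).
  by rewrite scalerDr addrA (addrAC _ (_ *: w) (_ *: a.2)) addrACA.
have -> : (\int[mu]_(x in D) (rnorm (w + ((\1_(a.1) x)%:C *: a.2 + wsets_eval l x)))%:E)%E =
  (\int[mu]_(x in D `&` a.1) (rnorm ((w + a.2) + wsets_eval l x))%:E +
   \int[mu]_(x in D `\` a.1) (rnorm (w + wsets_eval l x))%:E)%E.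
  rewrite -[X in (\int[_]_(x in X) _)%E](setUIDK D a.1).
  rewrite ge0_integral_setU//.
  - congr (_ + _)%E; apply: eq_integral => x; rewrite inE => -[Dx ax].
      by rewrite indicE mem_set// scale1r addrA.
    by rewrite indicE memNset// scale0r add0r.
  - apply/measurable_EFinP; apply: (@measurable_funS _ _ _ _ setT) => //.
    exact: (@measurable_rnorm_wsets (a :: l) w).
  - by move=> x _; rewrite lee_fin rnorm_ge0.
  - by apply/disj_setPS => x [[_ ?] []].
rewrite (le_trans _ (leeD (ih _ _ mDa Daoo lok) (ih _ _ mDa' Da'oo lok)))//.
by rewrite -EFinD lee_fin rnormD.
Qed.

Definition wsets_total l : E := wsets_integral setT l.

(** The previous estimate needs a domain of finite measure; the union of the
    sets of the list is one. *)
Lemma rnorm_wsets_total_le l : wsets_ok l ->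
  ((rnorm (wsets_total l))%:E <= \int[mu]_x (rnorm (wsets_eval l x))%:E)%E.
Proof.
move=> lok; pose fix U (s : seq (set T * E)) := if s is a :: s' then a.1 `|` U s' else set0.
have [mU Uoo] : measurable (U l) /\ (mu (U l) < +oo)%E.
  elim: l lok => [|a l ih] /=; first by rewrite measure0.
  move=> [ma aoo /ih[mU Uoo]]; split; first exact: measurableU.
  by rewrite (le_lt_trans (measureU2 _ _ _))// lte_add_pinfty.
have -> : wsets_total l = wsets_integral (U l) l.
  rewrite /wsets_total; have : U l `<=` U l by [].
  move: {2 3}(U l) => V; elim: {lok mU Uoo} l => [//|a l ih] /= UV.
  rewrite -ih; last by move=> x Ux; apply: UV; right.
  rewrite setTI (_ : V `&` a.1 = a.1)//.
  by apply/setIidPr => x ax; apply: UV; left.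
have := rnorm_wsets_integral_le 0 mU Uoo lok.
rewrite scaler0 add0r => /le_trans; apply.
under eq_integral do rewrite add0r.
apply: ge0_subset_integral => //.
- apply/measurable_EFinP; have := measurable_rnorm_wsets 0 lok.
  by under eq_fun do rewrite add0r.
- by move=> x _; rewrite lee_fin rnorm_ge0.
Qed.

End weighted_sets.

(** * Existence of Bochner integrals *)

Section simple_to_wsets.
Context {R : realType} {d : measure_display} {T : measurableType d}.
Context (mu : {measure set T -> \bar R}) {E : normedModType R[i]}.

Definition wsets_of (s : @simple_fun R d T mu E) : seq (set T * E) :=
  [seq (sf_set i, sf_val i) | i : 'I_(sf_size s)].

Lemma wsets_ofE (s : @simple_fun R d T mu E) :
  [/\ wsets_ok mu (wsets_of s), wsets_eval (wsets_of s) = sf_eval s &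
    wsets_total mu (wsets_of s) = sf_integral s].
Proof.
rewrite /wsets_of /image_mem; split.
- elim: (enum _) => //= i r ih; split => //; [exact: sf_measurable|exact: sf_finite].
- apply/funext => x; rewrite /sf_eval -big_enum /=.
  by elim: (enum _) => [|i r ih] /=; rewrite ?big_nil ?big_cons ?ih.
- rewrite /wsets_total /sf_integral -big_enum /=.
  by elim: (enum _) => [|i r ih] /=; rewrite ?big_nil ?big_cons ?setTI ?ih.
Qed.

Lemma wsets_ok_map (E' : normedModType R[i]) (L : E -> E') (l : seq (set T * E)) :
  wsets_ok mu l -> wsets_ok mu [seq (a.1, L a.2) | a <- l].
Proof. by elim: l => //= a l ih [? ? /ih]. Qed.

Lemma wsets_eval_map (E' : normedModType R[i]) (L : E -> E') (l : seq (set T * E)) x : linear L ->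
  wsets_eval [seq (a.1, L a.2) | a <- l] x = L (wsets_eval l x).
Proof.
move=> lL; elim: l => [|a l /= ->] /=; last by rewrite lL.
by have := lL (-1) 0 0; rewrite scaler0 addr0 scaleN1r addNr => ->.
Qed.

Lemma wsets_total_map (E' : normedModType R[i]) (L : E -> E') (l : seq (set T * E)) : linear L ->
  wsets_total mu [seq (a.1, L a.2) | a <- l] = L (wsets_total mu l).
Proof.
move=> lL; rewrite /wsets_total; elim: l => [|a l /= ->] /=; last by rewrite lL.
by have := lL (-1) 0 0; rewrite scaler0 addr0 scaleN1r addNr => ->.
Qed.

End simple_to_wsets.

(** Completeness expressed by the real norm, as a property that the complex
    numbers and the bounded operators are shown to have. *)
Definition seq_complete (R : realType) (V : normedModType R[i]) :=
  forall u : nat -> V,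
  (forall e : R, 0 < e -> exists N, forall m n, (N <= m)%N -> (N <= n)%N ->
     rnorm (u m - u n) <= e) -> exists l : V, u @ \oo --> l.

Section bochner.
Context {R : realType} {d : measure_display} {T : measurableType d}.
Context (mu : {measure set T -> \bar R}) {E : normedModType R[i]}.
Implicit Types (F : T -> E) (s : @simple_fun R d T mu E).

Lemma measurable_rnorm F : norm_measurable F -> measurable_fun setT (fun p => rnorm (F p)).
Proof. by move=> /(_ 0); under eq_fun do rewrite subr0. Qed.

Lemma norm_measurable_sub_sf F s : norm_measurable F ->
  norm_measurable (fun p => F p - sf_eval s p).
Proof.
by move=> mF; have [sok <- _] := wsets_ofE s; exact: norm_measurable_wsets sok mF.
Qed.

(** The integrals of simple functions converging to F in L^1 therefore form a
    Cauchy sequence. *)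
Lemma rnorm_sf_integralB F s s' : norm_measurable F ->
  ((rnorm (sf_integral s - sf_integral s'))%:E <=
   \int[mu]_p (rnorm (F p - sf_eval s p))%:E +
   \int[mu]_p (rnorm (F p - sf_eval s' p))%:E)%E.
Proof.
move=> mF; have [sok se si] := wsets_ofE s; have [sok' se' si'] := wsets_ofE s'.
have linN : linear (fun v : E => - v) by move=> a u v; rewrite opprD scalerN.
pose l := wsets_of s ++ [seq (a.1, - a.2) | a <- wsets_of s'].
have lok : wsets_ok mu l by apply/wsets_ok_cat; split => //; exact: wsets_ok_map.
have := rnorm_wsets_total_le lok.
rewrite {1}/wsets_total wsets_integral_cat -!/(wsets_total _ _) wsets_total_map// si si'.
move=> /le_trans; apply.
rewrite -ge0_integralD//; first last.
- apply/measurable_EFinP/measurable_rnorm; exact: norm_measurable_sub_sf.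
- by move=> x _; rewrite lee_fin rnorm_ge0.
- apply/measurable_EFinP/measurable_rnorm; exact: norm_measurable_sub_sf.
- by move=> x _; rewrite lee_fin rnorm_ge0.
apply: ge0_le_integral => //.
- by move=> x _; rewrite lee_fin rnorm_ge0.
- apply/measurable_EFinP; have := measurable_rnorm_wsets 0 lok.
  by under eq_fun do rewrite add0r.
- by apply/measurable_EFinP/measurable_funD; apply/measurable_rnorm; exact: norm_measurable_sub_sf.
move=> x _; rewrite -EFinD lee_fin wsets_eval_cat wsets_eval_map// se se'.
rewrite (_ : _ - _ = (F x - sf_eval s' x) - (F x - sf_eval s x)).
  by rewrite (le_trans (rnormB _ _))// addrC.
by rewrite opprB [RHS]addrC addrA subrK.
Qed.

(** The n-th simple function selects, at each p, the point of e 0, ..., e n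
    nearest to F p.  As e 0 = 0 is a candidate, the error is at most |F p|, so
    dominated convergence gives convergence in L^1. *)
Lemma bochner_exists F (e : nat -> E) : seq_complete E ->
  norm_measurable F -> e 0%N = 0 ->
  (forall p (r : R), 0 < r -> exists k, rnorm (F p - e k) < r) ->
  (\int[mu]_p (rnorm (F p))%:E < +oo)%E ->
  exists v, is_bochner_integral mu F v.
Proof.
move=> cE mF e0 eF Foo; pose f k p := rnorm (F p - e k).
(* For k <= n, on A n k the first nearest point to F p among e 0, ..., e n is
   e k. *)
pose A n k := [set p | (forall j, (j < k)%N -> f k p < f j p) /\
                       (forall j, (j <= n)%N -> f k p <= f j p)].
have mA n k : measurable (A n k).
  rewrite (_ : A n k = \bigcap_j ([set p | (j < k)%N -> f k p < f j p] `&`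
    [set p | (j <= n)%N -> f k p <= f j p])).
    apply: bigcapT_measurable => j; apply: measurableI.
    - have [jk|jk] := boolP (j < k)%N.
        rewrite (_ : [set p | _] = [set p | f k p < f j p]); last first.
          by apply/seteqP; split => p /=; [apply|].
        have := @measurable_fun_ltr _ T R setT (f k) (f j) (mF _) (mF _) measurableT [set true].
        by rewrite setTI; apply.
      by rewrite (_ : [set p | _] = setT)//; apply/seteqP; split.
    - have [jk|jk] := boolP (j <= n)%N.
        rewrite (_ : [set p | _] = [set p | f k p <= f j p]); last first.
          by apply/seteqP; split => p /=; [apply|].
        have := @measurable_fun_ler _ T R setT (f k) (f j) (mF _) (mF _) measurableT [set true].
        by rewrite setTI; apply.
      by rewrite (_ : [set p | _] = setT)//; apply/seteqP; split.
  apply/seteqP; split=> [p [h1 h2] j _|p h]; first by split=> ?; [apply: h1|apply: h2].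
  by split=> j; [exact: (h j I).1|exact: (h j I).2].
have mf k : measurable_fun setT (EFin \o f k) by apply/measurable_EFinP; exact: mF.
have f0E p : f 0%N p = rnorm (F p) by rewrite /f e0 subr0.
(* Where e (k + 1) is nearer to F p than e 0 = 0, |F p| is at least half of
   |e (k + 1)|, so the set has finite measure by Markov's inequality. *)
have Aoo n k : (mu (A n k.+1) < +oo)%E.
  have [ek0|ek0] := eqVneq (e k.+1) 0.
    rewrite (_ : A n k.+1 = set0) ?measure0//; apply/seteqP; split => // p [/(_ 0%N isT) + _].
    by rewrite f0E /f ek0 subr0 ltxx.
  pose c := rnorm (e k.+1) / 2.
  have c0 : 0 < c.
    rewrite divr_gt0// lt_def rnorm_ge0 andbT; apply: contra_neq ek0; exact: rnorm_eq0.
  have : (c%:E * mu (A n k.+1) < +oo)%E.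
    apply: le_lt_trans Foo; rewrite -integral_cst//.
    apply: (@le_trans _ _ (\int[mu]_(p in A n k.+1) (rnorm (F p))%:E)%E).
      apply: ge0_le_integral => //.
      - by move=> p _; rewrite lee_fin ltW.
      - apply: (@measurable_funS _ _ _ _ setT) => //.
        exact/measurable_EFinP/measurable_rnorm.
      move=> p [/(_ 0%N isT) + _]; rewrite f0E /f lee_fin ler_pdivrMr// => ltF.
      rewrite -[e k.+1](subKr (F p)) (le_trans (rnormB _ _))// mulr_natr mulr2n lerD2l.
      exact: ltW.
    apply: ge0_subset_integral => //; last by move=> p _; rewrite lee_fin rnorm_ge0.
    exact/measurable_EFinP/measurable_rnorm.
  rewrite ltey => h; rewrite ltey; apply: contra h => /eqP ->.
  by rewrite gt0_muley// lte_fin.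
pose s n := @SimpleFun R d T mu E n (fun i => A n i.+1) (fun i => e i.+1)
  (fun i => mA n i.+1) (fun i => Aoo n i).
have sf n p j : (j <= n)%N -> rnorm (F p - sf_eval (s n) p) <= f j p.
  pose P k := (k <= n)%N && [forall j : 'I_n.+1, f k p <= f j p].
  have exP : exists k, P k.
    exists [arg min_(i < (ord0 : 'I_n.+1)) f i p]%O; case: arg_minP => // i _ ih.
    by rewrite /P -ltnS ltn_ord/=; apply/forallP => k; exact: ih.
  have [k /andP[kn /forallP kf] kmin] := ex_minnP exP.
  have kf' i : (i <= n)%N -> f k p <= f i p by rewrite -ltnS => i_n; exact: (kf (Ordinal i_n)).
  suff -> : sf_eval (s n) p = e k by move=> /kf'.
  have Ak : A n k p.
    split => // i ik; rewrite ltNge; apply/negP => fik.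
    have /kmin : P i.
      rewrite /P (leq_trans (ltnW ik) kn); apply/forallP => m; exact: le_trans fik (kf m).
    by rewrite leqNgt ik.
  have nA i : (i <= n)%N -> i != k -> ~ A n i p.
    move=> i_n ik [h1 h2]; have /kmin ki : P i.
      by rewrite /P i_n; apply/forallP => m; apply: h2; rewrite -ltnS.
    have /h1 : (k < i)%N by rewrite ltn_neqAle eq_sym ik.
    by rewrite ltNge kf'.
  rewrite /sf_eval /=.
  case: k => [|k] in kn kf kmin kf' Ak nA *.
    rewrite e0 big1// => i _; rewrite indicE memNset ?scale0r//.
    exact: nA.
  rewrite (bigD1 (Ordinal kn))//= indicE mem_set// scale1r big1 ?addr0// => i ik.
  rewrite indicE memNset ?scale0r//; apply: nA => //.
have sF p : sf_eval (s n) p @[n --> \oo] --> F p.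
  apply/cvg_rnormP/cvgrPdist_lt => r r0; have [k kr] := eF p _ r0.
  exists k => // n /= kn; rewrite sub0r normrN ger0_norm ?rnorm_ge0// rnorm_distrC.
  exact: le_lt_trans (sf _ _ _ kn) kr.
have mFs n : measurable_fun setT (fun p => (rnorm (F p - sf_eval (s n) p))%:E).
  apply/measurable_EFinP/measurable_rnorm; exact: norm_measurable_sub_sf.
have L1 : (\int[mu]_x (rnorm (F x - sf_eval (s n) x))%:E)%E @[n --> \oo] --> (0 : \bar R)%E.
  have [] := @dominated_convergence _ _ _ mu setT measurableT
     (fun n p => (rnorm (F p - sf_eval (s n) p))%:E) (cst 0%E)
     (fun p => (rnorm (F p))%:E).
  - exact: mFs.
  - exact: measurable_cst.
  - apply: aeW => p _; apply: cvg_EFin; first exact: nearW.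
    have /cvg_rnormP := sF p; apply: cvg_trans; apply: near_eq_cvg.
    by apply: nearW => n /=; rewrite rnorm_distrC.
  - apply/integrableP; split; first exact/measurable_EFinP/measurable_rnorm.
    by under eq_integral do rewrite gee0_abs ?lee_fin ?rnorm_ge0//.
  - apply: aeW => p n _; rewrite gee0_abs ?lee_fin ?rnorm_ge0// -f0E.
    exact: sf.
  by move=> _ _; rewrite integral0.
have [|v vs] := cE (fun n => sf_integral (s n)); last first.
  by exists v, s; split => //; exact: aeW.
move=> r r0; have r20 : 0 < r / 2 by rewrite divr_gt0.
move/fine_cvgP : L1 => [[N1 _ N1L] /cvgrPdist_le /(_ _ r20)[N2 _ N2L]].
have H n : (maxn N1 N2 <= n)%N -> (\int[mu]_x (rnorm (F x - sf_eval (s n) x))%:E <= (r / 2)%:E)%E.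
  rewrite geq_max => /andP[/N1L/= fn /N2L /=]; rewrite sub0r normrN => h.
  by rewrite -(fineK fn) lee_fin (le_trans _ h)// ler_norm.
exists (maxn N1 N2) => m n Hm Hn; rewrite -lee_fin.
rewrite (le_trans (rnorm_sf_integralB _ _ mF))// [r]splitr EFinD leeD//; exact: H.
Qed.

End bochner.

(** * Linear maps applied to Bochner integrals *)

Lemma seq_complete_complex (R : realType) : seq_complete (R[i]^o : normedModType R[i]).
Proof.
move=> u uc.
have realc (g : R[i]^o -> R) : (forall z w, `|g z - g w| <= rnorm (z - w)) ->
    exists l : R, g (u n) @[n --> \oo] --> l.
  move=> gl; suff /cvg_ex : cvg (g (u n) @[n --> \oo]) by [].
  apply/cauchy_cvgP/cauchy_exP => e e0.
  have e20 : 0 < e / 2 by rewrite divr_gt0.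
  have [N uN] := uc _ e20; exists (g (u N)); exists N => // m /= Nm.
  rewrite -ball_normE /= (le_lt_trans (gl _ _))// (le_lt_trans (uN _ _ _ _))//.
  by rewrite ltr_pdivrMr// ltr_pMr// ltr1n.
have [|a ua] := realc (@complex.Re R).
  move=> z w; rewrite -(raddfB (@complex.Re R)) -lecR rnormE; exact: normc_ge_Re.
have [|b ub] := realc (@complex.Im R).
  move=> z w; rewrite -(raddfB (@complex.Im R)) -lecR rnormE.
  set y := z - w; rewrite normc_def lecR -sqrtr_sqr ler_wsqrtr//.
  by rewrite lerDr sqr_ge0.
exists (a +i* b : R[i]^o); apply/cvg_rnormP/cvgrPdist_lt => e e0.
have e20 : 0 < e / 2 by rewrite divr_gt0.
move/cvgrPdist_lt : ua => /(_ _ e20); move/cvgrPdist_lt : ub => /(_ _ e20).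
apply: filterS2 => n hb ha; rewrite sub0r normrN ger0_norm ?rnorm_ge0//.
have -> : u n - (a +i* b) = (complex.Re (u n) - a)%:C + (complex.Im (u n) - b)%:C * 'i%C :> R[i]^o.
  by case: (u n) => x y /=; simpc.
rewrite (le_lt_trans (rnormD _ _))// [e]splitr ltrD//.
  by rewrite rnormc normc_def/= expr0n addr0 sqrtr_sqr distrC.
by rewrite rnormc normrM !normc_def/= !(expr0n, addr0, add0r, expr1n, sqrtr1, mulr1, sqrtr_sqr, mulr0, subr0) normr1 mulr1 distrC.
Qed.

(** The pointwise limit of a Cauchy sequence of operators is linear, and stays
    within the Cauchy error of each operator of the sequence. *)
Lemma seq_complete_op (R : realType) (B : completeNormedModType R[i]) :
  seq_complete (bounded_op B).
Proof.
move=> T Tc.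
have TB n m x : rnorm (T n x - T m x) <= rnorm (T n - T m) * rnorm x by exact: (opnormP (T n - T m) x).
have /choice[f fT] x : exists l : B, T n x @[n --> \oo] --> l.
  apply: rcauchy_cvg => e e0.
  have e0' : 0 < e / (rnorm x + 1) by rewrite divr_gt0// ltr_wpDl// rnorm_ge0.
  have [N TN] := Tc _ e0'; exists N => m n Nm Nn.
  rewrite (le_trans (TB _ _ _))// (@le_trans _ _ (e / (rnorm x + 1) * rnorm x))//.
    by rewrite ler_wpM2r ?rnorm_ge0// TN.
  rewrite mulrAC ler_pdivrMr ?ler_wpM2l ?(ltW e0) ?lerDl//.
  by rewrite ltr_wpDl// rnorm_ge0.
have fl : linear f.
  move=> a x y; apply: (@cvg_unique _ (@norm_hausdorff _ B) (T n (a *: x + y) @[n --> \oo])); first exact: fT.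
  rewrite (_ : (fun n => T n (a *: x + y)) = (fun n => a *: T n x + T n y)); last first.
    by apply/funext => n; exact: bounded_op_linear.
  by apply: cvgD; [apply: cvgZl_tmp|]; exact: fT.
have dist N e x : (forall n, (N <= n)%N -> rnorm (T n - T N) <= e) ->
    rnorm (f x - T N x) <= e * rnorm x.
  move=> TN; have /cvg_rnorm : (T n x - T N x) @[n --> \oo] --> f x - T N x.
    by apply: cvgB => //; exact: cvg_cst.
  move=> h; apply: (ler_cvg_to h (cvg_cst _)).
  exists N => // n /= /TN; move=> /(ler_wpM2r (rnorm_ge0 x)); exact: le_trans.
have [N TN] := Tc 1 ltr01.
have fb : exists M : R, forall x, rnorm (f x) <= M * rnorm x.
  exists (1 + opnorm (T N)) => x.
  rewrite -(subrK (T N x) (f x)) (le_trans (rnormD _ _))// mulrDl lerD ?opnormP//.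
  by apply: dist => n Nn; exact: TN.
have [S SE] := mk_bounded_op fl fb.
exists S; apply/cvg_rnormP/cvgrPdist_le => e e0.
have [N' TN'] := Tc _ e0; exists N' => // n /= N'n.
rewrite sub0r normrN ger0_norm ?rnorm_ge0// rnorm_distrC; apply: opnorm_le => x x1.
have -> : (S - T n) x = f x - T n x by rewrite -SE.
apply: (@le_trans _ _ (e * rnorm x)); last by rewrite ler_piMr// ltW.
by apply: dist => m nm; apply: TN' => //; exact: leq_trans nm.
Qed.

Section bochner_estimates.
Context {R : realType} {d : measure_display} {T : measurableType d}.
Context (mu : {measure set T -> \bar R}).

(** F and phi are integrated jointly so that the cancellation between F p x and
    phi p x survives: for simple functions the estimate is the one for the
    B-valued simple function obtained by applying both to x, and the errors of
    approximation vanish in the limit. *)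
Lemma bochner_apply_sub_le (B : normedModType R[i]) (F : T -> bounded_op B) v
    (phi : T -> R[i]^o) w x :
  is_bochner_integral mu F v -> is_bochner_integral mu phi w ->
  norm_measurable F -> norm_measurable phi ->
  norm_measurable (fun p => F p x - phi p *: x) ->
  ((rnorm (v x - w *: x))%:E <= \int[mu]_p (rnorm (F p x - phi p *: x))%:E)%E.
Proof.
move=> [s [_ sL1 sv]] [t [_ tL1 tw]] mF mphi mD.
have linx : linear (fun S : bounded_op B => S x) by [].
have linz : linear (fun z : R[i]^o => - (z *: x)).
  by move=> a z z'; rewrite scalerDl opprD scalerN scalerA.
pose l n : seq (set T * B) := [seq (a.1, (a.2 : bounded_op B) x) | a <- wsets_of (s n)] ++
            [seq (a.1, - ((a.2 : R[i]) *: x)) | a <- wsets_of (t n)].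
have lok n : wsets_ok mu (l n).
  have [? _ _] := wsets_ofE (s n); have [? _ _] := wsets_ofE (t n).
  apply/wsets_ok_cat; split.
    exact: (@wsets_ok_map _ _ _ _ _ _ (fun S : bounded_op B => S x)).
  exact: (@wsets_ok_map _ _ _ _ _ _ (fun z : R[i]^o => - (z *: x))).
have levalE n p : wsets_eval (l n) p = sf_eval (s n) p x - sf_eval (t n) p *: x.
  have [_ <- _] := wsets_ofE (s n); have [_ <- _] := wsets_ofE (t n).
  rewrite wsets_eval_cat (@wsets_eval_map _ _ _ _ _ (fun S : bounded_op B => S x))//.
  by rewrite (@wsets_eval_map _ _ _ _ _ (fun z : R[i]^o => - (z *: x))).
have ltotE n : wsets_total mu (l n) = sf_integral (s n) x - sf_integral (t n) *: x.
  have [_ _ <-] := wsets_ofE (s n); have [_ _ <-] := wsets_ofE (t n).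
  rewrite /wsets_total wsets_integral_cat -!/(wsets_total _ _).
  rewrite (@wsets_total_map _ _ _ _ _ _ (fun S : bounded_op B => S x))//.
  by rewrite (@wsets_total_map _ _ _ _ _ _ (fun z : R[i]^o => - (z *: x))).
have mFs n : measurable_fun setT (fun p => (rnorm (F p - sf_eval (s n) p))%:E).
  apply/measurable_EFinP/measurable_rnorm; exact: norm_measurable_sub_sf.
have mts n : measurable_fun setT (fun p => (rnorm (phi p - sf_eval (t n) p))%:E).
  apply/measurable_EFinP/measurable_rnorm; exact: norm_measurable_sub_sf.
have mD' : measurable_fun setT (fun p => (rnorm (F p x - phi p *: x))%:E).
  exact/measurable_EFinP/measurable_rnorm.
set J := (\int[mu]_p _)%E.
pose a n := (\int[mu]_p (rnorm (F p - sf_eval (s n) p))%:E)%E.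
pose b n := (\int[mu]_p (rnorm (phi p - sf_eval (t n) p))%:E)%E.
have rx0 : (0 <= (rnorm x)%:E)%E by rewrite lee_fin rnorm_ge0.
have bound n : ((rnorm (sf_integral (s n) x - sf_integral (t n) *: x))%:E <=
    J + (rnorm x)%:E * a n + (rnorm x)%:E * b n)%E.
  rewrite -ltotE (le_trans (rnorm_wsets_total_le (lok n)))//.
  rewrite -!ge0_integralZl//; try by move=> p _; rewrite lee_fin rnorm_ge0.
  have ma : measurable_fun setT (fun p => (rnorm x)%:E * (rnorm (F p - sf_eval (s n) p))%:E)%E.
    exact: measurable_funeM.
  have mb : measurable_fun setT (fun p => (rnorm x)%:E * (rnorm (phi p - sf_eval (t n) p))%:E)%E.
    exact: measurable_funeM.
  have mDa : measurable_fun setT (fun p => (rnorm (F p x - phi p *: x))%:E +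
      (rnorm x)%:E * (rnorm (F p - sf_eval (s n) p))%:E)%E.
    exact: emeasurable_funD.
  rewrite /J -!ge0_integralD//;
    try by move=> p _; rewrite ?adde_ge0 ?mule_ge0// ?lee_fin ?rnorm_ge0.
  apply: ge0_le_integral => //.
  - by move=> p _; rewrite lee_fin rnorm_ge0.
  - apply/measurable_EFinP; have := measurable_rnorm_wsets 0 (lok n).
    by under eq_fun do rewrite add0r.
  - exact: emeasurable_funD.
  move=> p _; rewrite levalE -!EFinM -!EFinD lee_fin.
  set Fp := F p; set sp := sf_eval (s n) p; set tp := sf_eval (t n) p.
  have -> : sp x - tp *: x = (Fp x - phi p *: x) - (Fp - sp) x + (phi p - tp) *: x.
    have -> : (Fp - sp) x = Fp x - sp x by [].
    by rewrite scalerBl opprB (addrC (Fp x - _)) (addrA (sp x - _)) subrK addrA subrK.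
  rewrite (le_trans (rnormD _ _))// lerD//.
    by rewrite (le_trans (rnormB _ _))// lerD// mulrC opnormP.
  by rewrite rnormZ mulrC.
have lim : (rnorm (sf_integral (s n) x - sf_integral (t n) *: x))%:E @[n --> \oo]
    --> (rnorm (v x - w *: x))%:E.
  apply: cvg_EFin; first exact: nearW.
  apply: (@cvg_rnorm _ _ _ _ _ (fun n => sf_integral (s n) x - sf_integral (t n) *: x)).
  apply: cvgB.
    apply/cvg_rnormP; have /cvg_rnormP svn := sv.
    apply: (@squeeze_cvgr _ _ _ _ (cst 0) (fun n => rnorm (sf_integral (s n) - v) * rnorm x)).
    - by apply: nearW => n; rewrite rnorm_ge0/=; exact: (opnormP (sf_integral (s n) - v) x).
    - exact: cvg_cst.
    - by rewrite -(mul0r (rnorm x)); exact: cvgMr_tmp.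
  exact: cvgZr_tmp.
have rhs : (J + (rnorm x)%:E * a n + (rnorm x)%:E * b n)%E @[n --> \oo] --> J.
  have [->|/eqP Joo] := eqVneq J +oo%E.
    have e n : (+oo + (rnorm x)%:E * a n + (rnorm x)%:E * b n = +oo :> \bar R)%E.
      have a0 : (0 <= a n)%E by apply: integral_ge0 => p _; rewrite lee_fin rnorm_ge0.
      have b0 : (0 <= b n)%E by apply: integral_ge0 => p _; rewrite lee_fin rnorm_ge0.
      by rewrite -addeA addye// gt_eqF// (lt_le_trans (ltNyr 0))// adde_ge0// mule_ge0.
    by under eq_fun do rewrite e; exact: cvg_cst.
  have J0 : (0 <= J)%E by apply: integral_ge0 => p _; rewrite lee_fin rnorm_ge0.
  have Jfin : J \is a fin_num by rewrite ge0_fin_numE// ltey; exact/eqP.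
  rewrite -[X in _ --> X]adde0 -[X in _ --> (X + _)%E]adde0.
  rewrite -{2}(mule0 (rnorm x)%:E) -{1}(mule0 (rnorm x)%:E).
  apply: cvgeD; first by rewrite mule0 fin_num_adde_defl.
    apply: cvgeD; first by rewrite mule0 fin_num_adde_defl.
      exact: cvg_cst.
    exact: cvgeZl.
  exact: cvgeZl.
by apply: (lee_cvg_to lim rhs); exact: nearW.
Qed.

Context (g : R[i]^o -> R).
Hypothesis glin : forall (r : R) (z z' : R[i]^o), g (r%:C *: z + z') = r * g z + g z'.
Hypothesis gle : forall z : R[i]^o, `|g z| <= rnorm z.

Lemma functional_wsets_integral (l : seq (set T * R[i]^o)) : wsets_ok mu l ->
  mu.-integrable setT (fun p => (g (wsets_eval l p))%:E) /\
  (\int[mu]_p (g (wsets_eval l p))%:E)%E = (g (wsets_total mu l))%:E.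
Proof.
have g0 : g 0 = 0.
  by apply/eqP; rewrite -normr_eq0 eq_le normr_ge0 andbT -(@rnorm0 R (R[i]^o)) gle.
rewrite /wsets_total; elim: l => [|a l ih] /=.
  by move=> _; rewrite g0; split; [exact: integrable0|rewrite integral0].
move=> [ma aoo /ih[il lE]].
have iI : mu.-integrable setT (fun p => (\1_(a.1) p)%:E).
  apply/integrableP; split; first by apply/measurable_EFinP; exact: measurable_indic.
  under eq_integral do rewrite gee0_abs ?lee_fin//.
  by rewrite integral_indic// setIT.
have iI' : mu.-integrable setT (fun p => ((g a.2)%:E * (\1_(a.1) p)%:E)%E).
  exact: integrableZl.
have eqE : {in setT, (fun p => (g a.2)%:E * (\1_(a.1) p)%:E +
    (g (wsets_eval l p))%:E)%E =1
    (fun p => (g ((\1_(a.1) p)%:C *: a.2 + wsets_eval l p))%:E)}.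
  by move=> p _; rewrite glin EFinD EFinM muleC.
split.
  by apply: eq_integrable eqE _ => //; exact: integrableD.
rewrite -(eq_integral _ _ eqE) integralD//= lE integralZl// integral_indic//.
by rewrite setTI setIT glin EFinD EFinM fineK ?ge0_fin_numE// muleC.
Qed.

(** With g the real or the imaginary part this reduces complex Bochner
    integrals to Lebesgue integrals. *)
Lemma functional_bochner_integral (phi : T -> R[i]^o) w : is_bochner_integral mu phi w ->
  norm_measurable phi ->
  mu.-integrable setT (fun p => (g (phi p))%:E) ->
  (g w)%:E = (\int[mu]_p (g (phi p))%:E)%E.
Proof.
move=> [t [_ tL1 tw]] mphi iphi.
have gLip (z z' : R[i]^o) : `|g z - g z'| <= rnorm (z - z').
  rewrite [g z - _](_ : _ = g (z - z')) ?gle//.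
  have -> : z - z' = (-1)%:C *: z' + z :> R[i]^o.
    by rewrite (rmorphN1 (real_complex R)) scaleN1r addrC.
  by rewrite glin mulN1r addrC.
have lim1 : (g (sf_integral (t n)))%:E @[n --> \oo] --> (g w)%:E.
  apply: cvg_EFin; first exact: nearW.
  apply/cvgrPdist_lt => e e0; move/cvg_rnormP : tw => /cvgrPdist_lt /(_ _ e0).
  apply: filterS => n; rewrite sub0r normrN ger0_norm ?rnorm_ge0// distrC.
  by apply: le_lt_trans; exact: gLip.
have rexp n : [/\ mu.-integrable setT (fun p => (g (sf_eval (t n) p))%:E) &
   (\int[mu]_p (g (sf_eval (t n) p))%:E)%E = (g (sf_integral (t n)))%:E].
  by have [ok <- <-] := wsets_ofE (t n); have [] := functional_wsets_integral ok.
have fin : (\int[mu]_p (g (phi p))%:E)%E \is a fin_num by exact: integrable_fin_num.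
have lim2 : (g (sf_integral (t n)))%:E @[n --> \oo] -->
    (\int[mu]_p (g (phi p))%:E)%E.
  have sq : (`|(g (sf_integral (t n)))%:E - \int[mu]_p (g (phi p))%:E|%E) @[n --> \oo] --> 0%E.
    apply: (squeeze_cvge _ (cvg_cst _) tL1).
    apply: nearW => n; rewrite abse_ge0/=.
    have [it <-] := rexp n; rewrite -integralB//.
    apply: (le_trans (le_abse_integral _ _ _)) => //.
      by case/integrableP : (integrableB measurableT it iphi).
    apply: ge0_le_integral => //.
    - by apply: measurableT_comp => //; case/integrableP : (integrableB measurableT it iphi).
    - by apply/measurable_EFinP/measurable_rnorm; exact: norm_measurable_sub_sf.
    by move=> p _; rewrite lee_fin/= distrC.
  rewrite -(fineK fin) in sq *; apply: cvg_EFin; first exact: nearW.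
  apply/cvgrPdist_le => e e0.
  move/fine_cvgP : sq => [_ /cvgrPdist_le /(_ _ e0)]; apply: filterS => n /=.
  by rewrite sub0r normrN normr_id distrC.
exact: (cvg_unique _ lim1 lim2).
Qed.

End bochner_estimates.

(** * Open sets of the plane *)

Section plane.
Context {R : realType}.
Local Notation mR := (measurableTypeR R).
Local Notation leb := (@lebesgue_measure R).

(** The Borel sets of the plane are meant here in the product sigma-algebra; an
    open set belongs to it as the union of the countably many rational boxes
    that it contains. *)
Lemma open_measurable2 (U : set (R * R)) : open U ->
  measurable (U : set (mR * mR)).
Proof.
move=> oU.
pose box (q : rat * rat * nat) : set (R * R) :=
  `](ratr q.1.1 - q.2.+1%:R^-1), (ratr q.1.1 + q.2.+1%:R^-1)[ `*`
  `](ratr q.1.2 - q.2.+1%:R^-1), (ratr q.1.2 + q.2.+1%:R^-1)[.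
have -> : U = \bigcup_(q : rat * rat * nat) (if `[< box q `<=` U >] then box q else set0).
  apply/seteqP; split=> [[x y] Uxy|p [q _]]; last by case: asboolP => // bU /bU.
  have : nbhs (x, y) U by exact: open_nbhs_nbhs.
  move=> /nbhs_ballP[e /= e0 eU].
  have [n _ /(_ n (leqnn _)) /= nE] : \forall n \near \oo, (n.+1%:R^-1 : R) < e / 2.
    have e20 : 0 < e / 2 by rewrite divr_gt0.
    have := @cvg_harmonic R => /cvgrPdist_lt /(_ _ e20); apply: filterS => n.
    by rewrite /harmonic sub0r normrN ger0_norm// invr_ge0.
  have d0 : 0 < (n.+1%:R^-1 : R) by rewrite invr_gt0.
  have [q1 /andP[q1l q1r]] : exists q : rat, x - n.+1%:R^-1 < ratr q < x + n.+1%:R^-1.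
    have /rat_in_itvoo[q] : x - n.+1%:R^-1 < x + n.+1%:R^-1 by rewrite ltrD2l gtrN.
    by rewrite in_itv /= => qx; exists q.
  have [q2 /andP[q2l q2r]] : exists q : rat, y - n.+1%:R^-1 < ratr q < y + n.+1%:R^-1.
    have /rat_in_itvoo[q] : y - n.+1%:R^-1 < y + n.+1%:R^-1 by rewrite ltrD2l gtrN.
    by rewrite in_itv /= => qx; exists q.
  exists (q1, q2, n) => //; rewrite {}/box /=.
  move: (n.+1%:R^-1 : R) nE d0 q1l q1r q2l q2r => dd nE d0 q1l q1r q2l q2r.
  case: asboolP => [_|[]].
    by split; rewrite /= in_itv/=; apply/andP; split; lra.
  move=> [x' y'] []; rewrite /= !in_itv/= => /andP[x1 x2] /andP[y1 y2].
  by apply: eU; split; rewrite /ball/= ltr_norml; apply/andP; split; lra.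
apply: countable_bigcupT_measurable; first exact: countableP.
move=> q; case: asboolP => // _; apply: measurableX; exact: measurable_itv.
Qed.

Lemma continuous_measurable_fun2 (U : set (R * R)) (f : R * R -> R) : open U ->
  (forall p, U p -> {for p, continuous f}) ->
  measurable_fun (U : set (mR * mR)) f.
Proof.
move=> oU cf; apply: (measurability _ (RGenOInfty.measurableE R)).
move=> _ [_ [a ->] <-]; apply: open_measurable2.
rewrite openE => p [Up fp]; apply: filterI; first exact: open_nbhs_nbhs.
apply: (cf _ Up); apply: open_nbhs_nbhs; split => //; exact: interval_open.
Qed.

End plane.

(** * Integration of partial derivatives over rectangles *)

Section rectangles.
Context {R : realType}.
Local Notation mR := (measurableTypeR R).
Local Notation leb := (@lebesgue_measure R).

Definition off_axis : set (R * R) := [set p | p.2 != 0].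

Lemma open_off_axis : open off_axis.
Proof.
rewrite (_ : off_axis = snd @^-1` [set~ 0]); last first.
  by apply/seteqP; split=> p /= /eqP.
apply: open_comp; first by move=> p _; exact: cvg_snd.
by rewrite openC; exact: accessible_closed_set1 (hausdorff_accessible (@Rhausdorff R)) _.
Qed.

Definition rect (a b c d : R) : set (R * R) := `[a, b] `*` `[c, d].

Lemma measurable_rect a b c d : measurable (rect a b c d : set (mR * mR)).
Proof. by apply: measurableX; exact: measurable_itv. Qed.

Lemma rect_off_axis (a b c d : R) : 0 \notin `[c, d] -> rect a b c d `<=` off_axis.
Proof.
move=> c0d [x y] [_ /= yE]; by apply: contra c0d => /eqP/= <-.
Qed.

Lemma lebesgue2_rect a b c d : (lebesgue2 R (rect a b c d) < +oo)%E.
Proof.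
have -> : lebesgue2 R (rect a b c d) = (leb `[a, b]%classic * leb `[c, d]%classic)%E.
  by apply: product_measure1E; exact: measurable_itv.
rewrite !lebesgue_measure_itv/=.
by case: ifP => _; case: ifP => _; rewrite ?mule0 ?mul0e ?ltry// -!EFinB -EFinM ltry.
Qed.

Lemma rect_integrable (W : R -> R -> R) (a b c d : R) : 0 \notin `[c, d] ->
  (forall p, off_axis p -> {for p, continuous (fun p : R * R => W p.1 p.2)}) ->
  (lebesgue2 R).-integrable (rect a b c d) (fun p => (W p.1 p.2)%:E).
Proof.
move=> c0d cW; apply: measurable_bounded_integrable.
- exact: measurable_rect.
- exact: lebesgue2_rect.
- apply: (@measurable_funS _ _ _ _ off_axis).
  + exact: open_measurable2 open_off_axis.
  + exact: rect_off_axis.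
  + exact: continuous_measurable_fun2 open_off_axis cW.
have : compact ((fun p : R * R => W p.1 p.2) @` rect a b c d).
  apply: continuous_compact.
    apply/continuous_in_subspaceT => p; rewrite inE => /(rect_off_axis c0d); exact: cW.
  by apply: compact_setX; exact: segment_compact.
move=> /compact_bounded [M [Mr HM]]; exists M; split => // r Mr' p pr.
by apply: (HM _ Mr'); exists p.
Qed.

(** Fubini's theorem, with the fundamental theorem of calculus on each line. *)
Lemma rect_integral_dx (W W1 : R -> R -> R) (a b c d : R) : a < b -> 0 \notin `[c, d] ->
  (forall x y : R, y != 0 -> is_derive x 1 (W^~ y) (W1 x y)) ->
  (forall p, off_axis p -> {for p, continuous (fun p : R * R => W1 p.1 p.2)}) ->
  (\int[lebesgue2 R]_(p in rect a b c d) (W1 p.1 p.2)%:E =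
   \int[leb]_(y in `[c, d]) (W b y - W a y)%:E)%E.
Proof.
move=> ab c0d dW cW; have := rect_integrable a b c0d cW.
move/(integrable_mkcond _ (measurable_rect a b c d)) => irect.
rewrite integral_mkcond /lebesgue2 -(integral21_prod_meas1 irect).
rewrite [RHS]integral_mkcond; apply: eq_integral => y _.
rewrite [RHS]patchE; case: ifPn => yE; last first.
  apply: integral0_eq => x _; rewrite patchE ifF//; apply/negbTE; apply: contra yE.
  by rewrite !inE => -[].
have y0 : y != 0 by apply: contra c0d => /eqP <-; move: yE; rewrite inE.
rewrite EFinB -(@continuous_FTC2 _ (W1^~ y) (W^~ y) a b)//.
- rewrite [RHS]integral_mkcond; apply: eq_integral => x _.
  rewrite !patchE; congr (if _ then _ else _).
  by apply/idP/idP; rewrite !inE; [case|move=> xE; split => //; move: yE; rewrite inE].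
- apply/continuous_in_subspaceT => x _.
  apply: (@continuous_comp _ _ _ (fun x => (x, y)) (fun p : R * R => W1 p.1 p.2)).
    by apply: (@cvg_pair _ _ _ _ (nbhs x) (nbhs y)); [exact: cvg_id|exact: cvg_cst].
  exact: cW.
- have dr x : derivable (W^~ y) x 1 by case: (dW x y y0).
  have cr x : {for x, continuous (W^~ y)} by apply: differentiable_continuous; exact/derivable1_diffP.
  split => //; [exact: cvg_at_right_filter (cr a)|exact: cvg_at_left_filter (cr b)].
- by move=> x _; rewrite derive1E; case: (dW x y y0).
Qed.

Lemma rect_integral_dy (W W2 : R -> R -> R) (a b c d : R) : c < d -> 0 \notin `[c, d] ->
  (forall x y : R, y != 0 -> is_derive y 1 (W x) (W2 x y)) ->
  (forall p, off_axis p -> {for p, continuous (fun p : R * R => W2 p.1 p.2)}) ->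
  (\int[lebesgue2 R]_(p in rect a b c d) (W2 p.1 p.2)%:E =
   \int[leb]_(x in `[a, b]) (W x d - W x c)%:E)%E.
Proof.
move=> cd c0d dW cW; have := rect_integrable a b c0d cW.
move/(integrable_mkcond _ (measurable_rect a b c d)) => irect.
have y0 y : y \in `[c, d] -> y != 0 by move=> yE; apply: contra c0d => /eqP <-.
rewrite integral_mkcond /lebesgue2 -(integral12_prod_meas1 irect).
rewrite [RHS]integral_mkcond; apply: eq_integral => x _.
rewrite [RHS]patchE; case: ifPn => xE; last first.
  apply: integral0_eq => y _; rewrite patchE ifF//; apply/negbTE; apply: contra xE.
  by rewrite !inE => -[].
rewrite EFinB -(@continuous_FTC2 _ (W2 x) (W x) c d)//.
- rewrite [RHS]integral_mkcond; apply: eq_integral => y _.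
  rewrite !patchE; congr (if _ then _ else _).
  by apply/idP/idP; rewrite !inE; [case|move=> yE; split => //; move: xE; rewrite inE].
- apply/continuous_in_subspaceT => y; rewrite inE => /y0 {}y0.
  apply: (@continuous_comp _ _ _ (fun y => (x, y)) (fun p : R * R => W2 p.1 p.2)).
    by apply: (@cvg_pair _ _ _ _ (nbhs x) (nbhs y)); [exact: cvg_cst|exact: cvg_id].
  exact: cW.
- have dr y : y \in `[c, d] -> derivable (W x) y 1 by move=> /y0 {}y0; case: (dW x y y0).
  have cr y : y \in `[c, d] -> {for y, continuous (W x)}.
    by move=> yE; apply: differentiable_continuous; exact/derivable1_diffP/dr.
  split; first by move=> y yE; apply: dr; exact: subset_itv_oo_cc.
    by apply: cvg_at_right_filter (cr c _); rewrite in_itv/= lexx ltW.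
  by apply: cvg_at_left_filter (cr d _); rewrite in_itv/= lexx ltW.
- by move=> y /subset_itv_oo_cc/y0 {}y0; rewrite derive1E; case: (dW x y y0).
Qed.

End rectangles.

(** * Derivatives of pointwise expressions *)

Section pointwise_derivation.
Context {R : realType}.
Implicit Types (f g : R -> R) (x a b c : R).

(** These rules are phrased for explicit abstractions, so that the derivative of
    an expression can be assembled as a term. *)
Lemma is_derive_addf f g x a b : is_derive x 1 f a -> is_derive x 1 g b ->
  is_derive x 1 (fun t => f t + g t) (a + b).
Proof. exact: is_deriveD. Qed.

Lemma is_derive_subf f g x a b : is_derive x 1 f a -> is_derive x 1 g b ->
  is_derive x 1 (fun t => f t - g t) (a - b).
Proof. exact: is_deriveB. Qed.

Lemma is_derive_mulf f g x a b : is_derive x 1 f a -> is_derive x 1 g b ->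
  is_derive x 1 (fun t => f t * g t) (a * g x + f x * b).
Proof.
move=> fa gb; apply: (is_derive_eq (is_deriveM fa gb)).
by rewrite /GRing.scale/= addrC mulrC.
Qed.

Lemma is_derive_cstf x c : is_derive x 1 (fun=> c) 0.
Proof. exact: is_derive_cst. Qed.

Lemma is_derive_idf x : is_derive x 1 (fun t => t) 1.
Proof. exact: is_derive_id. Qed.

Lemma is_derive_scalef c f x a : is_derive x 1 f a ->
  is_derive x 1 (fun t => c * f t) (c * a).
Proof. exact: is_deriveZ. Qed.

Lemma is_derive_invf f x a : f x != 0 -> is_derive x 1 f a ->
  is_derive x 1 (fun t => (f t)^-1) (- a / f x ^+ 2).
Proof.
move=> fx0 fa; apply: (is_derive_eq (is_deriveV fx0 fa)).
by rewrite /GRing.scale/= mulrC mulrN mulNr.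
Qed.

Lemma is_derive_compf f g x a b : is_derive (g x) 1 f a -> is_derive x 1 g b ->
  is_derive x 1 (fun t => f (g t)) (a * b).
Proof. exact: is_derive1_comp. Qed.

Lemma is_derive_continuous f x a : is_derive x 1 f a -> {for x, continuous f}.
Proof.
by case=> df _; apply: differentiable_continuous; exact/derivable1_diffP.
Qed.

End pointwise_derivation.

(** * Integrals of powers *)

Section power_integrals.
Context {R : realType}.
Local Notation mR := (measurableTypeR R).
Local Notation leb := (@lebesgue_measure R).

Lemma ler_powR_neg (r x y : R) : r <= 0 -> 0 < x -> x <= y -> y `^ r <= x `^ r.
Proof.
move=> r0 x0 xy; rewrite -(opprK r) !(powRN _ (- r)).
rewrite lef_pV2 ?posrE ?powR_gt0//; last exact: lt_le_trans xy.
by apply: ge0_ler_powR; rewrite ?nnegrE ?oppr_ge0// ltW// (lt_le_trans x0).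
Qed.

Lemma powR_neg_cvg (b : R) : b < 0 -> a `^ b @[a --> +oo] --> (0 : R).
Proof.
move=> b0; apply/cvgrPdist_le => e e0; near=> a.
have A0 : 0 < e `^ b^-1 by rewrite powR_gt0.
rewrite sub0r normrN ger0_norm ?powR_ge0// (@le_trans _ _ ((e `^ b^-1) `^ b))//.
  by apply: ler_powR_neg => //; exact: ltW.
by rewrite -powRrM mulVf ?lt_eqF// powRr1// ltW.
Unshelve. all: by end_near. Qed.

Lemma powR_neg_cvgn (b : R) : b < 0 -> (n.+1%:R : R) `^ b @[n --> \oo] --> (0 : R).
Proof.
move=> b0; apply: (cvg_comp _ _ _ (powR_neg_cvg b0)).
apply/cvgryPge => A; near=> n; rewrite (@le_trans _ _ n%:R)//; last by rewrite ler_nat.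
by near: n; apply: nbhs_infty_ger.
Unshelve. all: by end_near. Qed.

Lemma continuous_powR_comp (T : topologicalType) (f : T -> R) (r : R) x :
  0 < f x -> {for x, continuous f} -> {for x, continuous (fun x => f x `^ r)}.
Proof.
move=> f0 cf; apply: (@continuous_comp _ _ _ f (@powR R ^~ r)) => //.
apply: differentiable_continuous; apply/derivable1_diffP.
by case: (is_derive1_powR r f0).
Qed.

(** By symmetry only [0, +oo[ matters, where (1 + x)^b / b is a primitive that
    vanishes at infinity. *)
Lemma integral_powR_norm1 (b : R) : b < 0 ->
  (\int[leb]_x ((1 + `|x|) `^ (b - 1))%:E < +oo)%E.
Proof.
move=> b0; rewrite (@ge0_symfun_integralT _ (fun x => (1 + `|x|) `^ (b - 1))); first last.
- by move=> x /=; rewrite normrN.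
- move=> x; apply: (@continuous_powR_comp R (fun x => 1 + `|x|)); first by rewrite ltr_pwDl.
  by apply: cvgD; [exact: cvg_cst|exact: norm_continuous].
- by move=> x; exact: powR_ge0.
rewrite lte_mul_pinfty//.
rewrite -set_itvcy.
have -> : (\int[leb]_(x in `[0%R, +oo[) ((1 + `|x|) `^ (b - 1))%:E =
  \int[leb]_(x in `[0%R, +oo[) ((1 + x) `^ (b - 1))%:E)%E.
  by apply: eq_integral => x; rewrite inE/= in_itv/= andbT => x0; rewrite ger0_norm.
have dp (x : R) : 0 <= x -> is_derive x 1 (fun x => b^-1 * (1 + x) `^ b) ((1 + x) `^ (b - 1)).
  move=> x0; have x10 : 0 < 1 + x by rewrite ltr_pwDl.
  have dx := is_derive_addf (is_derive_cstf x 1) (is_derive_idf x).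
  have dc := is_derive_scalef b^-1 (is_derive_compf (is_derive1_powR b x10) dx).
  by apply: (is_derive_eq dc); rewrite add0r mulr1 mulrA mulVf ?mul1r// lt_eqF.
rewrite (@ge0_continuous_FTC2y _ _ (fun x => b^-1 * (1 + x) `^ b) 0 0)//.
- by rewrite addr0 powR1 -EFinB ltry.
- by move=> x _; exact: powR_ge0.
- apply/continuous_in_subspaceT => x; rewrite inE/= in_itv/= andbT => x0.
  apply: (@continuous_powR_comp R (fun x => 1 + x)); first by rewrite ltr_pwDl.
  by apply: cvgD; [exact: cvg_cst|exact: cvg_id].
- rewrite -(mulr0 b^-1); apply: cvgMl_tmp.
  apply: (cvg_comp _ _ _ (powR_neg_cvg b0)).
  by apply: cvg_addrl.
- by move=> x x0; case: (dp x (ltW x0)).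
- have cr : {for 0, continuous (fun x : R => b^-1 * (1 + x) `^ b)}.
    exact: is_derive_continuous (dp 0 (lexx _)).
  exact: cvg_at_right_filter cr.
- by move=> x; rewrite in_itv/= andbT => x0; rewrite derive1E; case: (dp x (ltW x0)).
Qed.

Lemma measurable_norm_powR r (D : set mR) :
  measurable_fun D (fun y : R => `|y| `^ r).
Proof.
apply: (@measurableT_comp _ _ _ _ _ _ (@powR R ^~ r) D (fun y => `|y|)).
  exact: measurable_powR.
by apply: measurable_funTS; exact: normr_measurable.
Qed.

Lemma measurable_norm_shell (M : R) : measurable [set y : mR | (0 < `|y| <= M)%R].
Proof.
have h1 : measurable_fun [set: mR] (fun y : R => 0 < `|y|).
  by apply: measurable_fun_ltr => //; exact: normr_measurable.
have h2 : measurable_fun [set: mR] (fun y : R => `|y| <= M).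
  by apply: measurable_fun_ler => //; exact: normr_measurable.
have {}h1 := h1 measurableT [set true] I.
have {}h2 := h2 measurableT [set true] I.
rewrite (_ : [set _ | _] = (setT `&` (fun y : mR => 0 < `|y|) @^-1` [set true]) `&`
   (setT `&` (fun y : mR => `|y| <= M) @^-1` [set true])).
  exact: measurableI.
by apply/seteqP; split => y /= => [/andP[-> ->]//|[[_ ->] [_ ->]]//].
Qed.

(** The singularity at 0 is exhausted by the intervals M / (i + 2) <= |y| <= M,
    on which |y|^t / t is, up to sign, a primitive. *)
Lemma integral_norm_powR_le (t M : R) : 0 < t -> 0 < M ->
  (\int[leb]_(y in [set y | (0 < `|y| <= M)%R]) (`|y| `^ (t - 1))%:E <= (2 * (M `^ t / t))%:E)%E.
Proof.
move=> t0 M0.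
pose e (i : nat) : R := M / i.+2%:R.
have e0 i : 0 < e i by rewrite divr_gt0.
have eM i : e i < M by rewrite ltr_pdivrMr// ltr_pMr// ltr1n.
have e_cvg : e i @[i --> \oo] --> (0 : R).
  rewrite -(mulr0 M); apply: cvgMl_tmp.
  by have := @cvg_harmonic R; rewrite -cvg_shiftS.
pose S (i : nat) : set R := `[e i, M] `|` `[- M, - e i].
have -> : [set y : R | (0 < `|y| <= M)%R] = \bigcup_i S i.
  apply/seteqP; split=> [y /= /andP[y0 yM]|y [i _]].
    have [n _ /(_ n (leqnn _)) /= nE] : \forall n \near \oo, e n < `|y|.
      move/cvgrPdist_lt : e_cvg => /(_ _ y0); apply: filterS => n.
      by rewrite sub0r normrN ger0_norm// ltW.
    exists n => //; rewrite /S/= !in_itv/=; case: (leP 0 y) => yy.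
      by left; move: nE yM; rewrite ger0_norm// => /ltW -> ->.
    by right; move: nE yM; rewrite ltr0_norm// lerNl => nE ->; rewrite lerNr ltW.
  rewrite /S/= !in_itv/= => -[] /andP[h1 h2].
    have y0 : 0 < y by exact: lt_le_trans h1.
    by rewrite gtr0_norm// y0 h2.
  have y0 : y < 0 by rewrite (le_lt_trans h2)// oppr_lt0.
  by rewrite ltr0_norm// oppr_gt0 y0/= lerNl.
have mS i : measurable (S i) by apply: measurableU; exact: measurable_itv.
have mh (D : set mR) : measurable_fun D (fun y : R => (`|y| `^ (t - 1))%:E).
  by apply/measurable_EFinP; exact: measurable_norm_powR.
have ndS : nondecreasing_seq S.
  move=> i j ij; apply/subsetPset => y; rewrite /S/= !in_itv/=.
  have ee : e j <= e i by rewrite ler_pM2l// lef_pV2 ?posrE// ler_nat.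
  by move=> [] /andP[h1 h2]; [left|right]; apply/andP; split => //; lra.
have h0 i x : S i x -> (0 <= (`|x| `^ (t - 1))%:E)%E by rewrite lee_fin powR_ge0.
have := @ge0_nondecreasing_set_cvg_integral _ mR R S (fun y => (`|y| `^ (t - 1))%:E) leb ndS mS (fun i => mh (S i)) h0.
move=> cvgS; apply: (lee_cvg_to cvgS (cvg_cst _)).
apply: nearW => i; rewrite ge0_integral_setU//; last first.
  apply/disj_setPS => y [] /=; rewrite !in_itv/= => /andP[h1 h2] /andP[h3 h4].
  by have := e0 i; lra.
have dp (x : R) : 0 < x -> is_derive x 1 (fun x => t^-1 * x `^ t) (x `^ (t - 1)).
  move=> x0; apply: (is_derive_eq (is_derive_scalef t^-1 (is_derive1_powR t x0))).
  by rewrite mulrA mulVf ?mul1r// gt_eqF.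
have dn (x : R) : x < 0 -> is_derive x 1 (fun x => - (t^-1 * (- x) `^ t)) ((- x) `^ (t - 1)).
  move=> x0; have x0' : 0 < - x by rewrite oppr_gt0.
  have dc := is_derive_compf (f := fun x => t^-1 * x `^ t) (dp _ x0') (is_deriveNid x 1).
  have := is_derive_scalef (-1) dc.
  rewrite (_ : (fun x => - (t^-1 * (- x) `^ t)) = (fun x => -1 * (t^-1 * (- x) `^ t))).
    by move/is_derive_eq; apply; rewrite mulrN1 mulN1r opprK.
  by apply/funext => z; rewrite mulN1r.
have I1 : (\int[leb]_(y in `[e i, M]) (`|y| `^ (t - 1))%:E = (t^-1 * M `^ t)%:E - (t^-1 * e i `^ t)%:E)%E.
  rewrite -(@continuous_FTC2 _ (fun x => x `^ (t - 1)) (fun x => t^-1 * x `^ t) (e i) M)//.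
  - apply: eq_integral => x; rewrite inE/= in_itv/= => /andP[ex _].
    by rewrite gtr0_norm// (lt_le_trans (e0 i)).
  - apply/continuous_in_subspaceT => x; rewrite inE/= in_itv/= => /andP[ex _].
    by apply: (@continuous_powR_comp R id); [exact: lt_le_trans ex|exact: cvg_id].
  - split.
    + by move=> x; rewrite in_itv/= => /andP[ex _]; case: (dp x (lt_trans (e0 i) ex)).
    + exact: cvg_at_right_filter (is_derive_continuous (dp _ (e0 i))).
    + exact: cvg_at_left_filter (is_derive_continuous (dp _ M0)).
  - move=> x; rewrite in_itv/= => /andP[ex _]; rewrite derive1E.
    by case: (dp x (lt_trans (e0 i) ex)).
have I2 : (\int[leb]_(y in `[(- M)%R, (- e i)%R]) (`|y| `^ (t - 1))%:E = (- (t^-1 * e i `^ t))%:E - (- (t^-1 * M `^ t))%:E)%E.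
  have := @continuous_FTC2 _ (fun x => (- x) `^ (t - 1)) (fun x => - (t^-1 * (- x) `^ t)) (- M) (- e i).
  rewrite !opprK => <-//.
  - apply: eq_integral => x; rewrite inE/= in_itv/= => /andP[_ ex].
    by rewrite ltr0_norm// (le_lt_trans ex)// oppr_lt0.
  - by rewrite ltrN2.
  - apply/continuous_in_subspaceT => x; rewrite inE/= in_itv/= => /andP[_ ex].
    apply: (@continuous_powR_comp R -%R); last exact: opp_continuous.
    by rewrite oppr_gt0 (le_lt_trans ex)// oppr_lt0.
  - have M0' : - M < 0 by rewrite oppr_lt0.
    have e0' : - e i < 0 by rewrite oppr_lt0.
    split.
    + by move=> x; rewrite in_itv/= => /andP[_ ex]; case: (dn x (lt_trans ex e0')).
    + exact: cvg_at_right_filter (is_derive_continuous (dn _ M0')).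
    + exact: cvg_at_left_filter (is_derive_continuous (dn _ e0')).
  - move=> x; rewrite in_itv/= => /andP[_ ex]; rewrite derive1E.
    by case: (dn x (lt_trans ex _)); rewrite ?oppr_lt0.
rewrite I1 I2 -!EFinB -EFinD lee_fin.
have : 0 <= t^-1 * e i `^ t by rewrite mulr_ge0 ?powR_ge0// invr_ge0 ltW.
by rewrite [M `^ t / t]mulrC; lra.
Qed.

(** With t = n - alpha this is, up to a constant, the product of the bound
    (1 + |x|)^(a - n - 1) |y|^n for the dbar derivative of the almost analytic
    extension and the bound |y|^(-1) ((1 + |x|) / |y|)^alpha for the resolvent. *)
Definition strip_weight (a t : R) (p : R * R) : R :=
  (1 + `|p.1|) `^ (a - t - 1) * `|p.2| `^ (t - 1) *
  \1_[set p : R * R | 0 < `|p.2| <= 2 * (1 + `|p.1|)] p.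

Lemma strip_weight_ge0 a t p : 0 <= strip_weight a t p.
Proof. by rewrite /strip_weight !mulr_ge0 ?powR_ge0. Qed.

(** Integrating |y|^(t - 1) over 0 < |y| <= 2 (1 + |x|) produces a multiple of
    (1 + |x|)^t, which leaves the integrable function (1 + |x|)^(a - 1). *)
Lemma integrable_strip_weight (a t : R) : a < 0 -> 0 < t ->
  (lebesgue2 R).-integrable setT (fun p => (strip_weight a t p)%:E).
Proof.
move=> a0 t0.
have m1 : measurable_fun [set: mR * mR] (fun p : R * R => 1 + `|p.1|).
  apply: measurable_funD; first exact: measurable_cst.
  by apply: (@measurableT_comp _ _ _ _ _ _ (@Num.norm _ R)) => //; exact: normr_measurable.
have m2 : measurable_fun [set: mR * mR] (fun p : R * R => `|p.2|).
  by apply: (@measurableT_comp _ _ _ _ _ _ (@Num.norm _ R)) => //; exact: normr_measurable.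
have mset : measurable ([set p : R * R | 0 < `|p.2| <= 2 * (1 + `|p.1|)] : set (mR * mR)).
  have h1 : measurable_fun [set: mR * mR] (fun p : R * R => 0 < `|p.2|).
    exact: measurable_fun_ltr.
  have h2 : measurable_fun [set: mR * mR] (fun p : R * R => `|p.2| <= 2 * (1 + `|p.1|)).
    by apply: measurable_fun_ler => //; apply: measurable_funM.
  have {}h1 := h1 measurableT [set true] I.
  have {}h2 := h2 measurableT [set true] I.
  rewrite (_ : [set _ | _] = (setT `&` (fun p : mR * mR => 0 < `|p.2|) @^-1` [set true]) `&`
     (setT `&` (fun p : mR * mR => `|p.2| <= 2 * (1 + `|p.1|)) @^-1` [set true])).
    exact: measurableI.
  apply/seteqP; split => p /= => [/andP[-> ->]//|[[_ ->] [_ ->]]//].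
have mw : measurable_fun [set: mR * mR] (fun p => (strip_weight a t p)%:E).
  apply/measurable_EFinP; apply: measurable_funM; last exact: measurable_indic.
  apply: measurable_funM.
    by apply: (@measurableT_comp _ _ _ _ _ _ (@powR R ^~ _)) m1; exact: measurable_powR.
  by apply: (@measurableT_comp _ _ _ _ _ _ (@powR R ^~ _)) m2; exact: measurable_powR.
apply/(integrable12ltyP _ _ mw).
apply: (@le_lt_trans _ _ (\int[leb]_x ((2 * (2 `^ t / t))%:E * ((1 + `|x|) `^ (a - 1))%:E))%E).
  apply: ge0_le_integral => //.
  - by move=> x _; apply: integral_ge0.
  - have := @measurable_fun_fubini_tonelli_F _ _ mR mR R leb
      (fun p => `|(strip_weight a t p)%:E|%E).
    by apply => //; exact: measurableT_comp.
  - apply: measurable_funeM; apply/measurable_EFinP.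
    apply: (@measurableT_comp _ _ _ _ _ _ (@powR R ^~ _)); first exact: measurable_powR.
    by apply: measurable_funD => //; exact: normr_measurable.
  move=> x _; set M := 2 * (1 + `|x|).
  have m0 : 0 < 1 + `|x| by rewrite ltr_pwDl.
  have M0 : 0 < M by rewrite mulr_gt0.
  rewrite (eq_integral (fun y : mR => (((1 + `|x : R|) `^ (a - t - 1))%:E *
    ((fun y : R => (`|y| `^ (t - 1))%:E) \_ [set y : R | (0 < `|y| <= M)%R]) y)%E)); last first.
    move=> y _; rewrite gee0_abs ?lee_fin ?strip_weight_ge0// /strip_weight /= -mulrA EFinM patchE.
    congr (_ * _)%E; rewrite indicE.
    have [yM|yM] := pselect (0 < `|y| <= M).
      by rewrite !mem_set// mulr1.
    by rewrite !memNset// mulr0.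
  have mshell : measurable_fun setT
      ((fun y : mR => (`|y : R| `^ (t - 1))%:E) \_ [set y : R | 0 < `|y| <= M]).
    have [h _] := measurable_restrictT (fun y : mR => (`|y : R| `^ (t - 1))%:E)
      (measurable_norm_shell M).
    by apply: h; apply/measurable_EFinP; exact: measurable_norm_powR.
  rewrite ge0_integralZl//; try by [rewrite lee_fin powR_ge0 |
    move=> y _; rewrite patchE; case: ifP => // _; rewrite lee_fin powR_ge0].
  rewrite -integral_mkcond.
  apply: (@le_trans _ _ (((1 + `|x|) `^ (a - t - 1))%:E * (2 * (M `^ t / t))%:E)%E).
    by rewrite lee_wpmul2l ?lee_fin ?powR_ge0//; exact: integral_norm_powR_le.
  rewrite -!EFinM lee_fin /M powRM//.
  rewrite (_ : a - 1 = (a - t - 1) + t); last by ring.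
  have -> : (1 + `|x|) `^ (a - t - 1 + t) = (1 + `|x|) `^ (a - t - 1) * (1 + `|x|) `^ t.
    by rewrite powRD// (gt_eqF m0) implybT.
  by rewrite le_eqVlt; apply/orP; left; apply/eqP; ring.
have mm : measurable_fun [set: mR] (fun x : R => ((1 + `|x|) `^ (a - 1))%:E).
  apply/measurable_EFinP.
  apply: (@measurableT_comp _ _ _ _ _ _ (@powR R ^~ _)); first exact: measurable_powR.
  by apply: measurable_funD => //; exact: normr_measurable.
have k0 : 0 <= 2 * (2 `^ t / t) by rewrite !mulr_ge0 ?powR_ge0// invr_ge0 ltW.
rewrite ge0_integralZl//; try by [rewrite lee_fin | move=> x _; rewrite lee_fin powR_ge0].
by rewrite lte_mul_pinfty ?lee_fin//; exact: integral_powR_norm1.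
Qed.

End power_integrals.

(** * Quotients by the Cauchy kernel *)

Section continuity_pointwise.
Context {R : realType} {T : topologicalType}.
Implicit Types (f g : T -> R) (x : T).

Lemma continuous_addf f g x : {for x, continuous f} -> {for x, continuous g} ->
  {for x, continuous (fun t => f t + g t)}.
Proof. exact: cvgD. Qed.

Lemma continuous_subf f g x : {for x, continuous f} -> {for x, continuous g} ->
  {for x, continuous (fun t => f t - g t)}.
Proof. exact: cvgB. Qed.

Lemma continuous_mulf f g x : {for x, continuous f} -> {for x, continuous g} ->
  {for x, continuous (fun t => f t * g t)}.
Proof. exact: cvgM. Qed.

Lemma continuous_invf f x : f x != 0 -> {for x, continuous f} ->
  {for x, continuous (fun t => (f t)^-1)}.
Proof. exact: cvgV. Qed.

Lemma continuous_cstf c x : {for x, continuous (fun _ : T => c : R)}.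
Proof. exact: cvg_cst. Qed.

Lemma continuous_expf f n x : {for x, continuous f} ->
  {for x, continuous (fun t => f t ^+ n)}.
Proof.
move=> cf; elim: n => [|n ih].
  exact: continuous_cstf.
have -> : (fun t => f t ^+ n.+1) = (fun t => f t * f t ^+ n).
  by apply/funext => t; rewrite exprS.
exact: continuous_mulf.
Qed.

Lemma continuous_compf (S : topologicalType) (g : T -> S) (f : S -> R) x :
  {for g x, continuous f} -> {for x, continuous g} ->
  {for x, continuous (fun t => f (g t))}.
Proof. by move=> cf cg; exact: (continuous_comp cg cf). Qed.

End continuity_pointwise.

Section kernel.
Context {R : realType}.

Lemma is_derive_lipschitz (f f' : R -> R) (M : R) :
  (forall x : R, is_derive x 1 f (f' x)) -> (forall x, `|f' x| <= M) ->
  forall x y, `|f x - f y| <= M * `|x - y|.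
Proof.
move=> df fM x y; wlog xy : x y / x <= y.
  move=> h; case/orP : (le_total x y) => [|yx]; first exact: h.
  by rewrite distrC (distrC x) h.
have [|z _ fxy] := @MVT_segment R f f' x y xy.
  by apply/continuous_in_subspaceT => z _; exact: is_derive_continuous (df z).
by rewrite distrC fxy normrM (distrC y) ler_wpM2r.
Qed.

Context (P Q P1 P2 Q1 Q2 : R -> R -> R) (l : R).

Definition sqdist (x y : R) : R := (x - l) ^+ 2 + y ^+ 2.

Lemma sqdist_gt0 (x y : R) : y != 0 -> 0 < sqdist x y.
Proof. by move=> y0; rewrite /sqdist ltr_wpDl ?sqr_ge0// exprn_even_gt0. Qed.

(** The real and imaginary parts of (P + i Q) / (x - l + i y), followed by the
    partial derivatives of the former in x and of the latter in y. *)
Definition quot_re (x y : R) := (P x y * (x - l) + Q x y * y) / sqdist x y.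
Definition quot_im (x y : R) := (Q x y * (x - l) - P x y * y) / sqdist x y.
Definition quot_re1 (x y : R) :=
  ((P1 x y * (x - l) + P x y + Q1 x y * y) * sqdist x y -
   (P x y * (x - l) + Q x y * y) * (2 * (x - l))) / sqdist x y ^+ 2.
Definition quot_im2 (x y : R) :=
  ((Q2 x y * (x - l) - (P2 x y * y + P x y)) * sqdist x y -
   (Q x y * (x - l) - P x y * y) * (2 * y)) / sqdist x y ^+ 2.
(** The real part of dbar (P + i Q) / (z - l), which is also the one of the dbar
    derivative of (P + i Q) / (z - l), as 1 / (z - l) is holomorphic. *)
Definition dbar_quot_re (x y : R) :=
  2^-1 * (((P1 x y - Q2 x y) * (x - l) + (Q1 x y + P2 x y) * y) / sqdist x y).

Lemma dbar_quot_reE (x y : R) : y != 0 ->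
  dbar_quot_re x y = 2^-1 * (quot_re1 x y - quot_im2 x y).
Proof.
move=> y0; rewrite /dbar_quot_re /quot_re1 /quot_im2.
have := sqdist_gt0 x y0; rewrite /sqdist => D0.
by field; rewrite gt_eqF.
Qed.

Hypothesis dP1 : forall x y : R, is_derive x 1 (P^~ y) (P1 x y).
Hypothesis dP2 : forall x y : R, is_derive y 1 (P x) (P2 x y).
Hypothesis dQ1 : forall x y : R, is_derive x 1 (Q^~ y) (Q1 x y).
Hypothesis dQ2 : forall x y : R, is_derive y 1 (Q x) (Q2 x y).

Lemma is_derive_quot_re1 (x y : R) : y != 0 -> is_derive x 1 (quot_re^~ y) (quot_re1 x y).
Proof.
move=> y0; have D0 := sqdist_gt0 x y0.
have ds := is_derive_subf (is_derive_idf x) (is_derive_cstf x l).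
have dD : is_derive x 1 (sqdist^~ y) (2 * (x - l)).
  have := is_derive_addf (is_derive_mulf ds ds) (is_derive_cstf x (y ^+ 2)).
  by under eq_fun do rewrite -expr2; move/is_derive_eq; apply; ring.
have dN := is_derive_addf (is_derive_mulf (dP1 x y) ds)
  (is_derive_mulf (dQ1 x y) (is_derive_cstf x y)).
have := is_derive_mulf dN (@is_derive_invf _ (sqdist^~ y) x _ (lt0r_neq0 D0) dD).
move/is_derive_eq; apply; rewrite /quot_re1.
by field; rewrite gt_eqF.
Qed.

Lemma is_derive_quot_im2 (x y : R) : y != 0 -> is_derive y 1 (quot_im x) (quot_im2 x y).
Proof.
move=> y0; have D0 := sqdist_gt0 x y0.
have dD : is_derive y 1 (sqdist x) (2 * y).
  have := is_derive_addf (is_derive_cstf y ((x - l) ^+ 2)) (is_derive_mulf (is_derive_idf y) (is_derive_idf y)).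
  by under eq_fun do rewrite -expr2; move/is_derive_eq; apply; ring.
have dN := is_derive_subf (is_derive_mulf (dQ2 x y) (is_derive_cstf y (x - l)))
  (is_derive_mulf (dP2 x y) (is_derive_idf y)).
have := is_derive_mulf dN (is_derive_invf (lt0r_neq0 D0) dD).
move/is_derive_eq; apply; rewrite /quot_im2.
by field; rewrite gt_eqF.
Qed.

Local Notation continuous2 W := (continuous (fun p : R * R => W p.1 p.2)).
Hypothesis cP : continuous2 P.
Hypothesis cQ : continuous2 Q.
Hypothesis cP1 : continuous2 P1.
Hypothesis cP2 : continuous2 P2.
Hypothesis cQ1 : continuous2 Q1.
Hypothesis cQ2 : continuous2 Q2.

Let cx (p : R * R) : {for p, continuous (fun p : R * R => p.1 - l)}.
Proof. by apply: continuous_subf; [exact: cvg_fst|exact: continuous_cstf]. Qed.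

Let cy (p : R * R) : {for p, continuous (fun p : R * R => p.2)}.
Proof. exact: cvg_snd. Qed.

Let cD (p : R * R) : {for p, continuous (fun p : R * R => sqdist p.1 p.2)}.
Proof. by apply: continuous_addf; apply: continuous_expf. Qed.

Lemma continuous_quot_re p : off_axis p -> {for p, continuous (fun p : R * R => quot_re p.1 p.2)}.
Proof.
move=> p0; apply: continuous_mulf; last by apply: continuous_invf => //; rewrite gt_eqF// sqdist_gt0.
by apply: continuous_addf; apply: continuous_mulf => //; [exact: cP|exact: cQ].
Qed.

Lemma continuous_quot_im p : off_axis p -> {for p, continuous (fun p : R * R => quot_im p.1 p.2)}.
Proof.
move=> p0; apply: continuous_mulf; last by apply: continuous_invf => //; rewrite gt_eqF// sqdist_gt0.
by apply: continuous_subf; apply: continuous_mulf => //; [exact: cQ|exact: cP].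
Qed.

Lemma continuous_quot_re1 p : off_axis p -> {for p, continuous (fun p : R * R => quot_re1 p.1 p.2)}.
Proof.
move=> p0; apply: continuous_mulf; last first.
  apply: continuous_invf; last exact: continuous_expf.
  by rewrite expf_neq0// gt_eqF// sqdist_gt0.
apply: continuous_subf.
  apply: continuous_mulf => //; apply: continuous_addf; [apply: continuous_addf; [|exact: cP]|];
    by apply: continuous_mulf => //; [exact: cP1 || exact: cQ1].
apply: continuous_mulf.
  by apply: continuous_addf; apply: continuous_mulf => //; [exact: cP|exact: cQ].
by apply: continuous_mulf => //; exact: continuous_cstf.
Qed.

Lemma continuous_quot_im2 p : off_axis p -> {for p, continuous (fun p : R * R => quot_im2 p.1 p.2)}.
Proof.
move=> p0; apply: continuous_mulf; last first.
  apply: continuous_invf; last exact: continuous_expf.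
  by rewrite expf_neq0// gt_eqF// sqdist_gt0.
apply: continuous_subf.
  apply: continuous_mulf => //; apply: continuous_subf; [|apply: continuous_addf; [|exact: cP]];
    by apply: continuous_mulf => //; [exact: cQ2 || exact: cP2].
apply: continuous_mulf.
  by apply: continuous_subf; apply: continuous_mulf => //; [exact: cQ|exact: cP].
by apply: continuous_mulf => //; exact: continuous_cstf.
Qed.

(** The real part of the complex Green formula on a rectangle off the axis. *)
Lemma dbar_quot_re_rect (a b c d : R) : a < b -> c < d -> 0 \notin `[c, d] ->
  (\int[lebesgue2 R]_(p in rect a b c d) (dbar_quot_re p.1 p.2)%:E =
   2^-1%:E * (\int[@lebesgue_measure R]_(y in `[c, d]) (quot_re b y - quot_re a y)%:E -
    \int[@lebesgue_measure R]_(x in `[a, b]) (quot_im x d - quot_im x c)%:E))%E.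
Proof.
move=> ab cd c0d.
rewrite -(rect_integral_dx ab c0d is_derive_quot_re1 continuous_quot_re1).
rewrite -(rect_integral_dy a b cd c0d is_derive_quot_im2 continuous_quot_im2).
have i1 := rect_integrable a b c0d continuous_quot_re1.
have i2 := rect_integrable a b c0d continuous_quot_im2.
rewrite -integralB//; [|exact: measurable_rect].
rewrite -integralZl//; [|exact: measurable_rect|by apply: integrableB => //; exact: measurable_rect].
apply: eq_integral => p; rewrite inE => /(rect_off_axis c0d) p0.
by rewrite dbar_quot_reE// -EFinB -EFinM.
Qed.

End kernel.

(** * The Cauchy-Pompeiu formula at a real point *)

Section cauchy_pompeiu.
Context {R : realType}.
Local Notation mR := (measurableTypeR R).
Local Notation leb := (@lebesgue_measure R).
Context (P Q P1 P2 Q1 Q2 : R -> R -> R) (l C b : R).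
Local Notation continuous2 W := (continuous (fun p : R * R => W p.1 p.2)).
Hypothesis dP1 : forall x y : R, is_derive x 1 (P^~ y) (P1 x y).
Hypothesis dP2 : forall x y : R, is_derive y 1 (P x) (P2 x y).
Hypothesis dQ1 : forall x y : R, is_derive x 1 (Q^~ y) (Q1 x y).
Hypothesis dQ2 : forall x y : R, is_derive y 1 (Q x) (Q2 x y).
Hypothesis cP : continuous2 P.
Hypothesis cQ : continuous2 Q.
Hypothesis cP1 : continuous2 P1.
Hypothesis cP2 : continuous2 P2.
Hypothesis cQ1 : continuous2 Q1.
Hypothesis cQ2 : continuous2 Q2.
Hypothesis b1 : -1 <= b.
Hypothesis b0 : b < 0.
Hypothesis bP : forall x y, `|P x y| <= C * (1 + `|x|) `^ b.
Hypothesis bQ : forall x y, `|Q x y| <= C * (1 + `|x|) `^ b.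
Hypothesis bP2 : forall x y, `|P2 x y| <= C * (1 + `|x|) `^ (b - 1).
Hypothesis bQ2 : forall x y, `|Q2 x y| <= C * (1 + `|x|) `^ (b - 1).
Hypothesis bP1 : forall x, `|P1 x 0| <= C.

Local Notation D := (sqdist l).
Local Notation U := (quot_re P Q l).
Local Notation V := (quot_im P Q l).

Let C0 : 0 <= C. Proof. exact: le_trans (bP1 0). Qed.

Let m_gt0 (x : R) : 0 < 1 + `|x|. Proof. by rewrite ltr_pwDl. Qed.

Lemma poisson_integral (e a c : R) : 0 < e -> a < c ->
  (\int[leb]_(x in `[a, c]) (e / D x e)%:E =
   (atan ((c - l) / e))%:E - (atan ((a - l) / e))%:E)%E.
Proof.
move=> e0 ac.
have da (x : R) : is_derive x 1 (fun x => atan ((x - l) / e)) (e / D x e).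
  have dx := is_derive_mulf (is_derive_subf (is_derive_idf x) (is_derive_cstf x l)) (is_derive_cstf x e^-1).
  have := is_derive_compf (is_derive1_atan _) dx; move/is_derive_eq; apply.
  have := sqdist_gt0 l x (lt0r_neq0 e0); rewrite /sqdist => D0.
  by field; rewrite (lt0r_neq0 e0) (lt0r_neq0 D0).
rewrite (@continuous_FTC2 _ (fun x => e / D x e) (fun x => atan ((x - l) / e)))//.
- apply/continuous_in_subspaceT => x _; apply: (@continuous_mulf _ R (fun=> e) (fun x => (D x e)^-1)).
    exact: continuous_cstf.
  apply: continuous_invf; first by rewrite gt_eqF// sqdist_gt0// gt_eqF.
  apply: continuous_addf; last exact: continuous_cstf.
  by apply: continuous_expf; apply: continuous_subf; [exact: cvg_id|exact: continuous_cstf].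
- split; [by move=> x _; case: (da x)|exact: cvg_at_right_filter (is_derive_continuous (da a))|
    exact: cvg_at_left_filter (is_derive_continuous (da c))].
- by move=> x _; rewrite derive1E; case: (da x).
Qed.

(** The difference of the values of [quot_im] on the edges y = - e and y = e is
    compared with the Poisson kernel, which concentrates at l. *)
Definition edge_error e x := V x (- e) - V x e - 2 * P l 0 * (e / D x e).

Lemma edge_errorE e x : 0 < e -> edge_error e x =
  ((Q x (- e) - Q x e) * (x - l) + (P x (- e) + P x e - 2 * P l 0) * e) / D x e.
Proof.
move=> e0; rewrite /edge_error /quot_im.
have -> : D x (- e) = D x e by rewrite /sqdist sqrrN.
by field; rewrite gt_eqF// sqdist_gt0// gt_eqF.
Qed.

(** Moving from y = e or y = - e to the axis costs the bound of the
    y-derivatives; what remains is the variation of P along the axis. *)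
Lemma edge_error_num_le e x : 0 < e ->
  `|edge_error e x| <= (2 * C * e * (1 + `|x|) `^ (b - 1) * `|x - l| +
    (2 * C * e * (1 + `|x|) `^ (b - 1) + 2 * `|P x 0 - P l 0|) * e) / D x e.
Proof.
move=> e0; rewrite (edge_errorE _ e0) normrM; set mu := _ `^ _.
have D0 : 0 < D x e by rewrite sqdist_gt0// gt_eqF.
have DV0 : 0 <= (D x e)^-1 by rewrite invr_ge0 ltW.
rewrite (ger0_norm DV0) ler_wpM2r//.
rewrite (le_trans (ler_normD _ _))// !normrM (gtr0_norm e0) lerD//.
  rewrite ler_wpM2r// (le_trans (is_derive_lipschitz (dQ2 x) (bQ2 x) _ _))//.
  rewrite -/mu -opprD normrN -mulr2n -[e *+ 2]mulr_natl normrM (gtr0_norm e0) gtr0_norm//.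
  by rewrite le_eqVlt; apply/orP; left; apply/eqP; ring.
rewrite ler_wpM2r ?(ltW e0)//.
have l1 := is_derive_lipschitz (dP2 x) (bP2 x) (- e) 0.
have l2 := is_derive_lipschitz (dP2 x) (bP2 x) e 0.
rewrite !subr0 ?normrN (gtr0_norm e0) -/mu in l1 l2.
have -> : P x (- e) + P x e - 2 * P l 0 = (P x (- e) - P x 0) + (P x e - P x 0) + 2 * (P x 0 - P l 0) by ring.
rewrite (le_trans (ler_normD _ _))// lerD//; last by rewrite normrM gtr0_norm.
by rewrite (le_trans (ler_normD _ _))// (le_trans (lerD l1 l2))//; lra.
Qed.

Let dist_bounds x : `|P x 0 - P l 0| <= C * `|x - l| /\ `|P x 0 - P l 0| <= 2 * C.
Proof.
split; first exact: is_derive_lipschitz (dP1^~ 0) bP1 x l.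
have PC y : `|P y 0| <= C.
  rewrite (le_trans (bP y 0))// ler_piMr// (@le_trans _ _ ((1 + `|y|) `^ 0))//; last by rewrite powRr0.
  by apply: ler_powR; rewrite ?lerDl// ltW.
by rewrite (le_trans (ler_normB _ _))// mulr_natl mulr2n lerD.
Qed.

(** The domination of the edge error, uniform in e.  The variation of P on the
    axis is estimated by C |x - l| when x is near l and by 2 C otherwise; the
    hypothesis -1 <= b ensures that (1 + |x|)^(b - 1) is at least
    (1 + |x|)^(-2), the decay of 1 / |z - l|^2. *)
Lemma edge_error_le e x : 0 < e -> e <= 1 ->
  `|edge_error e x| <= 7 * C * (2 + `|l|) ^+ 2 * (1 + `|x|) `^ (b - 1).
Proof.
move=> e0 e1; apply: (le_trans (edge_error_num_le x e0)).
have [d1 d2] := dist_bounds x.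
have D0 : 0 < D x e by rewrite sqdist_gt0// gt_eqF.
rewrite ler_pdivrMr//.
set mu := (1 + `|x|) `^ (b - 1); set L := 2 + `|l|; set dl := `|P x 0 - _| in d1 d2 *.
have mu0 : 0 < mu by rewrite powR_gt0.
have L2 : 2 <= L by rewrite lerDl.
have Cmu0 : 0 <= C * mu by rewrite mulr_ge0// ltW.
have Lmu0 : 0 <= L ^+ 2 * mu by rewrite mulr_ge0 ?(ltW mu0)// sqr_ge0.
have DE : D x e = `|x - l| ^+ 2 + e ^+ 2 by rewrite /sqdist real_normK ?num_real.
have s0 : 0 <= `|x - l| by [].
set s := `|x - l| in d1 DE s0 *.
have mx : 1 + `|x| <= L - 1 + s.
  have : `|x| <= `|x - l| + `|l| by rewrite -{1}(subrK l x) ler_normD.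
  by rewrite /L -/s; lra.
have mu_ge : (1 + `|x|) ^- 2 <= mu.
  rewrite -powR_invn ?(ltW (m_gt0 x))//; apply: ler_powR; first by rewrite lerDl.
  by rewrite lerBrDr (le_trans _ b1)// -[2%:R]/(1 + 1) opprD subrK.
have m0 := m_gt0 x.
(* The term coming from the variation of P; L is chosen such that 1 + |x| is at
   most L near l and at most L |x - l| elsewhere. *)
have muL : 2 * dl * e <= 4 * C * L ^+ 2 * mu * D x e.
  case: (leP s 1) => s1.
    have muL1 : 1 <= L ^+ 2 * mu.
      rewrite (@le_trans _ _ (L ^+ 2 * (1 + `|x|) ^- 2))//; last first.
        by rewrite ler_wpM2l// sqr_ge0.
      rewrite -expr_div_n expr_ge1// ?divr_ge0 ?(ltW m0)//; try lra.
      by rewrite ler_pdivlMr//; lra.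
    have h : 2 * dl * e <= C * D x e.
      have : 2 * dl * e <= 2 * (C * s) * e by rewrite ler_wpM2r ?(ltW e0)// ler_wpM2l.
      move/le_trans; apply; rewrite DE.
      have : 0 <= C * (s - e) ^+ 2 by rewrite mulr_ge0// sqr_ge0.
      by nra.
    apply: (le_trans h); rewrite ler_wpM2r ?(ltW D0)//.
    have : C * 1 <= C * (L ^+ 2 * mu) by rewrite ler_wpM2l.
    have : 0 <= C * (L ^+ 2 * mu) by rewrite mulr_ge0.
    by lra.
  have muL1 : 1 <= L ^+ 2 * mu * s ^+ 2.
    rewrite (@le_trans _ _ (L ^+ 2 * (1 + `|x|) ^- 2 * s ^+ 2))//; last first.
      by rewrite ler_wpM2r ?sqr_ge0// ler_wpM2l// sqr_ge0.
    rewrite mulrAC -exprMn -expr_div_n expr_ge1// ?divr_ge0 ?mulr_ge0 ?(ltW m0)//; try lra.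
    by rewrite ler_pdivlMr// mul1r; nra.
  have h1 : 2 * dl * e <= 4 * C.
    have : dl * e <= dl by rewrite ler_piMr// normr_ge0.
    by lra.
  apply: (le_trans h1).
  have h2 : 1 <= L ^+ 2 * mu * D x e.
    by rewrite (le_trans muL1)// ler_wpM2l// DE lerDl sqr_ge0.
  have h6 : C * 1 <= C * (L ^+ 2 * mu * D x e) by exact: (ler_wpM2l C0 h2).
  by lra.
have h3 : 2 * C * e * mu * s <= C * mu * D x e.
  rewrite DE; have : 0 <= C * mu * (s - e) ^+ 2 by rewrite (mulr_ge0 Cmu0)// sqr_ge0.
  by nra.
have h4 : 2 * C * e * mu * e <= 2 * C * mu * D x e.
  have : 0 <= C * mu * s ^+ 2 by rewrite (mulr_ge0 Cmu0)// sqr_ge0.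
  by rewrite DE; nra.
have h5 : C * mu * D x e <= C * mu * D x e * L ^+ 2.
  rewrite ler_peMr//; first by rewrite mulr_ge0// ltW.
  by rewrite expr_ge1//; lra.
by rewrite mulrDl; nra.
Qed.

(** The factor e gives the pointwise limit 0 away from l. *)
Lemma edge_error_le_eps e x : 0 < e -> e <= 1 -> x != l ->
  `|edge_error e x| <= e * ((2 * C * (1 + `|x|) `^ (b - 1) * `|x - l| +
     2 * C * (1 + `|x|) `^ (b - 1) + 4 * C) / (x - l) ^+ 2).
Proof.
move=> e0 e1 xl; apply: (le_trans (edge_error_num_le x e0)).
have [_ d2] := dist_bounds x; set mu := _ `^ _.
have mu0 : 0 <= mu by exact: powR_ge0.
have s20 : 0 < (x - l) ^+ 2 by rewrite exprn_even_gt0//= subr_eq0.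
rewrite mulrA; apply: ler_pM.
- by rewrite addr_ge0// ?mulr_ge0 ?addr_ge0 ?mulr_ge0 ?(ltW e0).
- by rewrite invr_ge0 ltW// sqdist_gt0// gt_eqF.
- have h : C * e * mu * e <= C * e * mu.
    by rewrite -[leRHS]mulr1 ler_wpM2l// !mulr_ge0// ltW.
  have h' : 2 * `|P x 0 - P l 0| * e <= 2 * (2 * C) * e.
    by rewrite ler_wpM2r ?(ltW e0)// ler_wpM2l.
  by rewrite mulrDl; nra.
- rewrite lef_pV2 ?posrE// ?sqdist_gt0 ?gt_eqF// /sqdist lerDl sqr_ge0//.
Qed.

Let K (k : nat) : R := k.+1%:R.
Let K_ge1 k : 1 <= K k. Proof. by rewrite /K ler1n. Qed.
Let K_gt0 k : 0 < K k. Proof. exact: lt_le_trans (K_ge1 k). Qed.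
Let Kv_gt0 k : 0 < (K k)^-1. Proof. by rewrite invr_gt0. Qed.
Let Kv_le1 k : (K k)^-1 <= 1. Proof. by rewrite invf_le1. Qed.
Let Kv_cvg : (K k)^-1 @[k --> \oo] --> (0 : R). Proof. exact: cvg_harmonic. Qed.

Lemma atan_cvg_sq c : atan ((K k + c) * K k) @[k --> \oo] --> pi / 2.
Proof.
apply: (cvg_comp _ _ _ (@cvgy_atan R)); apply/cvgryPge => A.
near=> k.
have h : A <= K k by rewrite (@le_trans _ _ k%:R)//; [near: k; exact: nbhs_infty_ger|rewrite ler_nat].
have h' : 1 - c <= K k by rewrite (@le_trans _ _ k%:R)//; [near: k; exact: nbhs_infty_ger|rewrite ler_nat].
by rewrite (le_trans h)// ler_peMl// ?(ltW (K_gt0 k))//; lra.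
Unshelve. all: by end_near. Qed.

Lemma poisson_integral_cvg :
  (\int[leb]_(x in `[(- K k)%R, K k]) ((K k)^-1 / D x (K k)^-1)%:E)%E @[k --> \oo] --> pi%:E.
Proof.
have KK k : - K k < K k by rewrite gtrN.
under eq_fun do rewrite poisson_integral// !invrK -EFinB.
apply: cvg_EFin; first exact: nearW.
have -> : pi = pi / 2 - - (pi / 2) :> R by lra.
apply: cvgB; first exact: atan_cvg_sq.
have -> : (fun k => atan ((- K k - l) * K k)) = (fun k => - atan ((K k + l) * K k)).
  by apply/funext => k; rewrite -atanN -mulNr opprD.
by apply: cvgN; exact: atan_cvg_sq.
Qed.

Let continuous_edge e : e != 0 -> continuous (fun x => V x e).
Proof.
move=> e0 x; apply: (@continuous_compf R R (R * R)%type (fun x => (x, e)) (fun p => V p.1 p.2)).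
  exact: continuous_quot_im.
by apply: (@cvg_pair _ _ _ _ (nbhs x) (nbhs e)); [exact: cvg_id|exact: cvg_cst].
Qed.

Let continuous_poisson e : e != 0 -> continuous (fun x => e / D x e).
Proof.
move=> e0 x; apply: (@continuous_mulf _ R (fun=> e) (fun x => (D x e)^-1)).
  exact: continuous_cstf.
apply: continuous_invf; first by rewrite gt_eqF// sqdist_gt0.
apply: continuous_addf; last exact: continuous_cstf.
by apply: continuous_expf; apply: continuous_subf; [exact: cvg_id|exact: continuous_cstf].
Qed.

Let continuous_edge_error e : e != 0 -> continuous (edge_error e).
Proof.
move=> e0 x; apply: (@continuous_subf _ R (fun x => V x (- e) - V x e)).
  by apply: continuous_subf; apply: continuous_edge; rewrite ?oppr_eq0.
apply: (@continuous_mulf _ R (fun=> 2 * P l 0)); first exact: continuous_cstf.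
exact: continuous_poisson.
Qed.

Lemma edge_error_cvg0 :
  (\int[leb]_(x in `[(- K k)%R, K k]) (edge_error (K k)^-1 x)%:E)%E @[k --> \oo] --> (0 : \bar R)%E.
Proof.
have K0 k : (K k)^-1 != 0 by rewrite gt_eqF.
pose L := 7 * C * (2 + `|l|) ^+ 2.
have mm : measurable_fun [set: mR] (fun x : R => ((1 + `|x|) `^ (b - 1))%:E).
  apply/measurable_EFinP.
  apply: (@measurableT_comp _ _ _ _ _ _ (@powR R ^~ _)); first exact: measurable_powR.
  by apply: measurable_funD => //; exact: normr_measurable.
have [] := @dominated_convergence _ mR R leb setT measurableT
  (fun k => (fun x => (edge_error (K k)^-1 x)%:E) \_ `[(- K k), K k]%classic) (cst 0%E)
  (fun x => (L%:E * ((1 + `|x : R|) `^ (b - 1))%:E)%E).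
- move=> k.
  have [h _] := @measurable_restrictT _ _ mR _ `[(- K k), K k]%classic
     (fun x => (edge_error (K k)^-1 x)%:E) (measurable_itv _).
  apply: h; apply/measurable_EFinP; apply: measurable_funTS.
  by apply: continuous_measurable_fun; exact: continuous_edge_error.
- exact: measurable_cst.
- exists [set l]; split; [exact: measurable_set1|exact: lebesgue_measure_set1|].
  move=> x /=; apply: contra_notP => /eqP xl _.
  set c := (2 * C * (1 + `|x|) `^ (b - 1) * `|x - l| +
     2 * C * (1 + `|x|) `^ (b - 1) + 4 * C) / (x - l) ^+ 2.
  apply: (@squeeze_cvge _ _ _ _ (fun k => (- ((K k)^-1 * c))%:E) _ (fun k => ((K k)^-1 * c)%:E)).
  + apply: nearW => k; rewrite patchE; case: ifPn => _.
      by rewrite !lee_fin -ler_norml; exact: edge_error_le_eps.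
    have : 0 <= (K k)^-1 * c.
      by apply: le_trans (edge_error_le_eps (Kv_gt0 k) (Kv_le1 k) xl).
    by rewrite !lee_fin oppr_le0 => ->.
  + apply: cvg_EFin; first exact: nearW.
    by rewrite -oppr0 -(mul0r c); apply: cvgN; apply: cvgMr_tmp.
  + apply: cvg_EFin; first exact: nearW.
    by rewrite -(mul0r c); apply: cvgMr_tmp.
- apply: integrableZl => //; apply/integrableP; split => //.
  under eq_integral do rewrite gee0_abs ?lee_fin ?powR_ge0//.
  exact: integral_powR_norm1.
- apply: aeW => x k _; rewrite patchE; case: ifPn => _.
    by rewrite -EFinM lee_fin; exact: edge_error_le.
  by rewrite abse0 -EFinM lee_fin !mulr_ge0 ?powR_ge0// sqr_ge0.
move=> _ _; rewrite integral0; apply: cvg_trans; apply: near_eq_cvg; apply: nearW => k /=.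
by rewrite [RHS]integral_mkcond.
Qed.

Lemma edges_cvg :
  (\int[leb]_(x in `[(- K k)%R, K k]) (V x (- (K k)^-1) - V x (K k)^-1)%:E)%E
    @[k --> \oo] --> (2 * P l 0 * pi)%:E.
Proof.
have K0 k : (K k)^-1 != 0 by rewrite gt_eqF.
have -> : (2 * P l 0 * pi)%:E = (0 + (2 * P l 0)%:E * pi%:E)%E by rewrite add0e -EFinM.
have split_int k : (\int[leb]_(x in `[(- K k)%R, K k]) (V x (- (K k)^-1) - V x (K k)^-1)%:E)%E =
  (\int[leb]_(x in `[(- K k)%R, K k]) (edge_error (K k)^-1 x)%:E +
   (2 * P l 0)%:E * \int[leb]_(x in `[(- K k)%R, K k]) ((K k)^-1 / D x (K k)^-1)%:E)%E.
  have i1 : leb.-integrable `[(- K k), K k]%classic (EFin \o edge_error (K k)^-1).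
    apply: continuous_compact_integrable; first exact: segment_compact.
    by apply: continuous_subspaceT; exact: continuous_edge_error.
  have i2 : leb.-integrable `[(- K k), K k]%classic (EFin \o (fun x => (K k)^-1 / D x (K k)^-1)).
    apply: continuous_compact_integrable; first exact: segment_compact.
    by apply: continuous_subspaceT; exact: continuous_poisson.
  rewrite -integralZl// -integralD//; last exact: integrableZl.
  by apply: eq_integral => x _; rewrite -EFinM -EFinD /edge_error subrK.
under eq_fun do rewrite split_int.
apply: cvgeD => //; first exact: edge_error_cvg0.
by apply: cvgeZl => //; exact: poisson_integral_cvg.
Qed.

(** On the short edges the quotient is O(K^(b - 1)), and their length is O(K),
    so that their contribution is O(K^b) with b < 0. *)
Let side_bound k x y : `|x| = K k -> 2 * `|l| <= K k -> y != 0 ->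
  `|U x y| <= 4 * C * (K k) `^ b / K k.
Proof.
move=> xK lK y0; have D0 := sqdist_gt0 l x y0.
have s0 : K k / 2 <= `|x - l|.
  have : `|x| <= `|x - l| + `|l| by rewrite -{1}(subrK l x) ler_normD.
  by rewrite xK; lra.
set s := `|x - l| in s0.
have DE : D x y = s ^+ 2 + `|y| ^+ 2 by rewrite /sqdist !real_normK ?num_real.
rewrite normrM normfV (gtr0_norm D0) ler_pdivrMr//.
have Kb : (1 + `|x|) `^ b <= K k `^ b by apply: ler_powR_neg; rewrite ?xK ?lerDr// ltW.
have bnd (W : R -> R -> R) : `|W x y| <= C * (1 + `|x|) `^ b -> `|W x y| <= C * K k `^ b.
  by move/le_trans; apply; rewrite ler_wpM2l.
have h1 := bnd P (bP x y); have h2 := bnd Q (bQ x y).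
set A := C * K k `^ b in h1 h2.
have A0 : 0 <= A by exact: le_trans h1.
rewrite (@le_trans _ _ (A * s + A * `|y|))//.
  by rewrite (le_trans (ler_normD _ _))// !normrM lerD// ler_wpM2r.
have K0 := K_gt0 k.
rewrite (_ : 4 * C * _ / _ * _ = A * (4 * D x y / K k)); last by rewrite /A; ring.
rewrite -mulrDr ler_wpM2l// ler_pdivlMr// DE.
have y0' : 0 <= `|y| by [].
have h3 : (s + `|y|) * K k <= (s + `|y|) * (2 * s).
  by rewrite ler_wpM2l ?addr_ge0//; [exact: normr_ge0|lra].
have h4 : 0 <= (s - `|y|) ^+ 2 by exact: sqr_ge0.
have h5 : 0 <= s ^+ 2 by exact: sqr_ge0.
by nra.
Qed.

Let sides_cvg0 (c d : nat -> R) : (forall k, c k < d k) ->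
  (forall k, d k - c k <= 2 * (1 + K k)) -> (forall k, 0 \notin `[c k, d k]) ->
  (\int[leb]_(y in `[c k, d k]) (U (K k) y - U (- K k) y)%:E)%E @[k --> \oo] --> (0 : \bar R)%E.
Proof.
move=> cd len n0.
have cU x k y : y \in `[c k, d k] -> {for y, continuous (U x)}.
  move=> yE; apply: (@continuous_compf R R (R * R)%type (fun y => (x, y)) (fun p => U p.1 p.2)).
    apply: continuous_quot_re => //; apply: contra (n0 k) => /eqP/= <-//.
  by apply: (@cvg_pair _ _ _ _ (nbhs x) (nbhs y)); [exact: cvg_cst|exact: cvg_id].
have cUU k : {within `[c k, d k], continuous (fun y => U (K k) y - U (- K k) y)}.
  apply/continuous_in_subspaceT => y; rewrite inE => yE.
  by apply: continuous_subf; exact: (cU _ _ _ yE).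
have iU k : leb.-integrable `[c k, d k]%classic (EFin \o (fun y => U (K k) y - U (- K k) y)).
  by apply: continuous_compact_integrable => //; exact: segment_compact.
have lim : ((32 * C * K k `^ b)%:E) @[k --> \oo] --> (0 : \bar R)%E.
  apply: cvg_EFin; first exact: nearW.
  by rewrite -(mulr0 (32 * C)); apply: cvgMl_tmp; exact: powR_neg_cvgn.
apply/cvg_abse0P; apply: (squeeze_cvge _ (cvg_cst _) lim).
near=> k; rewrite abse_ge0/=.
have lK : 2 * `|l| <= K k.
  by rewrite (@le_trans _ _ k%:R)//; [near: k; exact: nbhs_infty_ger|rewrite ler_nat].
have mU : measurable_fun `[c k, d k]%classic (fun y => (U (K k) y - U (- K k) y)%:E).
  by case/integrableP : (iU k).
have := le_abse_integral leb (measurable_itv `[c k, d k]) mU; move=> /le_trans; apply.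
apply: (@le_trans _ _ (\int[leb]_(y in `[c k, d k]) (8 * C * K k `^ b / K k)%:E)%E).
  apply: ge0_le_integral => //.
  - by apply: measurableT_comp.
  move=> y yE; rewrite lee_fin.
  have y0 : y != 0 by apply: contra (n0 k) => /eqP <-.
  rewrite (le_trans (ler_normB _ _))// (le_trans (lerD (@side_bound k _ _ _ lK y0) (@side_bound k _ _ _ lK y0)))//.
  - by rewrite gtr0_norm.
  - by rewrite normrN gtr0_norm.
  by rewrite le_eqVlt; apply/orP; left; apply/eqP; ring.
rewrite integral_cst//=.
have -> : leb `[c k, d k]%classic = (d k - c k)%:E.
  by rewrite lebesgue_measure_itv/= lte_fin cd.
rewrite -EFinM lee_fin.
have K1 := K_ge1 k; have K0 := K_gt0 k.
have len4 : d k - c k <= 4 * K k by rewrite (le_trans (len k))//; lra.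
have B0 : 0 <= 8 * C * K k `^ b / K k by rewrite !mulr_ge0 ?powR_ge0 ?invr_ge0 ?(ltW K0).
rewrite (le_trans (ler_wpM2l B0 len4))// le_eqVlt; apply/orP; left; apply/eqP.
by field; rewrite gt_eqF.
Unshelve. all: by end_near. Qed.

Hypothesis supp : forall x y, 2 * (1 + `|x|) <= `|y| -> P x y = 0 /\ Q x y = 0.
Local Notation psi := (dbar_quot_re P1 P2 Q1 Q2 l).
Hypothesis axis : forall x, psi x 0 = 0.
Context (g : R * R -> R).
Hypothesis ig : (lebesgue2 R).-integrable setT (EFin \o g).
Hypothesis psig : forall p, `|psi p.1 p.2| <= g p.

Let continuous_psi p : off_axis p -> {for p, continuous (fun p : R * R => psi p.1 p.2)}.
Proof.
move=> p0; have cx : {for p, continuous (fun p : R * R => p.1 - l)}.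
  by apply: continuous_subf; [exact: cvg_fst|exact: continuous_cstf].
have cy : {for p, continuous (fun p : R * R => p.2)} by exact: cvg_snd.
apply: continuous_mulf; first exact: continuous_cstf.
apply: continuous_mulf; last first.
  apply: continuous_invf; first by rewrite gt_eqF// sqdist_gt0.
  by apply: continuous_addf; apply: continuous_expf.
apply: continuous_addf; apply: continuous_mulf => //.
  by apply: continuous_subf; [exact: cP1|exact: cQ2].
by apply: continuous_addf; [exact: cQ1|exact: cP2].
Qed.

Lemma measurable_dbar_quot_re : measurable_fun [set: mR * mR] (fun p : R * R => psi p.1 p.2).
Proof.
have mA := open_measurable2 (@open_off_axis R).
rewrite -(setUv (@off_axis R)); apply/measurable_funU => //; first exact: measurableC.
split; first exact: continuous_measurable_fun2 (@open_off_axis R) continuous_psi.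
apply: (@eq_measurable_fun _ _ _ _ _ (cst (0 : R))); last exact: measurable_cst.
move=> [x y]; rewrite inE /off_axis/= => /negP; rewrite negbK => /eqP ->.
by rewrite axis.
Qed.

(** The plane without the axis is exhausted by pairs of rectangles with
    |x| <= K and 1 / K <= |y| <= 2 (1 + K).  On the outer edges P and Q vanish,
    the short edges tend to 0, and the edges near the axis give the Poisson
    integral. *)
Theorem cauchy_pompeiu_re :
  (\int[lebesgue2 R]_p (psi p.1 p.2)%:E = (- pi * P l 0)%:E)%E.
Proof.
pose d k := 2 * (1 + K k).
have Kd k : K k <= d k by have := K_ge1 k; rewrite /d; lra.
have ed k : (K k)^-1 < d k.
  by rewrite (le_lt_trans (Kv_le1 k))//; have := K_ge1 k; rewrite /d; lra.
have KK k : - K k < K k by rewrite gtrN.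
have de k : - d k < - (K k)^-1 by rewrite ltrN2.
have n1 k : 0 \notin `[(K k)^-1, d k] by rewrite in_itv/= leNgt Kv_gt0.
have n2 k : 0 \notin `[- d k, - (K k)^-1].
  by apply/negP; rewrite in_itv/= => /andP[_]; rewrite oppr_ge0 leNgt Kv_gt0.
pose S1 k := rect (- K k) (K k) (K k)^-1 (d k).
pose S2 k := rect (- K k) (K k) (- d k) (- (K k)^-1).
pose S k := S1 k `|` S2 k.
have mS k : measurable (S k : set (mR * mR)) by apply: measurableU; exact: measurable_rect.
have mpsi := measurable_dbar_quot_re.
have lim1 : (\int[lebesgue2 R]_(p in S k) (psi p.1 p.2)%:E)%E @[k --> \oo] -->
    (\int[lebesgue2 R]_p (psi p.1 p.2)%:E)%E.
  have [] := @dominated_convergence _ (mR * mR)%type R (lebesgue2 R) setT measurableT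
    (fun k => (fun p => (psi p.1 p.2)%:E) \_ (S k)) (fun p => (psi p.1 p.2)%:E) (EFin \o g).
  - move=> k.
    have [h _] := @measurable_restrictT _ _ (mR * mR)%type _ (S k)
       (fun p => (psi p.1 p.2)%:E) (mS k).
    by apply: h; apply/measurable_EFinP; exact: measurable_funTS.
  - exact/measurable_EFinP.
  - apply: aeW => -[x y] _ /=; have [->|y0] := eqVneq y 0.
      apply: cvg_near_cst; apply: nearW => k; rewrite patchE /= axis.
      by case: ifP.
    apply: cvg_near_cst; near=> k; rewrite patchE ifT//= inE.
    have xK : `|x| <= K k.
      by rewrite (@le_trans _ _ k%:R)//; [near: k; exact: nbhs_infty_ger|rewrite ler_nat].
    have yK : `|y| <= d k.
      rewrite (le_trans _ (Kd k))// (@le_trans _ _ k%:R)//; [near: k; exact: nbhs_infty_ger|by rewrite ler_nat].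
    have eY : (K k)^-1 <= `|y|.
      have y0' : 0 < `|y| by rewrite normr_gt0.
      rewrite -(invrK `|y|) lef_pV2 ?posrE ?invr_gt0//.
      by rewrite (@le_trans _ _ k%:R)//; [near: k; exact: nbhs_infty_ger|rewrite ler_nat].
    have xE : x \in `[- K k, K k] by rewrite in_itv/= -ler_norml.
    case: (ltP 0 y) => yy.
      left; split => //=; rewrite in_itv/=; move: yK eY.
      by rewrite (gtr0_norm yy) => -> ->.
    right; split => //=; rewrite in_itv/=; move: yK eY.
    by rewrite (ler0_norm yy) lerNl => ->; rewrite lerNr.
  - exact: ig.
  - apply: aeW => p k _; rewrite patchE; case: ifP => _; first by rewrite lee_fin psig.
    by rewrite abse0 lee_fin (le_trans _ (psig p)).
  move=> _ _; apply: cvg_trans; apply: near_eq_cvg; apply: nearW => k /=.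
  by rewrite [RHS]integral_mkcond.
have side1 := @sides_cvg0 (fun k => (K k)^-1) d ed _ n1.
have side2 := @sides_cvg0 (fun k => - d k) (fun k => - (K k)^-1) de _ n2.
have {}side1 : (\int[leb]_(y in `[((K k)^-1)%R, d k]) (U (K k) y - U (- K k) y)%:E)%E @[k --> \oo] --> (0 : \bar R)%E.
  by apply: side1 => k; rewrite -/(d k) gerBl ltW.
have {}side2 : (\int[leb]_(y in `[(- d k)%R, (- (K k)^-1)%R]) (U (K k) y - U (- K k) y)%:E)%E @[k --> \oo] --> (0 : \bar R)%E.
  by apply: side2 => k; rewrite -/(d k) opprK addrC gerBl ltW.
(* Outer edges: d k is so large that the extension vanishes there. *)
have Vd k x : x \in `[- K k, K k] -> V x (d k) = 0 /\ V x (- d k) = 0.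
  rewrite in_itv/= -ler_norml => xK.
  have h : 2 * (1 + `|x|) <= d k by rewrite /d; lra.
  have d0 : 0 <= d k by rewrite (le_trans _ (Kd k))// ltW.
  have [P0 Q0] : P x (d k) = 0 /\ Q x (d k) = 0 by apply: supp; rewrite (ger0_norm d0).
  have [P0' Q0'] : P x (- d k) = 0 /\ Q x (- d k) = 0 by apply: supp; rewrite normrN (ger0_norm d0).
  by split; rewrite /quot_im ?P0 ?Q0 ?P0' ?Q0' !mul0r subrr mul0r.
have eqk k : (\int[lebesgue2 R]_(p in S k) (psi p.1 p.2)%:E =
   2^-1%:E * (\int[leb]_(y in `[((K k)^-1)%R, d k]) (U (K k) y - U (- K k) y)%:E) +
   2^-1%:E * (\int[leb]_(y in `[(- d k)%R, (- (K k)^-1)%R]) (U (K k) y - U (- K k) y)%:E) +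
   (- 2^-1)%:E * (\int[leb]_(x in `[(- K k)%R, K k]) (V x (- (K k)^-1) - V x (K k)^-1)%:E))%E.
  have i1 := rect_integrable (- K k) (K k) (n1 k) continuous_psi.
  have i2 := rect_integrable (- K k) (K k) (n2 k) continuous_psi.
  have K0 : (K k)^-1 != 0 by rewrite gt_eqF.
  have iV e : e != 0 -> leb.-integrable `[(- K k), K k]%classic (fun x => (V x e)%:E).
    move=> e0; apply: continuous_compact_integrable; first exact: segment_compact.
    by apply: continuous_subspaceT; exact: continuous_edge.
  have cU x y : y != 0 -> {for y, continuous (U x)}.
    move=> y0; apply: (@continuous_compf R R (R * R)%type (fun y => (x, y)) (fun p => U p.1 p.2)).
      exact: continuous_quot_re.
    by apply: (@cvg_pair _ _ _ _ (nbhs x) (nbhs y)); [exact: cvg_cst|exact: cvg_id].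
  have iU c c' : 0 \notin `[c, c'] -> leb.-integrable `[c, c']%classic (fun y => (U (K k) y - U (- K k) y)%:E).
    move=> nc; apply: continuous_compact_integrable; first exact: segment_compact.
    apply/continuous_in_subspaceT => y; rewrite inE => yE.
    have y0 : y != 0 by apply: contra nc => /eqP <-.
    by apply: continuous_subf; exact: cU.
  have E1 : (\int[leb]_(x in `[(- K k)%R, K k]) (V x (d k) - V x (K k)^-1)%:E =
     - \int[leb]_(x in `[(- K k)%R, K k]) (V x (K k)^-1)%:E)%E.
    rewrite -integralN; last first.
      by apply: integrable_add_def => //; exact: (iV _ K0).
    apply: eq_integral => x; rewrite inE => /Vd[-> _]; by rewrite sub0r.
  have E2 : (\int[leb]_(x in `[(- K k)%R, K k]) (V x (- (K k)^-1) - V x (- d k))%:E =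
     \int[leb]_(x in `[(- K k)%R, K k]) (V x (- (K k)^-1))%:E)%E.
    by apply: eq_integral => x; rewrite inE => /Vd[_ ->]; rewrite subr0.
  have E3 : (\int[leb]_(x in `[(- K k)%R, K k]) (V x (- (K k)^-1) - V x (K k)^-1)%:E =
     \int[leb]_(x in `[(- K k)%R, K k]) (V x (- (K k)^-1))%:E -
     \int[leb]_(x in `[(- K k)%R, K k]) (V x (K k)^-1)%:E)%E.
    under eq_integral do rewrite EFinB.
    by rewrite integralB//; apply: iV; rewrite ?oppr_eq0.
  have mf : measurable_fun (S k : set (mR * mR)) (fun p => (psi p.1 p.2)%:E).
    by apply/measurable_EFinP; exact: measurable_funTS.
  have dS : [disjoint S1 k & S2 k].
    apply/disj_setPS => -[x y] [[_ /=]]; rewrite in_itv/= => /andP[y1 _] [_ /=].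
    rewrite in_itv/= => /andP[_ y2].
    have := lt_le_trans (lt_le_trans (Kv_gt0 k) y1) y2.
    by rewrite oppr_gt0 ltNge ltW// Kv_gt0.
  rewrite (integral_setU _ (measurable_rect _ _ _ _) (measurable_rect _ _ _ _) mf dS).
  rewrite (dbar_quot_re_rect l dP1 dP2 dQ1 dQ2 cP cQ cP1 cP2 cQ1 cQ2 (KK k) (ed k) (n1 k)).
  rewrite (dbar_quot_re_rect l dP1 dP2 dQ1 dQ2 cP cQ cP1 cP2 cQ1 cQ2 (KK k) (de k) (n2 k)).
  rewrite E1 E2 E3.
  have fin A (h : mR -> \bar R) : leb.-integrable A h -> measurable A -> exists r : R, (\int[leb]_(x in A) h x)%E = r%:E.
    by move=> ih mA; exists (fine (\int[leb]_(x in A) h x)%E); rewrite fineK// integrable_fin_num.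
  have [r1 ->] := fin _ _ (iU _ _ (n1 k)) (measurable_itv _).
  have [r2 ->] := fin _ _ (iU _ _ (n2 k)) (measurable_itv _).
  have [r3 ->] := fin _ _ (iV _ K0) (measurable_itv _).
  have [|r4 ->] := fin _ _ (iV (- (K k)^-1) _) (measurable_itv _); first by rewrite oppr_eq0.
  by rewrite -!(EFinN, EFinD, EFinM); congr (_%:E); lra.
have lim2 : (\int[lebesgue2 R]_(p in S k) (psi p.1 p.2)%:E)%E @[k --> \oo] --> (- pi * P l 0)%:E.
  under eq_fun do rewrite eqk.
  have -> : (- pi * P l 0)%:E = (2^-1%:E * 0 + 2^-1%:E * 0 + (- 2^-1)%:E * (2 * P l 0 * pi)%:E)%E.
    by rewrite !mule0 !add0e -EFinM; congr (_%:E); lra.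
  have z1 := cvgeZl (y := (2^-1)%:E) isT side1.
  have z2 := cvgeZl (y := (2^-1)%:E) isT side2.
  have z3 := cvgeZl (y := ((- 2^-1))%:E) isT edges_cvg.
  apply: cvgeD z3; last by apply: cvgeD z1 z2; rewrite !mule0.
  by rewrite !mule0 add0e.
exact: (cvg_unique _ lim1 lim2).
Unshelve. all: by end_near. Qed.

End cauchy_pompeiu.

(** * Calculus of complex-valued functions *)

Section complex_valued.
Context {R : realType}.
Local Notation C := (R[i]^o).

(** The derivative is taken componentwise, in accordance with [cderive1n]. *)
Definition is_cderive (g : R -> R[i]) (x : R) (d : R[i]) :=
  is_derive x 1 (fun t => complex.Re (g t)) (complex.Re d) /\
  is_derive x 1 (fun t => complex.Im (g t)) (complex.Im d).

Lemma ReD (z w : R[i]) : complex.Re (z + w) = complex.Re z + complex.Re w.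
Proof. by case: z w => ? ? [? ?]. Qed.
Lemma ImD (z w : R[i]) : complex.Im (z + w) = complex.Im z + complex.Im w.
Proof. by case: z w => ? ? [? ?]. Qed.
Lemma ReM (z w : R[i]) : complex.Re (z * w) =
  complex.Re z * complex.Re w - complex.Im z * complex.Im w.
Proof. by case: z w => ? ? [? ?]. Qed.
Lemma ImM (z w : R[i]) : complex.Im (z * w) =
  complex.Re z * complex.Im w + complex.Im z * complex.Re w.
Proof. by case: z w => ? ? [? ?]. Qed.

Lemma is_cderive_cst (c : R[i]) x : is_cderive (fun=> c) x 0.
Proof. by split; exact: is_derive_cst. Qed.

Lemma is_cderive_add (g h : R -> R[i]) x a b : is_cderive g x a -> is_cderive h x b ->
  is_cderive (fun t => g t + h t) x (a + b).
Proof.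
move=> [gr gi] [hr hi]; split.
  have := is_derive_addf gr hr; rewrite ReD.
  by under [X in is_derive _ _ X]eq_fun do rewrite -ReD.
have := is_derive_addf gi hi; rewrite ImD.
by under [X in is_derive _ _ X]eq_fun do rewrite -ImD.
Qed.

Lemma is_cderive_mul (g h : R -> R[i]) x a b : is_cderive g x a -> is_cderive h x b ->
  is_cderive (fun t => g t * h t) x (a * h x + g x * b).
Proof.
move=> [gr gi] [hr hi]; split.
  rewrite (_ : (fun t => _) = (fun t => complex.Re (g t) * complex.Re (h t) - complex.Im (g t) * complex.Im (h t))); last first.
    by apply/funext => t; rewrite ReM.
  apply: (is_derive_eq (is_derive_subf (is_derive_mulf gr hr) (is_derive_mulf gi hi))).
  by rewrite ReD !ReM; ring.
rewrite (_ : (fun t => _) = (fun t => complex.Re (g t) * complex.Im (h t) + complex.Im (g t) * complex.Re (h t))); last first.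
  by apply/funext => t; rewrite ImM.
apply: (is_derive_eq (is_derive_addf (is_derive_mulf gr hi) (is_derive_mulf gi hr))).
by rewrite ImD !ImM; ring.
Qed.

Lemma is_cderive_real (g : R -> R) (x a : R) : is_derive x 1 g a ->
  is_cderive (fun t => (g t)%:C) x a%:C.
Proof. by move=> ga; split => //; exact: is_derive_cst. Qed.

Lemma is_cderive_comp (g : R -> R[i]) (h : R -> R) (x : R) a (b : R) :
  is_cderive g (h x) a -> is_derive x 1 h b ->
  is_cderive (fun t => g (h t)) x (a * b%:C).
Proof.
move=> [gr gi] hb; split.
  by apply: (is_derive_eq (is_derive_compf gr hb)); rewrite ReM /= mulr0 subr0.
by apply: (is_derive_eq (is_derive_compf gi hb)); rewrite ImM /= mulr0 add0r.
Qed.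

Lemma is_cderive_sum (I : Type) (r : seq I) (g : I -> R -> R[i]) x (a : I -> R[i]) :
  (forall i, is_cderive (g i) x (a i)) ->
  is_cderive (fun t => \sum_(i <- r) g i t) x (\sum_(i <- r) a i).
Proof.
move=> ga; elim: r => [|i r ih].
  rewrite big_nil (_ : (fun t => _) = (fun=> 0)); first exact: is_cderive_cst.
  by apply/funext => t; rewrite big_nil.
rewrite big_cons (_ : (fun t => _) = (fun t => g i t + \sum_(j <- r) g j t)).
  exact: is_cderive_add.
by apply/funext => t; rewrite big_cons.
Qed.

Lemma is_cderive_exp (g : R -> R[i]) n x a : is_cderive g x a ->
  is_cderive (fun t => g t ^+ n) x (n%:R * g x ^+ n.-1 * a).
Proof.
move=> ga; elim: n => [|n ih].
  rewrite mul0r mul0r (_ : (fun t => _) = (fun=> 1)); first exact: is_cderive_cst.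
  by apply/funext => t; rewrite expr0.
rewrite (_ : (fun t => _) = (fun t => g t * g t ^+ n)); last first.
  by apply/funext => t; rewrite exprS.
have := is_cderive_mul ga ih.
rewrite (_ : a * g x ^+ n + g x * (n%:R * g x ^+ n.-1 * a) = n.+1%:R * g x ^+ n.+1.-1 * a)//.
case: n {ih} => [|n] /=; first by ring.
by rewrite !exprS -[n.+2]addn1 natrD; ring.
Qed.

Lemma cderive1nE (g : R -> R[i]) x a : is_cderive g x a -> cderive1n 1 g x = a.
Proof.
move=> [[_ gr] [_ gi]]; rewrite /cderive1n /= !derive1E gr gi.
by case: a gr gi.
Qed.

Lemma smooth_is_cderive (g : R -> R[i]) n x : smooth g ->
  is_cderive (cderive1n n g) x (cderive1n n.+1 g x).
Proof.
move=> /(_ n x)[dr di]; split => /=.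
  by apply: DeriveDef => //=; rewrite derive1E.
by apply: DeriveDef => //=; rewrite derive1E.
Qed.

Lemma ler_Re_rnorm (z : C) : `|complex.Re z| <= rnorm z.
Proof. by rewrite -lecR rnormE; exact: normc_ge_Re. Qed.

Lemma ler_Im_rnorm (z : C) : `|complex.Im z| <= rnorm z.
Proof.
rewrite -lecR rnormE normc_def lecR -sqrtr_sqr ler_wsqrtr//.
by rewrite lerDr sqr_ge0.
Qed.

Lemma rnorm_ler_ReIm (z : C) : rnorm z <= `|complex.Re z| + `|complex.Im z|.
Proof.
rewrite rnormc normc_def /= -[leRHS]ger0_norm ?addr_ge0// -sqrtr_sqr ler_wsqrtr//.
rewrite sqrrD !real_normK ?num_real// addrAC lerDl mulrn_wge0// mulr_ge0//.
Qed.

Lemma rnormM (z w : C) : rnorm (z * w : C) = rnorm z * rnorm w.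
Proof. by rewrite !rnormc normrM ReM !normc_def /= mulr0 subr0. Qed.

Lemma rnorm_real (a : R) : rnorm (a%:C : C) = `|a|.
Proof. by rewrite rnormc normc_def/= expr0n addr0 sqrtr_sqr. Qed.

Lemma rnormX (z : C) n : rnorm (z ^+ n : C) = rnorm z ^+ n.
Proof.
elim: n => [|n ih]; first by rewrite !expr0 -[1]/(1%:C) rnorm_real normr1.
by rewrite !exprS rnormM ih.
Qed.

Lemma rnorm_i : rnorm ('i%C : C) = 1.
Proof. by rewrite rnormc normc_def/= expr0n add0r expr1n sqrtr1. Qed.

Lemma rnorm_sum (I : Type) (r : seq I) (F : I -> C) :
  rnorm (\sum_(i <- r) F i) <= \sum_(i <- r) rnorm (F i).
Proof.
elim: r => [|i r ih]; first by rewrite !big_nil rnorm0.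
by rewrite !big_cons (le_trans (rnormD _ _))// lerD2l.
Qed.

Section continuity.
Context {T : topologicalType}.
Implicit Types (g h : T -> C) (x : T).

Lemma ccontinuousP g x : {for x, continuous g} <->
  {for x, continuous (fun t => complex.Re (g t))} /\
  {for x, continuous (fun t => complex.Im (g t))}.
Proof.
split=> [/cvg_rnormP gx|[gr gi]].
  split; apply/cvgrPdist_le => e e0; move/cvgrPdist_le : gx => /(_ _ e0);
    apply: filterS => t; rewrite sub0r normrN ger0_norm ?rnorm_ge0// rnorm_distrC; apply: le_trans.
  - by rewrite -(raddfB (@complex.Re R)); exact: ler_Re_rnorm.
  - by rewrite -(raddfB (@complex.Im R)); exact: ler_Im_rnorm.
apply/cvg_rnormP/cvgrPdist_le => e e0; have e20 : 0 < e / 2 by rewrite divr_gt0.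
move/cvgrPdist_le : gr => /(_ _ e20); move/cvgrPdist_le : gi => /(_ _ e20).
apply: filterS2 => t hi hr; rewrite sub0r normrN ger0_norm ?rnorm_ge0//.
rewrite (le_trans (rnorm_ler_ReIm _))// [e]splitr (raddfB (@complex.Re R)) (raddfB (@complex.Im R)).
by rewrite lerD// distrC.
Qed.

Lemma ccontinuous_real (f : T -> R) x : {for x, continuous f} ->
  {for x, continuous (fun t => (f t)%:C : C)}.
Proof. by move=> cf; apply/ccontinuousP; split => //=; exact: continuous_cstf. Qed.

Lemma ccontinuous_add g h x : {for x, continuous g} -> {for x, continuous h} ->
  {for x, continuous (fun t => g t + h t : C)}.
Proof. exact: cvgD. Qed.

Lemma ccontinuous_mul g h x : {for x, continuous g} -> {for x, continuous h} ->
  {for x, continuous (fun t => g t * h t : C)}.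
Proof. exact: cvgM. Qed.

Lemma ccontinuous_inv g x : g x != 0 -> {for x, continuous g} ->
  {for x, continuous (fun t => (g t)^-1 : C)}.
Proof. exact: (@cvgV (R[i] : numFieldType)). Qed.

Lemma ccontinuous_sub g h x : {for x, continuous g} -> {for x, continuous h} ->
  {for x, continuous (fun t => g t - h t : C)}.
Proof. exact: cvgB. Qed.

Lemma ccontinuous_cst (c : C) x : {for x, continuous (fun _ : T => c)}.
Proof. exact: cvg_cst. Qed.

Lemma ccontinuous_exp g n x : {for x, continuous g} ->
  {for x, continuous (fun t => g t ^+ n : C)}.
Proof.
move=> cg; elim: n => [|n ih]; first exact: ccontinuous_cst.
have -> : (fun t => g t ^+ n.+1 : C) = (fun t => g t * g t ^+ n).
  by apply/funext => t; rewrite exprS.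
exact: ccontinuous_mul.
Qed.

Lemma ccontinuous_sum (I : Type) (r : seq I) (F : I -> T -> C) x :
  (forall i, {for x, continuous (F i)}) ->
  {for x, continuous (fun t => \sum_(i <- r) F i t : C)}.
Proof.
move=> cF; elim: r => [|i r ih].
  have -> : (fun t => \sum_(i <- [::]) F i t : C) = (fun=> 0).
    by apply/funext => t; rewrite big_nil.
  exact: ccontinuous_cst.
have -> : (fun t => \sum_(j <- i :: r) F j t : C) = (fun t => F i t + \sum_(j <- r) F j t).
  by apply/funext => t; rewrite big_cons.
exact: ccontinuous_add.
Qed.

End continuity.

Lemma is_cderive_continuous (g : R -> C) x d : is_cderive g x d -> {for x, continuous g}.
Proof.
move=> [gr gi]; apply/ccontinuousP.
by split; [exact: is_derive_continuous gr|exact: is_derive_continuous gi].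
Qed.

End complex_valued.

(** * Brackets and cutoffs *)

Section extension.
Context {R : realType}.
Local Notation C := (R[i]^o).
Local Notation J x := (bracket (x : R)%:C).

Lemma bracketE (x : R) : J x = Num.sqrt (1 + x ^+ 2).
Proof. by rewrite /bracket -(rnormc x%:C) rnorm_real real_normK ?num_real. Qed.

Lemma bracket_ge1 (x : R) : 1 <= J x.
Proof. by rewrite bracketE -{1}sqrtr1 ler_wsqrtr// lerDl sqr_ge0. Qed.

Lemma bracket_gt0 (x : R) : 0 < J x.
Proof. exact: lt_le_trans (bracket_ge1 x). Qed.

Lemma bracket_sqr (x : R) : J x ^+ 2 = 1 + x ^+ 2.
Proof. by rewrite bracketE sqr_sqrtr// addr_ge0// sqr_ge0. Qed.

Lemma norm_le_bracket (x : R) : `|x| <= J x.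
Proof. by rewrite bracketE -sqrtr_sqr ler_wsqrtr// lerDr. Qed.

Lemma bracket_le_norm1 (x : R) : J x <= 1 + `|x|.
Proof.
rewrite bracketE -[leRHS]ger0_norm ?addr_ge0// -sqrtr_sqr ler_wsqrtr//.
have := normr_ge0 x; have : `|x| ^+ 2 = x ^+ 2 by rewrite real_normK ?num_real.
by nra.
Qed.

Lemma norm1_le_bracket (x : R) : 1 + `|x| <= 2 * J x.
Proof. by have := bracket_ge1 x; have := norm_le_bracket x; lra. Qed.

(** Brackets are replaced by the equivalent weight 1 + |x|, whose powers have
    explicit primitives on half-lines. *)
Lemma powR_bracket_le (s x : R) : s <= 0 -> J x `^ s <= 2 `^ (- s) * (1 + `|x|) `^ s.
Proof.
move=> s0; have m0 : 0 < 1 + `|x| by rewrite ltr_pwDl.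
have -> : 2 `^ (- s) * (1 + `|x|) `^ s = ((1 + `|x|) / 2) `^ s.
  rewrite powRM ?invr_ge0 ?(ltW m0)// mulrC; congr (_ * _).
  by rewrite -[in RHS](powR_inv1 (ltW (ltr0n _ 2)))// -powRrM mulN1r.
apply: ler_powR_neg => //.
by rewrite ler_pdivrMr// mulrC norm1_le_bracket.
Qed.

Lemma is_derive_bracket (x : R) : is_derive x 1 (fun x : R => J x) (x / J x).
Proof.
have d2 : is_derive x 1 (fun x : R => 1 + x ^+ 2) (2 * x).
  have := is_derive_addf (is_derive_cstf x 1) (is_derive_mulf (is_derive_idf x) (is_derive_idf x)).
  by under eq_fun do rewrite -expr2; move/is_derive_eq; apply; ring.
have p : 0 < 1 + x ^+ 2 by rewrite -bracket_sqr exprn_gt0// bracket_gt0.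
have := @is_derive_compf _ Num.sqrt (fun x => 1 + x ^+ 2) _ _ _ (is_derive1_sqrt p) d2.
rewrite -bracketE (_ : (fun t : R => Num.sqrt (1 + t ^+ 2)) = (fun t : R => J t)); last first.
  by apply/funext => t; rewrite bracketE.
move/is_derive_eq; apply; have := bracket_gt0 x => J0.
by field; rewrite gt_eqF.
Qed.

Lemma continuous_bracket (x : R) : {for x, continuous (fun x : R => J x)}.
Proof. exact: is_derive_continuous (is_derive_bracket x). Qed.

Lemma cutoff_bounded (g : R -> C) : continuous g ->
  (forall t, 2 < `|t| -> g t = 0) -> exists M : R, forall t, rnorm (g t) <= M.
Proof.
move=> cg g0.
have cr : continuous (fun t => rnorm (g t)) by move=> t; exact: cvg_rnorm (cg t).
have [||c _ cM] := @EVT_max R (fun t => rnorm (g t)) (-2) 2.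
- by lra.
- exact: continuous_subspaceT.
exists (rnorm (g c)) => t; have [t2|t2] := leP `|t| 2.
  by apply: cM; rewrite in_itv/= -ler_norml.
by rewrite g0// rnorm0 rnorm_ge0.
Qed.

(** The cutoff is locally constant at such a point. *)
Lemma cutoff_derive0 (tau0 : R -> R[i]) t : cutoff tau0 ->
  (`|t| < 1 \/ 2 < `|t|) -> cderive1n 1 tau0 t = 0.
Proof.
move=> [_ tau1 tau2] ht.
have [c tauc] : exists c, \forall s \near t, tau0 s = c.
  case: ht => ht.
    exists 1; have : \forall s \near t, `|s| < 1.
      by have /cvgr_lt := @norm_continuous _ R t; apply.
    by apply: filterS => s /ltW; exact: tau1.
  exists 0; have : \forall s \near t, 2 < `|s|.
    by have /cvgr_gt := @norm_continuous _ R t; apply.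
  by apply: filterS => s /ltW; exact: tau2.
apply: cderive1nE; split.
  apply: (@near_eq_is_derive _ _ _ (cst (complex.Re c))).
    by apply: filterS tauc => s ->.
apply: (@near_eq_is_derive _ _ _ (cst (complex.Im c))).
  by apply: filterS tauc => s ->.
Qed.

(** The cutoff and its derivative are continuous and vanish outside [-2, 2]. *)
Lemma cutoff_bounds (tau0 : R -> R[i]) : cutoff tau0 -> exists M : R,
  forall t, rnorm (tau0 t : C) <= M /\ rnorm (cderive1n 1 tau0 t : C) <= M.
Proof.
move=> ct; have [st _ tau2] := ct.
have d0 t := @smooth_is_cderive _ tau0 0 t st.
have d1 t := @smooth_is_cderive _ tau0 1 t st.
have c0 : continuous (tau0 : R -> C).
  move=> t; have := is_cderive_continuous (d0 t).
  by rewrite (_ : cderive1n 0 tau0 = tau0)//; apply/funext => s; rewrite /cderive1n/=; case: (tau0 s).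
have c1 : continuous (cderive1n 1 tau0 : R -> C) by move=> t; exact: is_cderive_continuous (d1 t).
have [M0 HM0] := cutoff_bounded c0 (fun t ht => tau2 t (ltW ht)).
have [M1 HM1] := cutoff_bounded c1 (fun t ht => cutoff_derive0 ct (or_intror ht)).
by exists (Num.max M0 M1) => t; rewrite !le_max HM0 HM1 orbT.
Qed.

End extension.

(** * The almost analytic extension *)

Section almost_analytic.
Context {R : realType}.
Local Notation C := (R[i]^o).
Local Notation J x := (bracket (x : R)%:C).
Context (n : nat) (f tau0 : R -> R[i]).
Hypothesis sf : smooth f.
Hypothesis ct : cutoff tau0.

Let st : smooth tau0. Proof. by have [] := ct. Qed.

Let D k x : R[i] := cderive1n k f x.
Let iy (y : R) : R[i] := 'i%C * y%:C.
Let T1 t : R[i] := cderive1n 1 tau0 t.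
Let coef r : R[i] := (r`!%:R)^-1.

(** The Taylor sum, at the imaginary increment i y, of the k-th derivative of f;
    a derivative in x raises k, one in y also lowers m. *)
Definition taylor k m x y : R[i] :=
  \sum_(r < m) D (k + r) x * iy y ^+ r / r`!%:R.

Local Notation F := (almost_analytic_ext n tau0 f).
Definition ext_dx x y : R[i] :=
  taylor 1 n.+1 x y * tau0 (y / J x) +
  taylor 0 n.+1 x y * (T1 (y / J x) * (- (y * x) / J x ^+ 3)%:C).
Definition ext_dy x y : R[i] :=
  'i%C * taylor 1 n x y * tau0 (y / J x) +
  taylor 0 n.+1 x y * (T1 (y / J x) * ((J x)^-1)%:C).

Lemma almost_analytic_extE x y : F x y = taylor 0 n.+1 x y * tau0 (y / J x).
Proof. by []. Qed.

Let dD k x : is_cderive (D k) x (D k.+1 x).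
Proof. exact: smooth_is_cderive. Qed.

Let dtau t : is_cderive tau0 t (T1 t).
Proof.
have := @smooth_is_cderive _ tau0 0 t st.
by rewrite (_ : cderive1n 0 tau0 = tau0)//; apply/funext => s; rewrite /cderive1n/=; case: (tau0 s).
Qed.

Lemma is_cderive_eq (g : R -> R[i]) x a b : is_cderive g x a -> a = b -> is_cderive g x b.
Proof. by move=> ga <-. Qed.

Lemma is_cderive_ext_dx x y : is_cderive (F^~ y) x (ext_dx x y).
Proof.
have dS : is_cderive (fun t => taylor 0 n.+1 t y) x (taylor 1 n.+1 x y).
  apply: is_cderive_sum => r; rewrite /= add0n add1n.
  apply: is_cderive_eq.
    exact: is_cderive_mul (is_cderive_mul (dD r x) (is_cderive_cst _ x)) (is_cderive_cst _ x).
  by rewrite !mulr0 !addr0.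
have J0 := bracket_gt0 x.
have dq : is_derive x 1 (fun t : R => y / J t) (- (y * x) / J x ^+ 3).
  have := is_derive_scalef y (@is_derive_invf _ (fun t : R => J t) x _ (lt0r_neq0 J0) (is_derive_bracket x)).
  by move/is_derive_eq; apply; field; rewrite gt_eqF.
exact: is_cderive_mul dS (is_cderive_comp (dtau _) dq).
Qed.

Lemma is_cderive_ext_dy x y : is_cderive (F x) y (ext_dy x y).
Proof.
have dS : is_cderive (fun t => taylor 0 n.+1 x t) y ('i%C * taylor 1 n x y).
  have di : is_cderive iy y 'i%C.
    apply: is_cderive_eq.
      exact: is_cderive_mul (is_cderive_cst 'i%C y) (is_cderive_real (is_derive_idf y)).
    by rewrite mul0r add0r mulr1.
  have ds : is_cderive (fun t => taylor 0 n.+1 x t) y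
     (\sum_(r < n.+1) D r x * (r%:R * iy y ^+ r.-1 * 'i%C) / r`!%:R).
    apply: is_cderive_sum => r; rewrite /= add0n.
    apply: is_cderive_eq.
      exact: is_cderive_mul (is_cderive_mul (is_cderive_cst _ y) (is_cderive_exp r di)) (is_cderive_cst _ y).
    by rewrite !mul0r !mulr0 add0r addr0.
  apply: (is_cderive_eq ds); rewrite big_ord_recl /= mul0r mul0r mulr0 mul0r add0r.
  rewrite /taylor mulr_sumr; apply: eq_bigr => r _; rewrite /bump /= add1n factS natrM.
  have r0 : (r`!%:R : R[i]) != 0 by rewrite pnatr_eq0 -lt0n fact_gt0.
  have r1 : (r.+1%:R : R[i]) != 0 by rewrite pnatr_eq0.
  by field; rewrite r0 -[X in X + _]/(1%:R) -natrD add1n r1.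
have J0 := bracket_gt0 x.
have dq : is_derive y 1 (fun t : R => t / J x) (J x)^-1.
  have := is_derive_mulf (is_derive_idf y) (is_derive_cstf y (J x)^-1).
  by move/is_derive_eq; apply; rewrite mul1r mulr0 addr0.
exact: is_cderive_mul dS (is_cderive_comp (dtau _) dq).
Qed.

Lemma dbar_extE x y : dbar F x y = 2^-1 * (ext_dx x y + 'i%C * ext_dy x y).
Proof. by rewrite /dbar (cderive1nE (is_cderive_ext_dx x y)) (cderive1nE (is_cderive_ext_dy x y)). Qed.

(** The Taylor sums of the x- and y-derivatives telescope, and only the term of
    order n is left apart from the derivative of the cutoff. *)
Lemma dbar_ext_formula x y : dbar F x y =
  2^-1 * (D n.+1 x * iy y ^+ n / n`!%:R * tau0 (y / J x) +
   taylor 0 n.+1 x y * (T1 (y / J x) * ((- (y * x) / J x ^+ 3)%:C + 'i%C * ((J x)^-1)%:C))).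
Proof.
rewrite dbar_extE /ext_dx /ext_dy; congr (_ * _).
have -> : taylor 1 n.+1 x y = taylor 1 n x y + D n.+1 x * iy y ^+ n / n`!%:R.
  by rewrite /taylor big_ord_recr /= add1n.
have i2 : 'i%C * 'i%C = -1 :> R[i] by rewrite -expr2 sqr_i.
set a := taylor 1 n x y; set t := tau0 _; set S := taylor 0 _ _ _; set q := (_)%:C.
set p := ((J x)^-1)%:C; set w := D _ _ * _ / _; set T := T1 _.
have -> : 'i%C * ('i%C * a * t + S * (T * p)) = ('i%C * 'i%C) * a * t + 'i%C * (S * (T * p)) by ring.
by rewrite i2; ring.
Qed.

Let cD k (p : R * R) : {for p, continuous (fun p : R * R => D k p.1 : C)}.
Proof.
apply: (@continuous_comp _ _ _ fst (D k : R -> C)); first exact: cvg_fst.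
exact: is_cderive_continuous (dD k p.1).
Qed.

Let ciy (p : R * R) : {for p, continuous (fun p : R * R => iy p.2 : C)}.
Proof.
apply: ccontinuous_mul; first exact: ccontinuous_cst.
by apply: (@ccontinuous_real _ _ snd); exact: cvg_snd.
Qed.

Let cJ (p : R * R) : {for p, continuous (fun p : R * R => J p.1)}.
Proof.
apply: (@continuous_comp _ _ _ fst (fun x : R => J x)); first exact: cvg_fst.
exact: continuous_bracket.
Qed.

Let cJV (p : R * R) : {for p, continuous (fun p : R * R => (J p.1)^-1)}.
Proof. by apply: continuous_invf; [rewrite gt_eqF// bracket_gt0|exact: cJ]. Qed.

Let cq (p : R * R) : {for p, continuous (fun p : R * R => p.2 / J p.1)}.
Proof. by apply: continuous_mulf; [exact: cvg_snd|exact: cJV]. Qed.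

Let ctau (p : R * R) : {for p, continuous (fun p : R * R => tau0 (p.2 / J p.1) : C)}.
Proof.
apply: (@continuous_comp _ _ _ (fun p : R * R => p.2 / J p.1) (tau0 : R -> C)); first exact: cq.
exact: is_cderive_continuous (dtau _).
Qed.

Let cT1 (p : R * R) : {for p, continuous (fun p : R * R => T1 (p.2 / J p.1) : C)}.
Proof.
apply: (@continuous_comp _ _ _ (fun p : R * R => p.2 / J p.1) (T1 : R -> C)); first exact: cq.
exact: is_cderive_continuous (@smooth_is_cderive _ tau0 1 _ st).
Qed.

Let ctaylor k m (p : R * R) : {for p, continuous (fun p : R * R => taylor k m p.1 p.2 : C)}.
Proof.
apply: ccontinuous_sum => r.
apply: ccontinuous_mul; last exact: ccontinuous_cst.
by apply: ccontinuous_mul; [exact: cD|apply: ccontinuous_exp; exact: ciy].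
Qed.

Lemma continuous_ext (p : R * R) : {for p, continuous (fun p : R * R => F p.1 p.2 : C)}.
Proof. exact: (ccontinuous_mul (@ctaylor 0 n.+1 p) (@ctau p)). Qed.

Let cdq (p : R * R) : {for p, continuous (fun p : R * R => (- (p.2 * p.1) / J p.1 ^+ 3)%:C : C)}.
Proof.
apply: (@ccontinuous_real _ _ (fun p : R * R => - (p.2 * p.1) / J p.1 ^+ 3)).
apply: continuous_mulf.
  have := @continuous_subf _ _ (fun _ : R * R => 0) (fun p : R * R => p.2 * p.1) p.
  under [X in _ -> _ -> {for _, continuous X}]eq_fun do rewrite sub0r.
  apply; first exact: continuous_cstf.
  by apply: continuous_mulf; [exact: cvg_snd|exact: cvg_fst].
apply: continuous_invf; first by rewrite expf_neq0// gt_eqF// bracket_gt0.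
by apply: continuous_expf; exact: cJ.
Qed.

Lemma continuous_ext_dx (p : R * R) : {for p, continuous (fun p : R * R => ext_dx p.1 p.2 : C)}.
Proof.
apply: ccontinuous_add; apply: ccontinuous_mul; try exact: ctaylor; first exact: ctau.
by apply: ccontinuous_mul; [exact: cT1|exact: cdq].
Qed.

Lemma continuous_ext_dy (p : R * R) : {for p, continuous (fun p : R * R => ext_dy p.1 p.2 : C)}.
Proof.
apply: ccontinuous_add; apply: ccontinuous_mul; try exact: ctaylor.
- by apply: ccontinuous_mul; [exact: ccontinuous_cst|exact: ctaylor].
- exact: ctau.
- apply: ccontinuous_mul; first exact: cT1.
  by apply: (@ccontinuous_real _ _ (fun p : R * R => (J p.1)^-1)); exact: cJV.
Qed.

Lemma continuous_dbar_ext (p : R * R) : {for p, continuous (fun p : R * R => dbar F p.1 p.2 : C)}.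
Proof.
rewrite (_ : (fun p : R * R => _) = (fun p : R * R => 2^-1 * (ext_dx p.1 p.2 + 'i%C * ext_dy p.1 p.2) : C)).
  apply: ccontinuous_mul; first exact: ccontinuous_cst.
  apply: ccontinuous_add; first exact: continuous_ext_dx.
  by apply: ccontinuous_mul; [exact: ccontinuous_cst|exact: continuous_ext_dy].
by apply/funext => q; rewrite dbar_extE.
Qed.

End almost_analytic.

(** * Bounds for the almost analytic extension *)

Section almost_analytic_bounds.
Context {R : realType}.
Local Notation C := (R[i]^o).
Local Notation J x := (bracket (x : R)%:C).
Context (n : nat) (f tau0 : R -> R[i]) (b M : R) (cc : nat -> R).
Hypothesis sf : smooth f.
Hypothesis ct : cutoff tau0.
Hypothesis b0 : b < 0.
Hypothesis fcc : forall k x, rnorm (cderive1n k f x : C) <= cc k * J x `^ (b - k%:R).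
Hypothesis tauM : forall t, rnorm (tau0 t : C) <= M /\ rnorm (cderive1n 1 tau0 t : C) <= M.

Local Notation F := (almost_analytic_ext n tau0 f).
Local Notation coef k m := (\sum_(r < m) cc (k + r) * 2 ^+ r).

Let J0 x : 0 < J x. Proof. exact: bracket_gt0. Qed.

Let M0 : 0 <= M.
Proof. by have [h _] := tauM 0; rewrite (le_trans _ h)// rnorm_ge0. Qed.

Let cc0 k : 0 <= cc k.
Proof.
have h : 0 <= cc k * J 0 `^ (b - k%:R) := le_trans (rnorm_ge0 _) (fcc k 0).
by rewrite -(pmulr_lge0 _ (powR_gt0 (b - k%:R) (J0 0))).
Qed.

Let coef0 k m : 0 <= coef k m.
Proof. by apply: sumr_ge0 => r _; rewrite mulr_ge0// exprn_ge0. Qed.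

Lemma rnorm_fact_inv r : rnorm ((r`!%:R : R[i])^-1 : C) <= 1.
Proof.
have -> : (r`!%:R : R[i])^-1 = ((r`!%:R)^-1)%:C by rewrite fmorphV rmorph_nat.
rewrite rnorm_real ger0_norm ?invr_ge0// invf_le1 ?ltr0n ?fact_gt0//.
by rewrite ler1n fact_gt0.
Qed.

(** On the support of the cutoff each factor y is compensated by the additional
    decay of the next derivative of f. *)
Lemma rnorm_taylor_term k r x y : `|y| <= 2 * J x ->
  rnorm (cderive1n (k + r) f x * ('i%C * y%:C) ^+ r / r`!%:R : C) <=
  cc (k + r) * 2 ^+ r * J x `^ (b - k%:R).
Proof.
move=> yJ; rewrite rnormM (le_trans (ler_piMr _ (rnorm_fact_inv r))) ?rnorm_ge0//.
rewrite rnormM rnormX rnormM rnorm_i rnorm_real mul1r.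
rewrite (@le_trans _ _ (cc (k + r) * J x `^ (b - (k + r)%:R) * (2 * J x) ^+ r))//.
  by apply: ler_pM; rewrite ?rnorm_ge0 ?exprn_ge0// lerXn2r ?nnegrE ?mulr_ge0 ?(ltW (J0 x)).
rewrite exprMn (_ : b - k%:R = (b - (k + r)%:R) + r%:R); last by rewrite natrD; ring.
rewrite [in leRHS]powRD ?(gt_eqF (J0 x)) ?implybT// powR_mulrn ?(ltW (J0 x))//.
by rewrite le_eqVlt; apply/orP; left; apply/eqP; ring.
Qed.

Lemma rnorm_taylor k m x y : `|y| <= 2 * J x ->
  rnorm (taylor f k m x y : C) <= coef k m * J x `^ (b - k%:R).
Proof.
move=> yJ; rewrite (le_trans (rnorm_sum _ _))// mulr_suml ler_sum// => r _.
exact: rnorm_taylor_term.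
Qed.

Let tau_far x y : 2 * J x < `|y| -> tau0 (y / J x) = 0 /\ cderive1n 1 tau0 (y / J x) = 0.
Proof.
move=> yJ; have q : 2 < `|y / J x|.
  by rewrite normrM normfV (gtr0_norm (J0 x)) ltr_pdivlMr.
split; last by apply: cutoff_derive0 => //; right.
by have [_ _ ->//] := ct; exact: ltW.
Qed.

Lemma rnorm_ext x y : rnorm (F x y : C) <= coef 0 n.+1 * M * J x `^ b.
Proof.
have [yJ|yJ] := leP `|y| (2 * J x); last first.
  have [t0 _] := tau_far yJ; rewrite almost_analytic_extE t0 mulr0 rnorm0.
  by rewrite !mulr_ge0 ?powR_ge0 ?coef0.
rewrite almost_analytic_extE rnormM.
have h := rnorm_taylor 0 n.+1 yJ; rewrite subr0 in h.
rewrite (le_trans (ler_pM (rnorm_ge0 _) (rnorm_ge0 _) h (tauM _).1))//.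
by rewrite mulrAC.
Qed.

Lemma rnorm_ext_dy x y :
  rnorm (ext_dy n f tau0 x y : C) <= (coef 1 n + coef 0 n.+1) * M * J x `^ (b - 1).
Proof.
have [yJ|yJ] := leP `|y| (2 * J x); last first.
  have [t0 t1] := tau_far yJ; rewrite /ext_dy t0 t1 mul0r !mulr0 addr0 rnorm0.
  by rewrite !mulr_ge0 ?powR_ge0 ?addr_ge0 ?coef0.
have h0 := rnorm_taylor 0 n.+1 yJ; rewrite subr0 in h0.
have h1 := rnorm_taylor 1 n yJ.
rewrite (le_trans (rnormD _ _))// !mulrDl lerD//.
  rewrite rnormM rnormM rnorm_i mul1r.
  rewrite (le_trans (ler_pM (rnorm_ge0 _) (rnorm_ge0 _) h1 (tauM _).1))//.
  by rewrite mulrAC.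
rewrite rnormM rnormM rnorm_real (ger0_norm (_ : 0 <= (J x)^-1)) ?invr_ge0 ?(ltW (J0 x))//.
have JV0 : 0 <= (J x)^-1 by rewrite invr_ge0 ltW.
have h2 : rnorm (cderive1n 1 tau0 (y / J x) : C) * (J x)^-1 <= M * (J x)^-1.
  by rewrite ler_wpM2r// (tauM _).2.
rewrite (le_trans (ler_pM (rnorm_ge0 _) _ h0 h2))//; first by rewrite mulr_ge0// rnorm_ge0.
rewrite powRB ?(gt_eqF (J0 x)) ?implybT// powRr1 ?(ltW (J0 x))//.
by rewrite le_eqVlt; apply/orP; left; apply/eqP; ring.
Qed.

Lemma rnorm_ext_dx0 x : rnorm (ext_dx n f tau0 x 0 : C) <= coef 1 n.+1 * M.
Proof.
have yJ : `|0 : R| <= 2 * J x by rewrite normr0 mulr_ge0 ?(ltW (J0 x)).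
rewrite /ext_dx !mul0r oppr0 mul0r (_ : 0%:C = 0)// !mulr0 addr0 rnormM.
have h1 := rnorm_taylor 1 n.+1 yJ.
rewrite (le_trans (ler_pM (rnorm_ge0 _) (rnorm_ge0 _) h1 (tauM _).1))//.
rewrite ler_wpM2r// ler_piMr ?coef0//.
rewrite (@le_trans _ _ (J x `^ 0))//; last by rewrite powRr0.
by apply: ler_powR; [exact: bracket_ge1|rewrite subr_le0 (le_trans (ltW b0))].
Qed.

(** The order n in y is explicit in the Taylor term.  The other term is
    supported where |y| is comparable with the bracket of x, so powers of the
    two may be exchanged. *)
Lemma rnorm_dbar_ext x y :
  rnorm (dbar F x y : C) <=
   (cc n.+1 * M + 3 * coef 0 n.+1 * M) * (J x `^ (b - n%:R - 1) * `|y| ^+ n).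
Proof.
rewrite (dbar_ext_formula n sf ct).
have W0 : 0 <= J x `^ (b - n%:R - 1) * `|y| ^+ n by rewrite mulr_ge0 ?powR_ge0 ?exprn_ge0.
have [yJ|yJ] := leP `|y| (2 * J x); last first.
  have [-> ->] := tau_far yJ; rewrite mul0r !mulr0 add0r mulr0 rnorm0.
  by rewrite mulr_ge0// addr_ge0 ?mulr_ge0 ?coef0.
have half : rnorm ((2^-1 : R[i]) : C) <= 1.
  have -> : (2^-1 : R[i]) = (2^-1)%:C by rewrite fmorphV rmorph_nat.
  by rewrite rnorm_real ger0_norm// invf_le1// ler1n.
rewrite rnormM (le_trans (ler_wpM2r (rnorm_ge0 _) half))// mul1r.
rewrite (le_trans (rnormD _ _))// mulrDl lerD//.
  rewrite rnormM.
  rewrite (le_trans (ler_pM (rnorm_ge0 _) (rnorm_ge0 _) _ (tauM _).1) (_ : cc n.+1 * (J x `^ (b - n%:R - 1) * `|y| ^+ n) * M <= _))//.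
    rewrite rnormM (le_trans (ler_piMr _ (rnorm_fact_inv n))) ?rnorm_ge0//.
    rewrite rnormM rnormX rnormM rnorm_i rnorm_real mul1r mulrA ler_wpM2r ?exprn_ge0//.
    by rewrite (le_trans (fcc _ _))// -[n.+1%:R]natr1 opprD addrA.
  by rewrite mulrAC.
have [yJ1|yJ1] := ltP `|y| (J x).
  rewrite cutoff_derive0//; first by rewrite mul0r mulr0 rnorm0 mulr_ge0// mulr_ge0// mulr_ge0 ?coef0.
  by left; rewrite normrM normfV (gtr0_norm (J0 x)) ltr_pdivrMr// mul1r.
have h0 := rnorm_taylor 0 n.+1 yJ; rewrite subr0 in h0.
have hq : rnorm ((- (y * x) / J x ^+ 3)%:C + 'i%C * ((J x)^-1)%:C : C) <= 3 * (J x)^-1.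
  have JV0 : 0 < (J x)^-1 by rewrite invr_gt0.
  rewrite (le_trans (rnormD _ _))// rnormM rnorm_i mul1r !rnorm_real (gtr0_norm JV0).
  suff : `|- (y * x) / J x ^+ 3| <= 2 * (J x)^-1 by lra.
  rewrite normrM normrN normfV (gtr0_norm (exprn_gt0 3 (J0 x))) ler_pdivrMr ?exprn_gt0//.
  have -> : 2 * (J x)^-1 * J x ^+ 3 = (2 * J x) * J x by field; rewrite gt_eqF.
  by rewrite normrM ler_pM// norm_le_bracket.
have h2 : rnorm ((cderive1n 1 tau0 (y / J x) : C) * ((- (y * x) / J x ^+ 3)%:C + 'i%C * ((J x)^-1)%:C) : C) <= M * (3 * (J x)^-1).
  by rewrite rnormM ler_pM ?rnorm_ge0// (tauM _).2.
rewrite rnormM (le_trans (ler_pM (rnorm_ge0 _) (rnorm_ge0 _) h0 h2))//.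
have -> : coef 0 n.+1 * J x `^ b * (M * (3 * (J x)^-1)) = 3 * coef 0 n.+1 * M * (J x `^ b / J x) by ring.
rewrite ler_wpM2l ?mulr_ge0 ?coef0//.
have -> : J x `^ b / J x = J x `^ (b - n%:R - 1) * J x ^+ n.
  rewrite -powR_mulrn ?(ltW (J0 x))// -powRD ?(gt_eqF (J0 x)) ?implybT//.
  rewrite (_ : b - n%:R - 1 + n%:R = b - 1); last by ring.
  by rewrite powRB ?(gt_eqF (J0 x)) ?implybT// powRr1// ltW.
by rewrite ler_wpM2l ?powR_ge0// lerXn2r ?nnegrE ?(ltW (J0 x)).
Qed.

Lemma dbar_ext_far x y : 2 * J x < `|y| -> dbar F x y = 0.
Proof.
move=> yJ; have [t0 t1] := tau_far yJ.
by rewrite (dbar_ext_formula n sf ct) t0 t1 mul0r !mulr0 add0r mulr0.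
Qed.

Lemma ext_far x y : 2 * J x <= `|y| -> F x y = 0.
Proof.
move=> yJ; rewrite almost_analytic_extE; have [_ _ ->] := ct; first by rewrite mulr0.
by rewrite normrM normfV (gtr0_norm (J0 x)) ler_pdivlMr.
Qed.

End almost_analytic_bounds.

(** * Integrands continuous off the real axis *)

Section off_axis_functions.
Context {R : realType} {E : normedModType R[i]}.
Local Notation mR := (measurableTypeR R).
Context (G : R * R -> E).
Hypothesis cG : forall p, off_axis p -> {for p, continuous G}.
Hypothesis G0 : forall p, ~ off_axis p -> G p = 0.

Lemma off_axis_norm_measurable : norm_measurable (G : mR * mR -> E).
Proof.
move=> e; have mA := open_measurable2 (@open_off_axis R).
rewrite -(setUv (@off_axis R)); apply/measurable_funU => //; first exact: measurableC.
split.
  apply: (continuous_measurable_fun2 (@open_off_axis R)) => p p0.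
  apply: cvg_rnorm; apply: cvgB; [exact: cG|exact: cvg_cst].
apply: (@eq_measurable_fun _ _ _ _ _ (cst (rnorm (0 - e)))); last exact: measurable_cst.
by move=> p; rewrite inE => /G0 ->.
Qed.

(** The sequence consists of 0 and the values of G at the rational points. *)
Lemma off_axis_dense_range : exists e : nat -> E, e 0%N = 0 /\
  forall p (r : R), 0 < r -> exists k, rnorm (G p - e k) < r.
Proof.
pose e k : E := if k is k'.+1 then
  (if @unpickle (rat * rat)%type k' is Some q then G (ratr q.1, ratr q.2) else 0) else 0.
exists e; split => // p r r0; have [p0|p0] := pselect (off_axis p); last first.
  by exists 0%N; rewrite G0// subr0 rnorm0.
have /cvg_rnormP/cvgrPdist_lt/(_ _ r0) := cG p0.
move=> /nbhs_ballP[d /= d0 dG].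
have [q1 q1E] : exists q : rat, ball p.1 d (ratr q).
  have /rat_in_itvoo[q] : p.1 - d < p.1 + d by lra.
  rewrite in_itv/= => /andP[h1 h2]; exists q; rewrite /ball/= ltr_norml.
  by apply/andP; split; lra.
have [q2 q2E] : exists q : rat, ball p.2 d (ratr q).
  have /rat_in_itvoo[q] : p.2 - d < p.2 + d by lra.
  rewrite in_itv/= => /andP[h1 h2]; exists q; rewrite /ball/= ltr_norml.
  by apply/andP; split; lra.
exists (pickle (q1, q2)).+1; rewrite /e pickleK /=.
have := dG (ratr q1, ratr q2) (conj q1E q2E).
by rewrite /= sub0r normrN ger0_norm ?rnorm_ge0// rnorm_distrC.
Qed.

End off_axis_functions.

Section resolvent_plane.
Context {R : realType} {B : completeNormedModType R[i]}.
Context (H : unbounded_op B) (c alpha : R).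
Hypothesis hH : standing_hypothesis H c alpha.
Local Notation z_ p := ((p.1 : R) +i* (p.2 : R)).

Lemma off_axis_resolvent (p : R * R) : off_axis p -> ~ spectrum H (z_ p).
Proof. by have [_ _ h _ _] := hH => /eqP p0 /h/= /p0. Qed.

Lemma continuous_z (p : R * R) : {for p, continuous (fun p : R * R => z_ p : R[i]^o)}.
Proof. by apply/ccontinuousP; split; [exact: cvg_fst|exact: cvg_snd]. Qed.

Lemma continuous_resolvent_z (p : R * R) : off_axis p ->
  {for p, continuous (fun p : R * R => resolvent H (z_ p))}.
Proof.
move=> p0; apply: (@continuous_comp _ _ _ (fun p : R * R => z_ p : R[i]^o) (resolvent H : R[i]^o -> bounded_op B)).
  exact: continuous_z.
apply: resolvent_continuous.
have cI : {for (z_ p : R[i]^o), continuous (fun z : R[i]^o => complex.Im z)}.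
  by have [_ +] := (ccontinuousP (fun z : R[i]^o => z) (z_ p)).1 (@cvg_id _ _).
have : \forall w \near (z_ p : R[i]^o), complex.Im w != 0.
  have oU : open [set y : R | y != 0].
    rewrite (_ : [set y : R | y != 0] = [set~ 0]); last first.
      by apply/seteqP; split=> y /= /eqP.
    by rewrite openC; exact: accessible_closed_set1 (hausdorff_accessible (@Rhausdorff R)) _.
  by apply: (cI [set y : R | y != 0]); apply: open_nbhs_nbhs; split.
apply: filterS => w /eqP w0; have [_ _ h _ _] := hH.
by move/h.
Qed.

Lemma resolvent_opnorm_le (z : R[i]) : complex.Im z != 0 ->
  opnorm (resolvent H z) <= c * `|complex.Im z|^-1 * (bracket z / `|complex.Im z|) `^ alpha.
Proof. by have [_ _ _ _ h] := hH => /eqP/h; rewrite normr_opE lecR. Qed.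

End resolvent_plane.

(** * Domination of the integrand of the functional calculus *)

Section symbol_bounds.
Context {R : realType}.
Local Notation C := (R[i]^o).

(** The symbol classes increase with their order, so the order may be assumed to
    be at least -1, as needed in the Cauchy-Pompeiu formula. *)
Lemma algebraA_bounds (f : R -> R[i]) : algebraA f -> exists b (cc : nat -> R),
  [/\ -1 <= b, b < 0, smooth f & forall k x,
    rnorm (cderive1n k f x : C) <= cc k * bracket x%:C `^ (b - k%:R)].
Proof.
move=> [beta /= beta0 [sf bf]].
have /choice[cc ccP] k : exists c : R, 0 < c /\ forall x,
    `|cderive1n k f x| <= (c * bracket x%:C `^ (beta - k%:R))%:C.
  by have [c c0 cP] := bf k; exists c.
exists (Num.max beta (-1)), cc; split => //.
- by rewrite le_max lexx orbT.
- by rewrite gt_max beta0 oppr_lt0 ltr01.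
move=> k x; have [c0 /(_ x) cP] := ccP k.
rewrite -lecR rnormE (le_trans cP)// lecR ler_wpM2l ?(ltW c0)//.
by apply: ler_powR; [exact: bracket_ge1|rewrite lerD2r le_max lexx].
Qed.

End symbol_bounds.

Section estimates.
Context {R : realType}.
Local Notation C := (R[i]^o).
Context (n : nat) (f tau0 : R -> R[i]) (b : R) (cc : nat -> R).
Hypothesis sf : smooth f.
Hypothesis ct : cutoff tau0.
Hypothesis b0 : b < 0.
Hypothesis fcc : forall k x, rnorm (cderive1n k f x : C) <= cc k * bracket x%:C `^ (b - k%:R).

Local Notation F := (almost_analytic_ext n tau0 f).

Lemma ext_bounds : exists K : R, 0 <= K /\ forall x y,
  [/\ rnorm (F x y : C) <= K * (1 + `|x|) `^ b,
      rnorm (ext_dy n f tau0 x y : C) <= K * (1 + `|x|) `^ (b - 1),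
      rnorm (ext_dx n f tau0 x 0 : C) <= K &
      rnorm (dbar F x y : C) <= K * ((1 + `|x|) `^ (b - n%:R - 1) * `|y| ^+ n)].
Proof.
have [M tauM] := cutoff_bounds ct.
pose coef k m := \sum_(r < m) cc (k + r) * 2 ^+ r.
pose k1 := coef 0 n.+1 * M; pose k2 := (coef 1 n + coef 0 n.+1) * M.
pose k3 := coef 1 n.+1 * M; pose k4 := cc n.+1 * M + 3 * coef 0 n.+1 * M.
have H1 x y : rnorm (F x y : C) <= k1 * bracket x%:C `^ b by exact: rnorm_ext.
have H2 x y : rnorm (ext_dy n f tau0 x y : C) <= k2 * bracket x%:C `^ (b - 1) by exact: rnorm_ext_dy.
have H3 x : rnorm (ext_dx n f tau0 x 0 : C) <= k3 by exact: (rnorm_ext_dx0 n b0 fcc tauM).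
have H4 x y : rnorm (dbar F x y : C) <= k4 * (bracket x%:C `^ (b - n%:R - 1) * `|y| ^+ n).
  exact: rnorm_dbar_ext.
(* Powers of 2 come from replacing brackets by 1 + |x|. *)
pose K := `|k1| * 2 `^ (- b) + `|k2| * 2 `^ (- (b - 1)) + `|k3| + `|k4| * 2 `^ (- (b - n%:R - 1)).
have p1 : 0 <= `|k1| * 2 `^ (- b) by rewrite mulr_ge0 ?powR_ge0.
have p2 : 0 <= `|k2| * 2 `^ (- (b - 1)) by rewrite mulr_ge0 ?powR_ge0.
have p4 : 0 <= `|k4| * 2 `^ (- (b - n%:R - 1)) by rewrite mulr_ge0 ?powR_ge0.
have p3 : 0 <= `|k3| by [].
have conv (k s x : R) : s <= 0 -> k * bracket x%:C `^ s <= `|k| * 2 `^ (- s) * (1 + `|x|) `^ s.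
  move=> s0; rewrite (le_trans (ler_wpM2r (powR_ge0 _ _) (ler_norm k)))// -mulrA.
  by rewrite ler_wpM2l// powR_bracket_le.
have n0 : 0 <= n%:R :> R by [].
have b0' := ltW b0.
have s2 : b - 1 <= 0 by lra.
have s4 : b - n%:R - 1 <= 0 by lra.
exists K; split; first by rewrite /K !addr_ge0.
move=> x y; split.
- rewrite (le_trans (H1 x y))// (le_trans (conv _ _ _ (ltW b0)))//.
  by rewrite ler_wpM2r ?powR_ge0// /K; lra.
- rewrite (le_trans (H2 x y))// (le_trans (conv _ _ _ s2))//.
  by rewrite ler_wpM2r ?powR_ge0// /K; lra.
- by rewrite (le_trans (H3 x))// (le_trans (ler_norm k3))// /K; lra.
- rewrite (le_trans (H4 x y))// mulrA [leRHS]mulrA ler_wpM2r ?exprn_ge0//.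
  rewrite (le_trans (conv _ _ _ s4))//.
  by rewrite ler_wpM2r ?powR_ge0// /K; lra.
Qed.

Hypothesis n0 : (0 < n)%N.

Lemma dbar_ext_axis x : dbar F x 0 = 0.
Proof.
have [K [_ /(_ x 0)[_ _ _]]] := ext_bounds.
rewrite normr0 expr0n eqn0Ngt n0/= !mulr0 => h.
by apply: (@rnorm_eq0 R C); apply/eqP; rewrite eq_le h rnorm_ge0.
Qed.

Lemma bracket_strip (x y : R) : `|y| <= 2 * bracket x%:C ->
  bracket (x +i* y) <= 3 * (1 + `|x|).
Proof.
move=> yJ; have J0 := bracket_gt0 x.
have h : bracket (x +i* y) <= 3 * bracket x%:C.
  rewrite /bracket -/(bracket x%:C) normc_def /= sqr_sqrtr ?addr_ge0 ?sqr_ge0//.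
  have -> : 3 * bracket x%:C = Num.sqrt ((3 * bracket x%:C) ^+ 2).
    by rewrite sqrtr_sqr ger0_norm// mulr_ge0// ltW.
  apply: ler_wsqrtr; rewrite exprMn bracket_sqr.
  have : y ^+ 2 <= (2 * bracket x%:C) ^+ 2.
    by rewrite -(real_normK (num_real y)) lerXn2r ?nnegrE// mulr_ge0// ltW.
  rewrite exprMn bracket_sqr; have := sqr_ge0 x; lra.
by rewrite (le_trans h)// ler_wpM2l// bracket_le_norm1.
Qed.

Context {B : completeNormedModType R[i]} (H : unbounded_op B) (c alpha : R).
Hypothesis hH : standing_hypothesis H c alpha.
Hypothesis hn : alpha < n%:R.

(** Both factors |R(z)| and 1 / |y| are at most a constant times
    W = |y|^(-1) ((1 + |x|) / |y|)^alpha on the support of the extension, and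
    the bound of dbar F times W is the strip weight. *)
Lemma dbar_ext_dominated : exists K : R, 0 <= K /\ forall p : R * R, off_axis p ->
  rnorm (dbar F p.1 p.2 : C) * opnorm (resolvent H (p.1 +i* p.2)) <=
    K * strip_weight b (n%:R - alpha) p /\
  rnorm (dbar F p.1 p.2 : C) * `|p.2|^-1 <= K * strip_weight b (n%:R - alpha) p.
Proof.
have [_ _ _ [c0 a0] _] := hH.
have [K [K0 KP]] := ext_bounds.
pose K' := K * ((c + 1) * 3 `^ alpha).
have K'0 : 0 <= K' by rewrite !mulr_ge0 ?powR_ge0// addr_ge0// ltW.
exists K'; split => // -[x y] /= y0.
have [yJ|yJ] := leP `|y| (2 * bracket x%:C); last first.
  by rewrite (dbar_ext_far _ sf ct yJ) rnorm0 !mul0r mulr_ge0// strip_weight_ge0.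
have [_ _ _ dK] := KP x y.
set m := 1 + `|x| in dK *.
have m0 : 0 < m by rewrite ltr_pwDl.
have y0' : 0 < `|y| by rewrite normr_gt0.
have yV0 : 0 <= `|y|^-1 by rewrite invr_ge0.
have ym : `|y| <= 2 * m by rewrite (le_trans yJ)// ler_wpM2l// bracket_le_norm1.
have zm : bracket (x +i* y) <= 3 * m by exact: bracket_strip.
pose W := `|y|^-1 * (3 `^ alpha * m `^ alpha * (`|y| `^ alpha)^-1).
have key : (3 * m / `|y|) `^ alpha = 3 `^ alpha * m `^ alpha * (`|y| `^ alpha)^-1.
  rewrite powRM ?invr_ge0 ?mulr_ge0 ?(ltW m0)// powRM ?(ltW m0)//; congr (_ * _).
  by rewrite -powRN -mulN1r powRrM powR_inv1// ltW.
have R1 : opnorm (resolvent H (x +i* y)) <= c * W.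
  rewrite (le_trans (resolvent_opnorm_le hH _))//= /W -key mulrA.
  apply: ler_wpM2l; first by rewrite mulr_ge0// ltW.
  apply: ge0_ler_powR; rewrite ?nnegrE ?divr_ge0 ?mulr_ge0 ?(ltW m0) ?(ltW y0')//.
    by rewrite sqrtr_ge0.
  by rewrite ler_wpM2r.
have R2 : `|y|^-1 <= W.
  rewrite /W -key ler_peMr// (@le_trans _ _ ((3 * m / `|y|) `^ 0))//; first by rewrite powRr0.
  by apply: ler_powR => //; rewrite ler_pdivlMr// mul1r; lra.
have W0 : 0 <= W by rewrite (le_trans yV0).
have sw : m `^ (b - n%:R - 1) * `|y| ^+ n * W = 3 `^ alpha * strip_weight b (n%:R - alpha) (x, y).
  rewrite /strip_weight /W /= indicE mem_set/=; last by rewrite y0' ym.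
  rewrite -/m mulr1.
  have -> : b - (n%:R - alpha) - 1 = (b - n%:R - 1) + alpha by ring.
  have -> : n%:R - alpha - 1 = n%:R - (alpha + 1) by ring.
  have e1 : m `^ (b - n%:R - 1 + alpha) = m `^ (b - n%:R - 1) * m `^ alpha.
    by rewrite powRD// (gt_eqF m0) implybT.
  have e2 : `|y| `^ (n%:R - (alpha + 1)) = `|y| ^+ n / (`|y| `^ alpha * `|y|).
    rewrite powRB ?(gt_eqF y0') ?implybT// powRD ?(gt_eqF y0') ?implybT//.
    by rewrite powRr1 ?(ltW y0')// powR_mulrn// ltW.
  rewrite e1 e2; have ya : `|y| `^ alpha != 0 by rewrite gt_eqF// powR_gt0.
  by field; rewrite ya gt_eqF.
have ineq A a : 0 <= A -> A <= a * W -> 0 <= a -> a <= c + 1 ->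
    rnorm (dbar F x y : C) * A <= K' * strip_weight b (n%:R - alpha) (x, y).
  move=> A0 AW ha ac.
  have AW' : A <= (c + 1) * W by rewrite (le_trans AW)// ler_wpM2r.
  rewrite (le_trans (ler_pM (rnorm_ge0 _) A0 dK AW'))//.
  have -> : K * (m `^ (b - n%:R - 1) * `|y| ^+ n) * ((c + 1) * W) =
     K * (c + 1) * (m `^ (b - n%:R - 1) * `|y| ^+ n * W) by ring.
  by rewrite sw /K'; rewrite le_eqVlt; apply/orP; left; apply/eqP; ring.
split.
- by apply: (ineq _ c) => //; [exact: opnorm_ge0|exact: ltW|rewrite lerDl].
- by apply: (ineq _ 1) => //; [rewrite mul1r|rewrite lerDr ltW].
Qed.

End estimates.

(** * The Cauchy-Pompeiu formula for the extension *)

Section cauchy_pompeiu_complex.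
Context {R : realType}.
Local Notation C := (R[i]^o).
Context (n : nat) (f tau0 : R -> R[i]) (b : R) (cc : nat -> R) (l : R).
Hypothesis n0 : (0 < n)%N.
Hypothesis sf : smooth f.
Hypothesis ct : cutoff tau0.
Hypothesis b1 : -1 <= b.
Hypothesis b0 : b < 0.
Hypothesis fcc : forall k x, rnorm (cderive1n k f x : C) <= cc k * bracket x%:C `^ (b - k%:R).

Local Notation F := (almost_analytic_ext n tau0 f).

Definition cauchy_integrand (p : R * R) : C :=
  dbar F p.1 p.2 * (p.1 +i* p.2 - l%:C)^-1.

Let P1 x y := complex.Re (ext_dx n f tau0 x y).
Let Q1 x y := complex.Im (ext_dx n f tau0 x y).
Let P2 x y := complex.Re (ext_dy n f tau0 x y).
Let Q2 x y := complex.Im (ext_dy n f tau0 x y).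

Lemma inv_complexE (s y : R) :
  (s +i* y)^-1 = (s / (s ^+ 2 + y ^+ 2)) +i* (- (y / (s ^+ 2 + y ^+ 2))).
Proof. by []. Qed.

(** The imaginary part is the real part for - i F, that is, for the pair (Q, - P)
    instead of (P, Q). *)
Lemma cauchy_integrandE p : cauchy_integrand p =
  dbar_quot_re P1 P2 Q1 Q2 l p.1 p.2 +i*
  dbar_quot_re Q1 Q2 (fun x y => - P1 x y) (fun x y => - P2 x y) l p.1 p.2.
Proof.
have half : (2^-1 : R[i]) = (2^-1)%:C by rewrite fmorphV rmorph_nat.
case: p => x y; rewrite /cauchy_integrand /fst /snd (dbar_extE n sf ct) half.
have -> : x +i* y - l%:C = (x - l) +i* y by simpc.
rewrite inv_complexE /dbar_quot_re /P1 /P2 /Q1 /Q2 /sqdist.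
case: (ext_dx _ _ _ _ _) => p1 q1; case: (ext_dy _ _ _ _ _) => p2 q2.
by simpc; apply/eqP; rewrite eq_complex /=; apply/andP; split; apply/eqP; ring.
Qed.

Lemma continuous_cauchy_integrand p : off_axis p -> {for p, continuous cauchy_integrand}.
Proof.
move=> p0; apply: ccontinuous_mul; first exact: continuous_dbar_ext.
apply: ccontinuous_inv; last by apply: ccontinuous_sub; [exact: continuous_z|exact: ccontinuous_cst].
by rewrite eq_complex /= subr0 negb_and [X in _ || X]p0 orbT.
Qed.

Lemma cauchy_integrand_axis p : ~ off_axis p -> cauchy_integrand p = 0.
Proof.
case: p => x y; rewrite /off_axis /= => /negP; rewrite negbK => /eqP ->.
by rewrite /cauchy_integrand /= (dbar_ext_axis sf ct b0 fcc n0) mul0r.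
Qed.

Context (g : R * R -> R).
Hypothesis ig : (lebesgue2 R).-integrable setT (EFin \o g).
Hypothesis fg : forall p, rnorm (cauchy_integrand p) <= g p.

(** The real formula is applied to F and to - i F, whose values on the real axis
    are f and - i f. *)
Lemma cauchy_pompeiu_ext w : is_bochner_integral (lebesgue2 R) cauchy_integrand w ->
  w = - pi%:C * f l.
Proof.
have := b1 => b1'; have := b0 => b0'.
move=> wP.
have mc := off_axis_norm_measurable continuous_cauchy_integrand cauchy_integrand_axis.
have [K [K0 KP]] := ext_bounds n sf ct b0 fcc.
have Fl : F l 0 = f l.
  have [_ t1 _] := ct; rewrite almost_analytic_extE mul0r t1 ?normr0//.
  rewrite mulr1 /taylor big_ord_recl /= expr0 mulr1 fact0 divr1 big1 ?addr0.
    by rewrite /cderive1n /=; case: (f l).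
  by move=> r _; rewrite mulr0 expr0n /= mulr0 mul0r.
have dx x y := is_cderive_ext_dx n sf ct x y.
have dy x y := is_cderive_ext_dy n f ct x y.
have cF (p : R * R) := (ccontinuousP _ _).1 (@continuous_ext _ n _ _ sf ct p).
have cFx (p : R * R) := (ccontinuousP _ _).1 (@continuous_ext_dx _ n _ _ sf ct p).
have cFy (p : R * R) := (ccontinuousP _ _).1 (@continuous_ext_dy _ n _ _ sf ct p).
have cneg (W : R -> R -> R) : continuous (fun p : R * R => W p.1 p.2) ->
    continuous (fun p : R * R => - W p.1 p.2).
  by move=> cW p; apply: cvgN; exact: cW.
have supp x y : 2 * (1 + `|x|) <= `|y| -> F x y = 0.
  by move=> h; apply: ext_far => //; apply: le_trans h; rewrite ler_wpM2l// bracket_le_norm1.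
have re_axis x : dbar_quot_re P1 P2 Q1 Q2 l x 0 = 0 /\
    dbar_quot_re Q1 Q2 (fun x y => - P1 x y) (fun x y => - P2 x y) l x 0 = 0.
  have := cauchy_integrandE (x, 0); rewrite cauchy_integrand_axis ?/off_axis /= ?eqxx//.
  by move=> [<- <-].
have Relin (r : R) (z z' : C) : complex.Re (r%:C *: z + z') = r * complex.Re z + complex.Re z'.
  by case: z z' => u v [u' v']; rewrite /GRing.scale/= mul0r subr0.
have Imlin (r : R) (z z' : C) : complex.Im (r%:C *: z + z') = r * complex.Im z + complex.Im z'.
  by case: z z' => u v [u' v']; rewrite /GRing.scale/= mul0r addr0.
have meas (h : C -> R) : (forall p, off_axis p -> {for p, continuous (fun p => h (cauchy_integrand p))}) ->
    h 0 = 0 -> (forall z, `|h z| <= rnorm z) ->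
    (lebesgue2 R).-integrable setT (fun p => (h (cauchy_integrand p))%:E).
  move=> ch h0 hle; have mA := open_measurable2 (@open_off_axis R).
  apply: le_integrable ig => //.
    apply/measurable_EFinP; rewrite -(setUv (@off_axis R)).
    apply/measurable_funU => //; first exact: measurableC.
    split; first exact: continuous_measurable_fun2 (@open_off_axis R) ch.
    apply: (@eq_measurable_fun _ _ _ _ _ (cst (0 : R))); last exact: measurable_cst.
    by move=> p; rewrite inE => /cauchy_integrand_axis ->; rewrite h0.
  move=> p _ /=; rewrite lee_fin (le_trans (hle _))// (le_trans (fg p))//.
  exact: ler_norm.
have intR := meas (@complex.Re R) (fun p p0 =>
  ((ccontinuousP _ _).1 (continuous_cauchy_integrand p0)).1) erefl (@ler_Re_rnorm R).
have intI := meas (@complex.Im R) (fun p p0 =>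
  ((ccontinuousP _ _).1 (continuous_cauchy_integrand p0)).2) erefl (@ler_Im_rnorm R).
have ReP := functional_bochner_integral Relin (@ler_Re_rnorm R) wP mc intR.
have ImP := functional_bochner_integral Imlin (@ler_Im_rnorm R) wP mc intI.
have ReE p : complex.Re (cauchy_integrand p) = dbar_quot_re P1 P2 Q1 Q2 l p.1 p.2.
  by rewrite cauchy_integrandE.
have ImE p : complex.Im (cauchy_integrand p) =
    dbar_quot_re Q1 Q2 (fun x y => - P1 x y) (fun x y => - P2 x y) l p.1 p.2.
  by rewrite cauchy_integrandE.
have cP : continuous (fun p : R * R => complex.Re (F p.1 p.2)) by move=> p; case: (cF p).
have cQ : continuous (fun p : R * R => complex.Im (F p.1 p.2)) by move=> p; case: (cF p).
have cP1 : continuous (fun p : R * R => P1 p.1 p.2) by move=> p; case: (cFx p).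
have cQ1 : continuous (fun p : R * R => Q1 p.1 p.2) by move=> p; case: (cFx p).
have cP2 : continuous (fun p : R * R => P2 p.1 p.2) by move=> p; case: (cFy p).
have cQ2 : continuous (fun p : R * R => Q2 p.1 p.2) by move=> p; case: (cFy p).
have bF x y : `|complex.Re (F x y)| <= K * (1 + `|x|) `^ b /\
    `|complex.Im (F x y)| <= K * (1 + `|x|) `^ b.
  have [h _ _ _] := KP x y.
  by split; apply: le_trans h; [exact: ler_Re_rnorm|exact: ler_Im_rnorm].
have bF2 x y : `|P2 x y| <= K * (1 + `|x|) `^ (b - 1) /\
    `|Q2 x y| <= K * (1 + `|x|) `^ (b - 1).
  have [_ h _ _] := KP x y.
  by split; apply: le_trans h; [exact: ler_Re_rnorm|exact: ler_Im_rnorm].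
have bF1 x : `|P1 x 0| <= K /\ `|Q1 x 0| <= K.
  have [_ _ h _] := KP x 0.
  by split; apply: le_trans h; [exact: ler_Re_rnorm|exact: ler_Im_rnorm].
have supp0 x y : 2 * (1 + `|x|) <= `|y| -> complex.Re (F x y) = 0 /\ complex.Im (F x y) = 0.
  by move=> /supp ->.
have RCP := @cauchy_pompeiu_re R (fun x y => complex.Re (F x y)) (fun x y => complex.Im (F x y))
  P1 P2 Q1 Q2 l K b (fun x y => (dx x y).1) (fun x y => (dy x y).1)
  (fun x y => (dx x y).2) (fun x y => (dy x y).2) cP cQ cP1 cP2 cQ1 cQ2 b1 b0
  (fun x y => (bF x y).1) (fun x y => (bF x y).2) (fun x y => (bF2 x y).1)
  (fun x y => (bF2 x y).2) (fun x => (bF1 x).1) supp0 (fun x => (re_axis x).1) g ig.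
have ICP := @cauchy_pompeiu_re R (fun x y => complex.Im (F x y)) (fun x y => - complex.Re (F x y))
  Q1 Q2 (fun x y => - P1 x y) (fun x y => - P2 x y) l K b
  (fun x y => (dx x y).2) (fun x y => (dy x y).2)
  (fun x y => is_deriveN (dx x y).1) (fun x y => is_deriveN (dy x y).1)
  cQ (cneg (fun x y => complex.Re (F x y)) cP) cQ1 cQ2 (cneg P1 cP1) (cneg P2 cP2) b1 b0.
have {}RCP : (\int[lebesgue2 R]_p (dbar_quot_re P1 P2 Q1 Q2 l p.1 p.2)%:E =
    (- pi * complex.Re (f l))%:E)%E.
  rewrite -Fl; apply: RCP => p; rewrite -ReE.
  by rewrite (le_trans (ler_Re_rnorm _)).
have {}ICP : (\int[lebesgue2 R]_p (dbar_quot_re Q1 Q2 (fun x y => - P1 x y) (fun x y => - P2 x y) l p.1 p.2)%:E =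
    (- pi * complex.Im (f l))%:E)%E.
  rewrite -Fl; apply: (ICP _ _ _ _ _ _ _ g ig).
  - by move=> x y; case: (bF x y).
  - by move=> x y; rewrite normrN; case: (bF x y).
  - by move=> x y; case: (bF2 x y).
  - by move=> x y; rewrite normrN; case: (bF2 x y).
  - by move=> x; case: (bF1 x).
  - by move=> x y /supp ->; rewrite oppr0.
  - by move=> x; case: (re_axis x).
  - by move=> p; rewrite -ImE (le_trans (ler_Im_rnorm _)).
have {}ReP : complex.Re w = - pi * complex.Re (f l).
  by apply: EFin_inj; rewrite ReP -RCP; apply: eq_integral => p _; rewrite ReE.
have {}ImP : complex.Im w = - pi * complex.Im (f l).
  by apply: EFin_inj; rewrite ImP -ICP; apply: eq_integral => p _; rewrite ImE.
apply/eqP; rewrite eq_complex -rmorphN /= ReP ImP.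
by case: (f l) => u v /=; rewrite !mul0r subr0 addr0 !eqxx.
Qed.

End cauchy_pompeiu_complex.

(** * The spectral inclusion *)

Section spectral_inclusion.
Context {R : realType} {B : completeNormedModType R[i]}.
Local Notation C := (R[i]^o).
Local Notation mR := (measurableTypeR R).

Lemma off_axis_bochner_exists (E : normedModType R[i]) (G : R * R -> E) (g : R * R -> R) :
  seq_complete E ->
  (forall p, off_axis p -> {for p, continuous G}) ->
  (forall p, ~ off_axis p -> G p = 0) ->
  (lebesgue2 R).-integrable setT (EFin \o g) ->
  (forall p, rnorm (G p) <= g p) ->
  exists v, is_bochner_integral (lebesgue2 R) G v.
Proof.
move=> cE cG G0 ig Gg.
have mG := off_axis_norm_measurable cG G0.
have [e [e0 eG]] := off_axis_dense_range cG G0.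
apply: (bochner_exists cE mG e0 eG).
have : (lebesgue2 R).-integrable setT (fun p => (rnorm (G p))%:E).
  apply: le_integrable ig => //; first exact/measurable_EFinP/measurable_rnorm.
  move=> p _; rewrite /= lee_fin ger0_norm ?rnorm_ge0// (le_trans (Gg p))//.
  exact: ler_norm.
move/integrableP => [_]; apply: le_lt_trans; rewrite le_eqVlt; apply/orP; left; apply/eqP.
by apply: eq_integral => p _; rewrite gee0_abs// lee_fin rnorm_ge0.
Qed.

Context (H : unbounded_op B) (c alpha : R) (n : nat) (f tau0 : R -> R[i]).
Hypothesis hH : standing_hypothesis H c alpha.
Hypothesis hf : algebraA f.
Hypothesis hn : alpha < n%:R.
Hypothesis ct : cutoff tau0.

Lemma off_spectrum_near (l d : R) : 0 < d ->
  exists z, rnorm (z - l%:C : C) <= d /\ ~ spectrum H z.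
Proof.
move=> d0; exists (l +i* d); split; last first.
  by apply: (off_axis_resolvent hH (p := (l, d))); rewrite /off_axis /= gt_eqF.
have -> : l +i* d - l%:C = 0 +i* d by simpc.
by rewrite (le_trans (rnorm_ler_ReIm _))//= normr0 add0r gtr0_norm.
Qed.

Lemma norm_cauchy_kernel_le (p : R * R) (l : R) : off_axis p ->
  rnorm ((p.1 +i* p.2 - l%:C)^-1 : C) <= `|p.2|^-1.
Proof.
case: p => x y; rewrite /off_axis /= => y0.
have z0 : x +i* y - l%:C != 0 by rewrite eq_complex /= subr0 (negbTE y0) andbF.
have y0' : 0 < `|y| by rewrite normr_gt0.
have yz : `|y| <= rnorm (x +i* y - l%:C : C).
  by apply: le_trans (ler_Im_rnorm _); rewrite /= subr0.
have h : rnorm ((x +i* y - l%:C)^-1 : C) * rnorm (x +i* y - l%:C : C) = 1.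
  by rewrite -rnormM mulVf// -[1]/(1%:C) rnorm_real normr1.
have z1 : 0 < rnorm (x +i* y - l%:C : C) by rewrite (lt_le_trans y0').
by rewrite -(ler_pM2r z1) h ler_pdivlMl// mulr1.
Qed.

(** The difference is the integral of dbar F (R(z) x_k - x_k / (z - l)) up to a
    constant; its integrand tends to 0 off the real axis and is dominated
    because x_k has norm 1. *)
Lemma functional_calculus_eigen_cvg (l : R) (x : nat -> B) :
  (forall k, op_dom H (x k)) -> (forall k, rnorm (x k) = 1) ->
  (forall k, rnorm (H (x k) - l%:C *: x k) <= k.+1%:R^-1) ->
  rnorm (f l *: x k - functional_calculus n tau0 H f (x k)) @[k --> \oo] --> (0 : R).
Proof.
move=> xD x1 xl.
have [_ _ _ [c0 a0] _] := hH.
have n0 : (0 < n)%N by rewrite -(ltr0n R) (le_lt_trans a0).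
have t0 : 0 < n%:R - alpha by rewrite subr_gt0.
have [b [cc [b1 b0 sf fcc]]] := algebraA_bounds hf.
have [K [K0 KP]] := dbar_ext_dominated n sf ct b0 fcc hH.
pose D p : C := dbar (almost_analytic_ext n tau0 f) p.1 p.2.
pose G p : bounded_op B := D p *: resolvent H (p.1 +i* p.2).
pose phi := cauchy_integrand n f tau0 l.
pose g p := K * strip_weight b (n%:R - alpha) p.
have ig : (lebesgue2 R).-integrable setT (EFin \o g).
  have := integrable_strip_weight (R := R) b0 t0.
  by move=> /(integrableZl measurableT K).
have g0 p : 0 <= g p by rewrite mulr_ge0// strip_weight_ge0.
have cG p : off_axis p -> {for p, continuous G}.
  by move=> p0; apply: cvgZ; [exact: (continuous_dbar_ext sf ct)|exact: (@continuous_resolvent_z _ _ H c alpha hH p p0)].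
have G0 p : ~ off_axis p -> G p = 0.
  case: p => u v; rewrite /off_axis /= => /negP; rewrite negbK => /eqP ->.
  by rewrite /G /D /= (dbar_ext_axis sf ct b0 fcc n0) scale0r.
have Gg p : rnorm (G p) <= g p.
  have [p0|p0] := pselect (off_axis p); last by rewrite (G0 _ p0) rnorm0.
  by rewrite rnormZ; exact: (KP p p0).1.
have cphi p : off_axis p -> {for p, continuous phi}.
  exact: continuous_cauchy_integrand.
have phi0 p : ~ off_axis p -> phi p = 0.
  exact: (cauchy_integrand_axis l n0 sf ct b0 fcc).
have phig p : rnorm (phi p) <= g p.
  have [p0|p0] := pselect (off_axis p); last by rewrite (phi0 _ p0) rnorm0.
  rewrite rnormM (le_trans _ (KP p p0).2)// ler_wpM2l ?rnorm_ge0//.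
  exact: norm_cauchy_kernel_le.
have [V VP] := off_axis_bochner_exists (@seq_complete_op R B) cG G0 ig Gg.
have [w wP] := off_axis_bochner_exists (@seq_complete_complex R) cphi phi0 ig phig.
have wE := cauchy_pompeiu_ext n0 sf ct b1 b0 fcc ig phig wP.
set W := bochner_integral (lebesgue2 R) G.
have {V VP}WP : is_bochner_integral (lebesgue2 R) G W by exact: xgetI VP.
have mG := off_axis_norm_measurable cG G0.
have mphi := off_axis_norm_measurable cphi phi0.
pose delta k p := G p (x k) - phi p *: x k.
have cdelta k p : off_axis p -> {for p, continuous (delta k)}.
  move=> p0; apply: cvgB; last by apply: cvgZr_tmp; exact: cphi.
  apply/cvg_rnormP; have /cvg_rnormP := cG p p0.
  apply: squeeze_cvgr; last exact: cvg_cst.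
  near=> q; rewrite rnorm_ge0 /=.
  by have := opnormP (G q - G p) (x k); rewrite x1 mulr1.
have delta0 k p : ~ off_axis p -> delta k p = 0.
  by move=> p0; rewrite /delta (G0 _ p0) (phi0 _ p0) scale0r subr0.
have mdelta k := off_axis_norm_measurable (cdelta k) (delta0 k).
pose I k := (\int[lebesgue2 R]_p (rnorm (delta k p))%:E)%E.
have dom k : ((rnorm (W (x k) - w *: x k))%:E <= I k)%E.
  by apply: bochner_apply_sub_le WP wP mG mphi (mdelta k).
have deltag k p : rnorm (delta k p) <= g p + g p.
  apply: le_trans (rnormB _ _) _; apply: lerD.
    by rewrite (le_trans _ (Gg p))// (le_trans (opnormP _ _))// x1 mulr1.
  by rewrite rnormZ x1 mulr1; exact: phig.
have delta_cvg p : rnorm (delta k p) @[k --> \oo] --> (0 : R).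
  have [p0|p0] := pselect (off_axis p); last first.
    by under eq_fun do rewrite delta0// rnorm0; exact: cvg_cst.
  have nz := off_axis_resolvent hH p0.
  have zl : p.1 +i* p.2 != l%:C by rewrite eq_complex /= [X in _ && X](negbTE p0) andbF.
  pose A := rnorm (D p) * (opnorm (resolvent H (p.1 +i* p.2)) *
     rnorm ((p.1 +i* p.2 - l%:C)^-1 : C)).
  have Ak : (A * k.+1%:R^-1 : R) @[k --> \oo] --> (0 : R).
    rewrite -[X in _ --> X](mulr0 A); apply: cvgMl_tmp; exact: cvg_harmonic.
  apply: (squeeze_cvgr _ (cvg_cst 0) Ak); near=> k; rewrite rnorm_ge0/=.
  have -> : delta k p = D p *: (resolvent H (p.1 +i* p.2) (x k) -
      (p.1 +i* p.2 - l%:C)^-1 *: x k) by rewrite scalerBr scalerA.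
  rewrite rnormZ -[X in X * _]/(rnorm (D p)) /A -mulrA ler_wpM2l ?rnorm_ge0//.
  rewrite (le_trans (resolvent_eigen_approx nz zl (xD k)))//.
  by rewrite ler_wpM2l// mulr_ge0 ?opnorm_ge0 ?rnorm_ge0.
have I0 : I k @[k --> \oo] --> (0 : \bar R).
  have [] := @dominated_convergence _ (mR * mR)%type R (lebesgue2 R) setT measurableT
    (fun k p => (rnorm (delta k p))%:E) (cst 0%E) (fun p => ((g p)%:E + (g p)%:E)%E).
  - by move=> k; apply/measurable_EFinP/measurable_rnorm; exact: mdelta.
  - exact: measurable_cst.
  - by apply/aeW => p _; apply: cvg_EFin; [exact: nearW|exact: delta_cvg].
  - by apply: integrableD.
  - by apply/aeW => p k _; rewrite gee0_abs ?lee_fin ?rnorm_ge0// -EFinD lee_fin.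
  by move=> _ _; rewrite integral0.
have Wk : rnorm (W (x k) - w *: x k) @[k --> \oo] --> (0 : R).
  apply: (@fine_cvg _ _ _ _ (fun k => (rnorm (W (x k) - w *: x k))%:E)).
  apply: (squeeze_cvge _ (cvg_cst 0%E) I0); near=> k.
  by rewrite lee_fin rnorm_ge0 dom.
have fE k : rnorm (f l *: x k - functional_calculus n tau0 H f (x k)) =
    pi^-1 * rnorm (W (x k) - w *: x k).
  rewrite /functional_calculus -/D -/G -/W bounded_opZE.
  have -> : f l *: x k = - (pi^-1)%:C *: (w *: x k).
    rewrite scalerA wE mulrA mulrNN -rmorphM mulVf ?gt_eqF ?pi_gt0//.
    by rewrite mul1r.
  rewrite -scalerBr rnormZ rnorm_distrC; congr (_ * _).
  by rewrite normrN -(rnormc (pi^-1)%:C) rnorm_real ger0_norm// invr_ge0 pi_ge0.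
under eq_fun do rewrite fE.
have := @cvgMl_tmp R _ _ _ _ (pi^-1) _ Wk; rewrite mulr0; exact.
Unshelve. all: by end_near.
Qed.

(** A bounded inverse S would give 1 = |x_k| <= |S| |f(l) x_k - f(H) x_k| for the
    approximate eigenvectors x_k, and the right-hand side tends to 0. *)
Lemma functional_calculus_no_resolvent (l : R) (S : bounded_op B) :
  spectrum H l%:C ->
  ~ is_resolvent (op_of_bounded (functional_calculus n tau0 H f)) (f l) S.
Proof.
move=> Hl [_ SP].
have /choice[x xP] (k : nat) : exists x, [/\ op_dom H x, rnorm x = 1 &
    rnorm (H x - l%:C *: x) <= k.+1%:R^-1].
  by apply: approximate_eigenvector => //; exact: off_spectrum_near.
have x1 k : rnorm (x k) = 1 by case: (xP k).
have := @functional_calculus_eigen_cvg l x (fun k => let: And3 h _ _ := xP k in h) x1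
  (fun k => let: And3 _ _ h := xP k in h).
move=> cv0.
have cv : opnorm S * rnorm (f l *: x k - functional_calculus n tau0 H f (x k)) @[k --> \oo]
    --> opnorm S * 0 by exact: cvgMl_tmp.
rewrite mulr0 in cv.
have le1 k : 1 <= opnorm S * rnorm (f l *: x k - functional_calculus n tau0 H f (x k)).
  by rewrite -[leLHS](x1 k) -{1}(SP (x k) I) opnormP.
suff : (1 : R) <= 0 by rewrite ler10.
by apply: (ler_cvg_to (cvg_cst (1 : R)) cv); near=> k; exact: le1.
Unshelve. all: by end_near.
Qed.

End spectral_inclusion.

Theorem theorem4p6 (R : realType) (B : completeNormedModType R[i])
    (H : unbounded_op B) (c alpha : R) (hH : standing_hypothesis H c alpha)
    (f : R -> R[i]) (hf : algebraA f)
    (n : nat) (hn : alpha < n%:R) (tau0 : R -> R[i]) (htau0 : cutoff tau0) :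
  closure (f @` [set x : R | spectrum H x%:C] : set R[i]^o) `<=`
    spectrum (op_of_bounded (functional_calculus n tau0 H f)).
Proof.
move=> mu mu_cl [T TP].
(* The resolvent T at mu reaches every point within 1 / (|T| + 1), among which
   there is a value f(l). *)
have d0 : 0 < (opnorm T + 1)^-1 by rewrite invr_gt0 ltr_wpDl ?opnorm_ge0.
have nb : nbhs (mu : R[i]^o) [set w | rnorm (w - mu : R[i]^o) < (opnorm T + 1)^-1].
  have : idfun @ nbhs (mu : R[i]^o) --> (mu : R[i]^o) by exact: cvg_id.
  move=> /cvg_rnormP/cvgrPdist_lt/(_ _ d0).
  by apply: filterS => w; rewrite sub0r normrN ger0_norm// rnorm_ge0.
have [_ [[l /= Hl <-] flmu]] := mu_cl _ nb.
have [S SP] : exists S,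
    is_resolvent (op_of_bounded (functional_calculus n tau0 H f)) (f l) S.
  apply: is_resolvent_near TP _.
  rewrite (le_lt_trans (ler_wpM2r (opnorm_ge0 T) (ltW flmu)))//.
  by rewrite ltr_pdivrMl ?mulr1 ?ltrDl// ltr_wpDl ?opnorm_ge0.
exact: (functional_calculus_no_resolvent hH hf hn htau0 Hl SP).
Qed.
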